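(* Let $L_1,\dots,L_M\in\mathbb{N}$ and $q_1,\dots,q_M\in\mathbb{R}[x]$ with $\deg q_j<2L_j$, $q_j(0)=0$; let $P=\prod_{j=1}^M(y+q_j(x)+ix^{2L_j})$, $A=\tfrac12(P+\bar P)$, $B=\tfrac1{2i}(P-\bar P)$. Fix $1\le\mathfrak{p}<\infty$ and a proper $t\in\mathbb{R}$, so $A+tB=u\prod_{j}(y-a_j(x;t))$ with $-a_j(x;t)=q_j(x)+x^{2L_j}\psi_j(x;t)$. Then there is a relabeling of the indices $1,\dots,M$ (of the factors of $P$, together with the corresponding branches $a_j$) such that, with $F_k=(A+tB)/\prod_{j=1}^k(y-a_j(x;t))$, the following holds: every $Q\in\mathbb{C}\{x,y\}$ has a unique representative modulo $(P,\bar P)$ of the form $$Q\equiv\sum_{k=1}^Mc_k(x)F_k(x,y),\qquad c_k\in\mathbb{C}[x],\ \deg c_k<2L_k+\sum_{j\ne k}O_{jk},$$ and $Q/P\in L^{\mathfrak{p}}_{loc}$ if and only if for each $k=1,\dots,M$, $c_k$ vanishes at $0$ to order at least $$\bigl\lfloor(2L_k+1)(1-1/\mathfrak{p})\bigr\rfloor+\sum_{j<k}O_{jk}.$$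
   Context: $\bar P(x,y)=\overline{P(\bar x,\bar y)}$. $\mathbb{C}\{x,y\}$ are convergent power series at the origin and $(P,\bar P)$ the ideal they generate; $\mathbb{R}\{x\}$ are real-coefficient convergent series; a unit is a series nonvanishing at the origin; Ord is order of vanishing at $0$. $f\in L^{\mathfrak{p}}_{loc}$ means $f\in L^{\mathfrak{p}}(U)$ for some neighborhood $U$ of $(0,0)$ in $\mathbb{R}^2$. $O_{ij}=\min\{\mathrm{Ord}(q_j-q_i),2L_j,2L_i\}$. A real $t$ is called proper if there is a local factorization $A+tB=u(x,y;t)\prod_{j=1}^M(y+q_j(x)+x^{2L_j}\psi_j(x;t))$ with $u(\cdot,\cdot;t)$ a unit, $\psi_j(\cdot;t)\in\mathbb{R}\{x\}$, and $\mathrm{Ord}(q_j-q_i+x^{2L_j}\psi_j(x;t)-x^{2L_i}\psi_i(x;t))=O_{ij}$ for all $i\ne j$; all but finitely many real $t$ are proper. *)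

(* Defs.v *)
(* mathcomp 2.5 + mathcomp-analysis 1.16 + real-closed (complex R = R[i]). *)
From HB Require Import structures.
From mathcomp Require Import all_boot all_order all_algebra all_fingroup.
From mathcomp Require Import all_classical all_reals all_analysis.
From mathcomp Require Import complex.
Set Implicit Arguments. Unset Strict Implicit. Unset Printing Implicit Defensive.
Import Order.TTheory GRing.Theory Num.Theory.
Import numFieldNormedType.Exports.
Local Open Scope ring_scope.

Section Defs.
Variable R : realType.
Local Notation C := R[i].

(* modulus of a complex number, real valued *)
Definition cabs (z : C) : R :=
  Num.sqrt (complex.Re z ^+ 2 + complex.Im z ^+ 2).

(* Formal power series in two variables x, y with complex coefficients:
   [a m n] is the coefficient of x^m y^n. *)
Definition ps := nat -> nat -> C.

Definition ps_zero : ps := fun _ _ => 0.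
Definition ps_one : ps := fun m n => if (m == 0%N) && (n == 0%N) then 1 else 0.
Definition ps_add (a b : ps) : ps := fun m n => a m n + b m n.
Definition ps_scale (c : C) (a : ps) : ps := fun m n => c * a m n.
Definition ps_sub (a b : ps) : ps := ps_add a (ps_scale (-1) b).
(* Cauchy product *)
Definition ps_mul (a b : ps) : ps := fun m n =>
  \sum_(i < m.+1) \sum_(j < n.+1) a i j * b (m - i)%N (n - j)%N.
Definition ps_prod (s : seq ps) : ps := foldr ps_mul ps_one s.
Definition ps_sum (s : seq ps) : ps := foldr ps_add ps_zero s.
(* the variable y *)
Definition ps_Y : ps := fun m n => if (m == 0%N) && (n == 1%N) then 1 else 0.
(* a series in x only, with coefficients c *)
Definition ps_ofx (c : nat -> C) : ps := fun m n => if n == 0%N then c m else 0.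
(* a complex polynomial in x, viewed as a series *)
Definition ps_polyx (c : {poly C}) : ps := ps_ofx (fun m => c`_m).
(* \bar P (x,y) = conj (P (conj x, conj y)) : conjugate the coefficients *)
Definition ps_conj (a : ps) : ps := fun m n => ((a m n)^*)%C.

(* convergent power series at the origin (C{x,y}): absolutely convergent on
   some polydisc around 0 *)
Definition ps_convergent (a : ps) : Prop :=
  exists r : R, 0 < r /\
    forall z w : C, cabs z < r -> cabs w < r ->
      (\esum_(k in [set: nat * nat])
          (cabs (a k.1 k.2 * z ^+ k.1 * w ^+ k.2))%:E < +oo)%E.

(* a unit of C{x,y}: nonvanishing at the origin *)
Definition ps_unit (a : ps) : Prop := a 0%N 0%N != 0.

(* real convergent series in x (R{x}) *)
Definition rseries_convergent (psi : nat -> R) : Prop :=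
  ps_convergent (ps_ofx (fun m => ((psi m)%:C)%C)).

(* value of the series at (z, w): limit of the square partial sums *)
Definition ps_partial (a : ps) (z w : C) (N : nat) : C :=
  \sum_(m < N) \sum_(n < N) a m n * z ^+ m * w ^+ n.
Definition ps_eval (a : ps) (z w : C) : C :=
  (limn (fun N => complex.Re (ps_partial a z w N)) +i*
   limn (fun N => complex.Im (ps_partial a z w N)))%C.

(* h belongs to the ideal (f, g) of C{x,y} *)
Definition in_ideal2 (f g h : ps) : Prop :=
  exists al be : ps, ps_convergent al /\ ps_convergent be /\
    h = ps_add (ps_mul al f) (ps_mul be g).

(* Ord f = n  for a (real) series in x given by its coefficients, n finite *)
Definition ord_is (f : nat -> R) (n : nat) : Prop :=
  (forall m, (m < n)%N -> f m = 0) /\ f n != 0.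

(* order of vanishing at 0 of a nonzero real polynomial *)
Definition ord_poly (p : {poly R}) : nat := find (fun c => c != 0) p.

(* O_ij = min {Ord(q_j - q_i), 2L_j, 2L_i}, with Ord 0 = +oo *)
Definition Oidx (Li Lj : nat) (qi qj : {poly R}) : nat :=
  if qj - qi == 0 then minn (2 * Lj) (2 * Li)
  else minn (ord_poly (qj - qi)) (minn (2 * Lj) (2 * Li)).

(* coefficients of x^k * psi(x) *)
Definition xshift (k : nat) (psi : nat -> R) (m : nat) : R :=
  if (k <= m)%N then psi (m - k)%N else 0.

(* the factor y + q(x) + i x^(2L) of P *)
Definition Pfac (L : nat) (q : {poly R}) : ps :=
  ps_add ps_Y (ps_ofx (fun m => ((q`_m)%:C)%C + (if m == (2 * L)%N then 'i%C else 0))).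

Variable M : nat.
Variables (L : 'I_M -> nat) (q : 'I_M -> {poly R}).

Definition P : ps := ps_prod [seq Pfac (L j) (q j) | j <- enum 'I_M].
Definition Pbar : ps := ps_conj P.
Definition Aser : ps := ps_scale (2^-1) (ps_add P Pbar).
Definition Bser : ps := ps_scale ((2 * 'i%C)^-1) (ps_sub P Pbar).
Definition ApB (t : R) : ps := ps_add Aser (ps_scale ((t%:C)%C) Bser).

(* the factor y - a_j(x;t) = y + q_j(x) + x^(2L_j) psi_j(x;t) *)
Definition bfac (j : 'I_M) (psi : 'I_M -> nat -> R) : ps :=
  ps_add ps_Y (ps_ofx (fun m => (((q j)`_m + xshift (2 * L j) (psi j) m)%:C)%C)).

(* t is proper, witnessed by the unit u and the real series psi_j *)
Definition proper_factorization (t : R) (u : ps) (psi : 'I_M -> nat -> R) : Prop :=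
  [/\ ps_convergent u, ps_unit u, (forall j, rseries_convergent (psi j)),
      ApB t = ps_mul u (ps_prod [seq bfac j psi | j <- enum 'I_M]) &
      forall i j : 'I_M, i != j ->
        ord_is (fun m => (q j - q i)`_m + xshift (2 * L j) (psi j) m
                                        - xshift (2 * L i) (psi i) m)
               (Oidx (L i) (L j) (q i) (q j))].

(* after relabeling by s: F_k = (A + tB) / prod_(j <= k) (y - a_(s j))
                              = u * prod_(j > k) (y - a_(s j)) *)
Definition Fk (u : ps) (psi : 'I_M -> nat -> R) (s : {perm 'I_M}) (k : 'I_M) : ps :=
  ps_mul u (ps_prod [seq bfac (s j) psi | j <- [seq j0 <- enum 'I_M | (nat_of_ord k < nat_of_ord j0)%N]]).

(* relabeled O_jk *)
Definition Os (s : {perm 'I_M}) (j k : 'I_M) : nat :=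
  Oidx (L (s j)) (L (s k)) (q (s j)) (q (s k)).

(* c is an admissible representative of Q modulo (P, Pbar) *)
Definition is_rep (u : ps) (psi : 'I_M -> nat -> R) (s : {perm 'I_M})
    (Q : ps) (c : 'I_M -> {poly C}) : Prop :=
  (forall k : 'I_M,
     (size (c k) <= 2 * L (s k) + \sum_(j < M | j != k) Os s j k)%N) /\
  in_ideal2 P Pbar
    (ps_sub Q (ps_sum [seq ps_mul (ps_polyx (c k)) (Fk u psi s k) | k <- enum 'I_M])).

End Defs.

(* L^p_loc near (0,0) in R^2, for a complex valued function *)
Definition Lp_loc (R : realType) (p : R) (f : R * R -> R[i]) : Prop :=
  exists U : set (R * R), nbhs ((0 : R), (0 : R)) U /\ measurable U /\
    measurable_fun U (fun z => complex.Re (f z)) /\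
    measurable_fun U (fun z => complex.Im (f z)) /\
    (\int[(@lebesgue_measure R \x @lebesgue_measure R)%E]_(z in U)
        ((cabs (f z)) `^ p)%:E < +oo)%E.

(* the function (x, y) |-> Q(x,y) / P(x,y) on R^2 *)
Definition quot_fun (R : realType) (Q Pp : ps R) : R * R -> R[i] :=
  fun z => ps_eval Q ((z.1)%:C)%C ((z.2)%:C)%C / ps_eval Pp ((z.1)%:C)%C ((z.2)%:C)%C.

(* Main.v *)
(* Since A + tB is a combination of P and its conjugate with a nonzero
   coefficient on the latter, the ideal is (P, A + tB), and the unit u is 1
   because both sides are Weierstrass polynomials.  Dividing successively by
   y - a_M, ..., y - a_1 and reducing the remainders, which are series in x,
   modulo P restricted to y = a_k, a series of order 2 L_k + \sum_(j != k) O_jk,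
   gives the unique representatives.

   On the real plane write D_j = |y + q_j + i x^(2 L_j)|.  Then
   D_i + D_j >= c |x|^O_ij, so that \prod_(j <= k) D_j is bounded below by
   D_i |x|^(\sum_(j != i) O_ij) for the index i minimising D_i, and
   c_k F_k / P is in L^p as soon as c_k vanishes to the order demanded by each
   i <= k.  The indices are ordered greedily so that, within every initial
   segment, the last index demands the most.  Conversely, on the strip
   |y - a_k| << |x|^(2 L_k) one has |y - a_j| ~ D_j ~ |x|^O_jk for j != k; after
   removing the factors with j > k, \sum_(i <= k) c_i F_i is a polynomial of
   bounded degree in y with value c_k(x) at y = a_k, hence comparable to c_k(x)
   on a fixed proportion of the strip, and the order of c_k follows; one then
   subtracts c_k F_k and descends. *)
Require Import Defs.
From HB Require Import structures.
From mathcomp Require Import all_boot all_order all_algebra all_fingroup.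
From mathcomp Require Import all_classical all_reals all_analysis.
From mathcomp Require Import complex.
From mathcomp Require Import measurable_realfun.
From mathcomp Require Import zify ring lra.
Import Order.TTheory GRing.Theory Num.Theory.
Import numFieldNormedType.Exports.
Set Implicit Arguments.
Unset Strict Implicit.
Unset Printing Implicit Defensive.
Local Open Scope ring_scope.

(** * Formal power series *)

(** The exponents come from the strip: a quotient of size |x|^n / |x|^(S + 2 L_k) over width |x|^(2
    L_k) has finite p-th power integral exactly when p (n - S - 2 L_k) + 2 L_k > -1, that is n > S +
    2 L_k (1 - 1/p) - 1/p. For integers n this reads n >= S + floor((2 L_k + 1)(1 - 1/p)). Since S
    sums contacts inside an initial segment, the comparison of two indices changes with the segment;
    hence the order is built from the last index down.

    The lower bound for D_i + D_j cannot come from subtracting two factors of P, which may even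
    coincide. Conjugating one of them keeps its modulus on the real plane and makes the imaginary
    parts x^(2 L_i) and x^(2 L_j) add instead of cancel. The same remark, |Pbar| = |P| at real
    points, shows that elements of the ideal have bounded quotient by P, so that only the class of Q
    matters.

    Convergence accompanies each algebraic step as a geometric bound on coefficients; all divisions
    reduce to one recursion estimate. *)

(* [ps R] is convertible to [fps (fps R[i])], the outer index being the exponent
   of [x]. *)
Definition fps (A : Type) := nat -> A.

Section FormalPowerSeries.
Variable A : comNzRingType.
Implicit Types (a b c : fps A).

HB.instance Definition _ := gen_eqMixin (fps A).
HB.instance Definition _ := gen_choiceMixin (fps A).

Definition fps_const (x : A) : fps A := fun m => if m == 0%N then x else 0.
Definition fps_mul a b : fps A := fun m => \sum_(i < m.+1) a i * b (m - i)%N.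

Fact fps_addA : associative (fun a b : fps A => (fun m => a m + b m) : fps A).
Proof. by move=> a b c; apply/funext => m; rewrite addrA. Qed.
Fact fps_addC : commutative (fun a b : fps A => (fun m => a m + b m) : fps A).
Proof. by move=> a b; apply/funext => m; rewrite addrC. Qed.
Fact fps_add0 : left_id ((fun=> 0) : fps A) (fun a b => (fun m => a m + b m) : fps A).
Proof. by move=> a; apply/funext => m; rewrite add0r. Qed.
Fact fps_addN : left_inverse ((fun=> 0) : fps A) (fun a => (fun m => - a m) : fps A)
  (fun a b => (fun m => a m + b m) : fps A).
Proof. by move=> a; apply/funext => m; rewrite addNr. Qed.

HB.instance Definition _ :=
  GRing.isZmodule.Build (fps A) fps_addA fps_addC fps_add0 fps_addN.

Definition fps_trunc n a : {poly A} := \poly_(i < n) a i.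

(* Below degree [n] the Cauchy product only sees truncations, so the ring laws
   are inherited from [{poly A}]. *)
Lemma fps_mul_trunc n a b m : (m < n)%N ->
  fps_mul a b m = (fps_trunc n a * fps_trunc n b)`_m.
Proof.
move=> mn; rewrite coefM; apply: eq_bigr => i _.
rewrite !coef_poly (leq_trans _ mn) ?ltn_ord// (leq_ltn_trans _ mn)//.
exact: leq_subr.
Qed.

Fact fps_mulC : commutative fps_mul.
Proof.
by move=> a b; apply/funext => m; rewrite !(fps_mul_trunc _ _ (ltnSn m)) mulrC.
Qed.

Fact fps_mulA : associative fps_mul.
Proof.
move=> a b c; apply/funext => m.
transitivity ((fps_trunc m.+1 a * (fps_trunc m.+1 b * fps_trunc m.+1 c))`_m).
  rewrite coefM; apply: eq_bigr => i _.
  rewrite coef_poly ltn_ord (@fps_mul_trunc m.+1)//; lia.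
rewrite mulrA coefM; apply: eq_bigr => i _.
have im := ltn_ord i.
rewrite (@fps_mul_trunc m.+1)// coef_poly ifT//; lia.
Qed.

Fact fps_mul1 : left_id (fps_const 1) fps_mul.
Proof.
move=> a; apply/funext => m; rewrite /fps_mul big_ord_recl /fps_const/= mul1r.
by rewrite subn0 big1 ?addr0// => i _; rewrite mul0r.
Qed.

Fact fps_mulDl : left_distributive fps_mul (fun a b => (fun m => a m + b m) : fps A).
Proof.
move=> a b c; apply/funext => m; rewrite /fps_mul -big_split/=.
by apply: eq_bigr => i _; rewrite mulrDl.
Qed.

Fact fps_one_neq0 : fps_const 1 != 0.
Proof.
apply/eqP => /(congr1 (fun a => a 0%N)) /eqP.
by rewrite /fps_const/= (negbTE (oner_neq0 A)).
Qed.

HB.instance Definition _ := GRing.Zmodule_isComNzRing.Build (fps A)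
  fps_mulA fps_mulC fps_mul1 fps_mulDl fps_one_neq0.

Lemma fps_addE a b m : (a + b) m = a m + b m. Proof. by []. Qed.
Lemma fps_oppE a m : (- a) m = - a m. Proof. by []. Qed.
Lemma fps_subE a b m : (a - b) m = a m - b m. Proof. by []. Qed.
Lemma fps_oneE m : (1 : fps A) m = if m == 0%N then 1 else 0. Proof. by []. Qed.
Lemma fps_mulE a b m : (a * b) m = \sum_(i < m.+1) a i * b (m - i)%N.
Proof. by []. Qed.
Lemma fps_sumE I (r : seq I) (Q : pred I) (F : I -> fps A) m :
  (\sum_(i <- r | Q i) F i) m = \sum_(i <- r | Q i) F i m.
Proof. by elim/big_rec2 : _ => // i x y _ <-. Qed.

Lemma fps_mul0 a b : (a * b) 0%N = a 0%N * b 0%N.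
Proof. by rewrite fps_mulE big_ord1. Qed.

Lemma fps_const0 : fps_const 0 = 0.
Proof. by apply/funext => m; rewrite /fps_const; case: eqP. Qed.
Lemma fps_constB x y : fps_const (x - y) = fps_const x - fps_const y.
Proof.
by apply/funext => m; rewrite fps_subE /fps_const; case: eqP => // _; rewrite subr0.
Qed.
Lemma fps_constM x y : fps_const (x * y) = fps_const x * fps_const y.
Proof.
apply/funext => m; rewrite fps_mulE big_ord_recl/= big1 ?addr0 => [|i _].
  by rewrite /fps_const subn0/=; case: eqP => //; rewrite mulr0.
by rewrite /fps_const/= mul0r.
Qed.

HB.instance Definition _ := GRing.isZmodMorphism.Build A (fps A) fps_const fps_constB.
HB.instance Definition _ := GRing.isMonoidMorphism.Build A (fps A) fps_const
  (erefl, fps_constM).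

Lemma fps_constME x a m : (fps_const x * a) m = x * a m.
Proof.
rewrite fps_mulE big_ord_recl/= big1 ?addr0 ?subn0 => [|i _]; rewrite /fps_const//=.
by rewrite mul0r.
Qed.

Definition fpsX : fps A := fun m => if m == 1%N then 1 else 0.

Lemma fpsXME a m : (fpsX * a) m.+1 = a m.
Proof.
rewrite fps_mulE !big_ord_recl big1 => [|i _]; rewrite /fpsX/= ?mul0r//.
by rewrite add0r mul1r addr0 subSS subn0.
Qed.
Lemma fpsXM0 a : (fpsX * a) 0%N = 0.
Proof. by rewrite fps_mul0 /fpsX/= mul0r. Qed.

Lemma fpsXnME n a m : (fpsX ^+ n * a) m = if (m < n)%N then 0 else a (m - n)%N.
Proof.
elim: n m => [|n IH] m; first by rewrite expr0 mul1r ltn0 subn0.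
by rewrite exprS -mulrA; case: m => [|m]; rewrite ?fpsXM0// fpsXME IH ltnS subSS.
Qed.

Lemma fpsXnE n m : (fpsX ^+ n) m = (m == n)%:R.
Proof.
rewrite -[_ ^+ n]mulr1 fpsXnME fps_oneE subn_eq0.
by case: ltngtP.
Qed.

Lemma fps_mulXn_eq0 n a : fpsX ^+ n * a = 0 -> a = 0.
Proof.
move=> /(congr1 (fun b => b (_ + n)%N)) h; apply/funext => m.
by have := h m; rewrite fpsXnME addnK ltnNge leq_addl.
Qed.

Definition fps_ord a n := (forall m, (m < n)%N -> a m = 0) /\ a n != 0.

Lemma fps_ordXn a n : (forall m, (m < n)%N -> a m = 0) ->
  a = fpsX ^+ n * (fun m => a (m + n)%N).
Proof.
move=> a0; apply/funext => m; rewrite fpsXnME; case: ltnP => [/a0//|nm].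
by rewrite subnK.
Qed.

End FormalPowerSeries.
Arguments fps_const {A}.
Arguments fpsX {A}.

Lemma fps_ordM (A : idomainType) (a b : fps A) n m :
  fps_ord a n -> fps_ord b m -> fps_ord (a * b) (n + m).
Proof.
move=> [a0 an] [b0 bm].
rewrite (fps_ordXn a0) (fps_ordXn b0) mulrACA -exprD.
by split=> [k kn|]; rewrite fpsXnME ?kn// ltnn subnn fps_mul0 !add0n mulf_neq0.
Qed.
Lemma fps_ord1 (A : idomainType) : fps_ord (1 : fps A) 0.
Proof. by split=> //; rewrite fps_oneE/= oner_neq0. Qed.

(** * Geometric bounds and convergence *)

Import ComplexField.Normc.

Section ComplexModulus.
Variable R : realType.
Implicit Types z w : R[i].

Lemma cabsE z : cabs z = normc z. Proof. by case: z. Qed.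
Lemma cabs_ge0 z : 0 <= cabs z. Proof. exact: sqrtr_ge0. Qed.
Lemma cabs0 : cabs (0 : R[i]) = 0. Proof. by rewrite cabsE normc0. Qed.
Lemma cabs1 : cabs (1 : R[i]) = 1. Proof. by rewrite cabsE normc1. Qed.
Lemma cabs_eq0 z : (cabs z == 0) = (z == 0).
Proof.
apply/eqP/eqP => [|->]; last exact: cabs0.
by rewrite cabsE => /eq0_normc.
Qed.
Lemma cabs_gt0 z : (0 < cabs z) = (z != 0).
Proof. by rewrite lt_def cabs_ge0 andbT cabs_eq0. Qed.
Lemma cabsM z w : cabs (z * w) = cabs z * cabs w.
Proof. by rewrite !cabsE normcM. Qed.
Lemma cabsV z : cabs z^-1 = (cabs z)^-1.
Proof. by rewrite !cabsE normcV. Qed.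
Lemma cabsX z n : cabs (z ^+ n) = cabs z ^+ n.
Proof. by elim: n => [|n IH]; rewrite ?cabs1// !exprS cabsM IH. Qed.
Lemma cabsD z w : cabs (z + w) <= cabs z + cabs w.
Proof. by rewrite !cabsE le_normcD. Qed.
Lemma cabsN z : cabs (- z) = cabs z.
Proof. by rewrite !cabsE normcN. Qed.
Lemma cabsB z w : cabs (z - w) <= cabs z + cabs w.
Proof. by rewrite -(cabsN w) cabsD. Qed.
Lemma cabsBC z w : cabs (z - w) = cabs (w - z).
Proof. by rewrite -cabsN opprB. Qed.
Lemma cabs_conj z : cabs (z^*%C) = cabs z.
Proof. by case: z => a b; rewrite /cabs/= sqrrN. Qed.
Lemma cabs_real (x : R) : cabs (x%:C)%C = `|x|.
Proof. by rewrite /cabs/= expr0n/= addr0 sqrtr_sqr. Qed.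
Lemma cabs_Re z : `|complex.Re z| <= cabs z.
Proof.
case: z => a b; rewrite /cabs/= -[leLHS]sqrtr_sqr ler_sqrt.
  by rewrite lerDl sqr_ge0.
by rewrite addr_ge0 ?sqr_ge0.
Qed.
Lemma cabs_Im z : `|complex.Im z| <= cabs z.
Proof.
case: z => a b; rewrite /cabs/= -[leLHS]sqrtr_sqr ler_sqrt.
  by rewrite lerDr sqr_ge0.
by rewrite addr_ge0 ?sqr_ge0.
Qed.
Lemma cabs_ReIm z : cabs z <= `|complex.Re z| + `|complex.Im z|.
Proof.
case: z => a b; rewrite /cabs/=.
rewrite -[leRHS]ger0_norm ?addr_ge0// -sqrtr_sqr ler_sqrt ?sqr_ge0//.
by rewrite sqrrD !real_normK ?num_real// lerD2r lerDl mulrn_wge0// mulr_ge0.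
Qed.
Lemma cabs_prod I (r : seq I) (Q : pred I) (F : I -> R[i]) :
  cabs (\prod_(i <- r | Q i) F i) = \prod_(i <- r | Q i) cabs (F i).
Proof.
by elim/big_rec2 : _ => [|i x y _ <-]; rewrite ?cabs1 ?cabsM.
Qed.
Lemma cabs_sum I (r : seq I) (Q : pred I) (F : I -> R[i]) :
  cabs (\sum_(i <- r | Q i) F i) <= \sum_(i <- r | Q i) cabs (F i).
Proof.
elim/big_rec2 : _ => [|i x y _ h]; rewrite ?cabs0//.
by rewrite (le_trans (cabsD _ _))// lerD2l.
Qed.

End ComplexModulus.

Lemma sum_geo2 (R : realFieldType) N : \sum_(i < N) (2^-1 : R) ^+ i <= 2.
Proof.
suff -> : \sum_(i < N) (2^-1 : R) ^+ i = 2 - 2 * 2^-1 ^+ N.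
  by rewrite gerBl mulr_ge0// exprn_ge0// invr_ge0.
elim: N => [|N IH]; first by rewrite big_ord0 expr0 mulr1 subrr.
by rewrite big_ord_recr/= IH exprS; field.
Qed.

Lemma succ_le_exp2 (R : realFieldType) n : n.+1%:R * (2^-1 : R) ^+ n <= 1.
Proof.
rewrite exprVn ler_pdivrMr ?exprn_gt0// mul1r -natrX ler_nat.
exact: ltn_expl.
Qed.

Section GeometricBounds.
Variable R : realType.
Local Notation C := R[i].
Implicit Types a b : ps R.

Definition gle (r K : R) a := forall m n, cabs (a m n) * r ^+ (m + n) <= K.

(** Equivalent to [ps_convergent], by [gbounded_convergent] and [convergent_gbounded]. Bounding
    single coefficients instead of a sum makes closure under products and divisions an elementary
    estimate; [r <= 1] makes the powers of [r] comparable. *)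
Definition gbounded a := exists r K : R, [/\ 0 < r, r <= 1 & gle r K a].

Lemma gle_ge0 r K a : 0 < r -> gle r K a -> 0 <= K.
Proof.
move=> r0 /(_ 0%N 0%N); apply: le_trans.
by rewrite mulr_ge0 ?cabs_ge0// exprn_ge0// ltW.
Qed.

Lemma gle_mono r r' K a : 0 < r' -> r' <= r -> gle r K a -> gle r' K a.
Proof.
move=> r0 rr h m n; apply: le_trans (h m n).
rewrite ler_wpM2l ?cabs_ge0// lerXn2r// nnegrE ltW//.
exact: lt_le_trans rr.
Qed.

Lemma gbounded2 a b : gbounded a -> gbounded b ->
  exists r K K' : R, [/\ 0 < r, r <= 1, gle r K a & gle r K' b].
Proof.
move=> [r [K [r0 r1 ha]]] [r' [K' [r0' r1' hb]]].
exists (Num.min r r'), K, K'; split.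
- by rewrite lt_min r0.
- by rewrite ge_min r1.
- by apply: gle_mono ha; rewrite ?lt_min ?r0// ge_min lexx.
- by apply: gle_mono hb; rewrite ?lt_min ?r0// ge_min lexx orbT.
Qed.

(** On the polydisc of half the radius the terms are dominated by [K] times a double geometric
    series of ratio 1/2, with sum at most [4 * K]. *)
Lemma gle_convergent r K a : 0 < r -> gle r K a -> ps_convergent a.
Proof.
move=> r0 h; have K0 := gle_ge0 r0 h.
exists (r / 2); split; first by rewrite divr_gt0.
move=> z w zr wr.
set f := fun k : nat * nat => _.
pose g (m n : nat) : \bar R := (K * 2^-1 ^+ m * 2^-1 ^+ n)%:E.
have fg k : (f k <= g k.1 k.2)%E.
  rewrite /f /g lee_fin !cabsM !cabsX.
  have e t n : cabs t < r / 2 -> cabs t ^+ n <= r ^+ n * 2^-1 ^+ n :> R.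
    move=> /ltW tr; rewrite -exprMn lerXn2r// nnegrE ?cabs_ge0//.
    by rewrite mulr_ge0 ?invr_ge0// ltW.
  apply: le_trans (_ : cabs (a k.1 k.2) * (r ^+ k.1 * 2^-1 ^+ k.1) *
     (r ^+ k.2 * 2^-1 ^+ k.2) <= _).
    apply: ler_pM => //; rewrite ?mulr_ge0 ?cabs_ge0 ?exprn_ge0 ?cabs_ge0//.
      by rewrite ler_wpM2l ?cabs_ge0// e.
    exact: e.
  have := h k.1 k.2; rewrite exprD => h'.
  rewrite [leLHS](_ : _ = cabs (a k.1 k.2) * (r ^+ k.1 * r ^+ k.2) *
    (2^-1 ^+ k.1 * 2^-1 ^+ k.2)); last by ring.
  rewrite -[leRHS]mulrA ler_wpM2r// mulr_ge0// exprn_ge0// invr_ge0//.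
apply: le_lt_trans (_ : (4 * K)%:E < _)%E; last by rewrite ltry.
apply: le_trans (_ : \esum_(k in [set: nat * nat]) g k.1 k.2 <= _)%E.
  by apply: le_esum => k _; exact: fg.
have g0 i j : (0 <= g i j)%E.
  by rewrite /g lee_fin !mulr_ge0// exprn_ge0// invr_ge0.
rewrite (_ : [set: nat * nat]%classic = ([set: nat] `*`` (fun=> [set: nat]))%classic); last first.
  by apply/seteqP; split.
rewrite -esum_esum//.
have lim (F : nat -> \bar R) (B : R) : (forall i, 0 <= F i)%E ->
   (forall i, F i <= (B * 2^-1 ^+ i)%:E)%E -> 0 <= B ->
   (\esum_(i in [set: nat]) F i <= (2 * B)%:E)%E.
  move=> F0 FB B0; rewrite -nneseries_esumT//.
  apply: lime_le; first exact: is_cvg_nneseries.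
  apply: nearW => N; rewrite big_mkord.
  apply: le_trans (_ : \sum_(i < N) (B * 2^-1 ^+ i)%:E <= _)%E.
    by apply: lee_sum => i _.
  rewrite sumEFin lee_fin -mulr_sumr mulrC ler_wpM2r//.
  exact: sum_geo2.
apply: le_trans (lim _ (2 * K) _ _ _) _.
- by move=> i; apply: esum_ge0.
- move=> i; rewrite -mulrA; apply: lim => //.
  by rewrite mulr_ge0// exprn_ge0// invr_ge0.
- by rewrite mulr_ge0.
- by rewrite lee_fin mulrA -natrM.
Qed.

Lemma gbounded_convergent a : gbounded a -> ps_convergent a.
Proof. by move=> [r [K [r0 _ /gle_convergent]]]; exact. Qed.

(** The single point [z = w = r / 2] suffices, since each modulus is at most the sum of all of
    them. *)
Lemma convergent_gbounded a : ps_convergent a -> gbounded a.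
Proof.
move=> [r [r0 h]].
set z : C := ((r / 2)%:C)%C.
have zr : cabs z < r.
  by rewrite cabs_real ger0_norm ?divr_ge0 ?ltW// ltr_pdivrMr// mulr_natr mulr2n ltrDl.
have {h} := h z z zr zr; set S := esum _ _ => SI.
have S0 : (0 <= S)%E by apply: esum_ge0 => k _; rewrite lee_fin cabs_ge0.
have Sfin : S \is a fin_num by rewrite ge0_fin_numE.
have h m n : cabs (a m n) * (r / 2) ^+ (m + n) <= fine S.
  rewrite -lee_fin fineK//; apply: esum_ge.
  exists [set (m, n)]%classic; first by split => //; exact: finite_set1.
  rewrite fsbig_set1/= lee_fin !cabsM !cabsX cabs_real ger0_norm ?divr_ge0 ?(ltW r0)//.
  by rewrite -mulrA -exprD.
exists (Num.min (r / 2) 1), (fine S); split.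
- by rewrite lt_min divr_gt0/=.
- by rewrite ge_min lexx orbT.
- by apply: gle_mono h; rewrite ?lt_min ?divr_gt0//= ge_min lexx.
Qed.

Lemma gboundedD a b : gbounded a -> gbounded b -> gbounded ((a : fps (fps C)) + b).
Proof.
move=> ha hb; have [r [K [K' [r0 r1 {}ha {}hb]]]] := gbounded2 ha hb.
exists r, (K + K'); split=> // m n.
apply: le_trans (_ : (cabs (a m n) + cabs (b m n)) * r ^+ (m + n) <= _).
  by rewrite ler_wpM2r ?exprn_ge0 ?(ltW r0)// cabsD.
by rewrite mulrDl lerD.
Qed.

Lemma fps2_mulE (a b : fps (fps C)) m n :
  (a * b) m n = \sum_(i < m.+1) \sum_(j < n.+1) a i j * b (m - i)%N (n - j)%N.
Proof. by rewrite fps_mulE fps_sumE. Qed.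

(** Each summand of the Cauchy product, weighted by its share of [r ^+ (m + n)], is at most
    [K * K']. The number of summands stays explicit; halving the radius absorbs it through
    [succ_le_exp2]. *)
Lemma gleM r K K' a b : 0 < r -> gle r K a -> gle r K' b ->
  forall m n, cabs (((a : fps (fps C)) * b) m n) * r ^+ (m + n) <=
     K * K' * (m.+1%:R * n.+1%:R).
Proof.
move=> r0 ha hb m n; rewrite fps2_mulE.
apply: le_trans (_ : (\sum_(i < m.+1) \sum_(j < n.+1)
   cabs (a i j) * cabs (b (m - i)%N (n - j)%N)) * r ^+ (m + n) <= _).
  rewrite ler_wpM2r ?exprn_ge0 ?(ltW r0)//.
  apply: le_trans (cabs_sum _ _ _) _; apply: ler_sum => i _.
  apply: le_trans (cabs_sum _ _ _) _; apply: ler_sum => j _.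
  by rewrite cabsM.
rewrite mulr_suml.
apply: le_trans (_ : \sum_(i < m.+1) (K * K' * n.+1%:R) <= _); last first.
  by rewrite sumr_const card_ord -[leLHS]mulr_natr -!mulrA [n.+1%:R * _]mulrC.
apply: ler_sum => i _; rewrite mulr_suml.
apply: le_trans (_ : \sum_(j < n.+1) (K * K') <= _); last first.
  by rewrite sumr_const card_ord -[leLHS]mulr_natr.
apply: ler_sum => j _.
have -> : (m + n = (i + j) + ((m - i) + (n - j)))%N.
  by have := ltn_ord i; have := ltn_ord j; lia.
rewrite exprD mulrACA.
by apply: ler_pM; rewrite ?mulr_ge0 ?cabs_ge0 ?exprn_ge0 ?(ltW r0).
Qed.

Lemma gboundedM a b : gbounded a -> gbounded b -> gbounded ((a : fps (fps C)) * b).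
Proof.
move=> ha hb; have [r [K [K' [r0 r1 {}ha {}hb]]]] := gbounded2 ha hb.
have K0 := gle_ge0 r0 ha; have K'0 := gle_ge0 r0 hb.
exists (r / 2), (K * K'); split=> [||m n]; first by rewrite divr_gt0.
  by rewrite ler_pdivrMr// mul1r (le_trans r1)// ler1n.
rewrite [leLHS](_ : _ = cabs (((a : fps (fps C)) * b) m n) * r ^+ (m + n) *
  (2^-1 ^+ m * 2^-1 ^+ n)); last by rewrite exprMn !exprD; ring.
apply: le_trans (_ : K * K' * (m.+1%:R * n.+1%:R) * (2^-1 ^+ m * 2^-1 ^+ n) <= _).
  by rewrite ler_wpM2r ?mulr_ge0 ?exprn_ge0 ?invr_ge0//; exact: gleM.
rewrite -mulrA ler_piMr ?mulr_ge0// mulrACA.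
by apply: mulr_ile1; rewrite ?mulr_ge0 ?exprn_ge0 ?invr_ge0// succ_le_exp2.
Qed.

Lemma gbounded_support a N : (forall m n, (N <= m + n)%N -> a m n = 0) -> gbounded a.
Proof.
move=> h; exists 1, (\sum_(i < N) \sum_(j < N) cabs (a i j)); split => // m n.
rewrite expr1n mulr1.
have [/h ->|mn] := leqP N (m + n).
  by rewrite cabs0; do 2 (apply: sumr_ge0 => ? _); exact: cabs_ge0.
have mN : (m < N)%N by lia.
have nN : (n < N)%N by lia.
rewrite (bigD1 (Ordinal mN))//= (bigD1 (Ordinal nN))//= -addrA lerDl.
by apply: addr_ge0; do ?(apply: sumr_ge0 => ? _); exact: cabs_ge0.
Qed.

Lemma gbounded_const (c : C) : gbounded (fps_const (fps_const c)).
Proof.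
apply: (@gbounded_support _ 1) => -[|m] [|n]//=; rewrite /fps_const //=.
Qed.

Lemma gbounded0 : gbounded (0 : fps (fps C)).
Proof. exact: (@gbounded_support _ 0). Qed.
Lemma gbounded1 : gbounded (1 : fps (fps C)).
Proof. exact: (gbounded_const 1). Qed.

Lemma gboundedN a : gbounded a -> gbounded (- (a : fps (fps C))).
Proof. by move=> [r [K [r0 r1 h]]]; exists r, K; split=> // m n; rewrite cabsN. Qed.

Lemma gboundedB a b : gbounded a -> gbounded b -> gbounded ((a : fps (fps C)) - b).
Proof. by move=> ha hb; apply: gboundedD => //; exact: gboundedN. Qed.

Lemma gbounded_conj a : gbounded a -> gbounded (ps_conj a).
Proof.
by move=> [r [K [r0 r1 h]]]; exists r, K; split=> // m n; rewrite /ps_conj cabs_conj.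
Qed.

Lemma gbounded_prod I (r : seq I) (Q : pred I) (F : I -> fps (fps C)) :
  (forall i, Q i -> gbounded (F i)) -> gbounded (\prod_(i <- r | Q i) F i).
Proof. by move=> h; elim/big_ind : _ => //; [exact: gbounded1|exact: gboundedM]. Qed.
Lemma gbounded_sum I (r : seq I) (Q : pred I) (F : I -> fps (fps C)) :
  (forall i, Q i -> gbounded (F i)) -> gbounded (\sum_(i <- r | Q i) F i).
Proof. by move=> h; elim/big_ind : _ => //; [exact: gbounded0|exact: gboundedD]. Qed.

(* The recursion [v = b + f * shift_y^d v], [f] a series in [x] vanishing at
   the origin: [d = 1] is division by [y - f(x)], [d = 0] is division by
   [1 - f(x)]. *)
Lemma shift_recursion (d : nat) (b : fps (fps C)) (f : fps C) :
  f 0%N = 0 -> (d <= 1)%N ->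
  exists v : fps (fps C),
    (forall m n, v m n = b m n + \sum_(i < m.+1) f i * v (m - i)%N (n + d)%N) /\
    (gbounded b -> gbounded (fps_const \o f) -> gbounded v).
Proof.
move=> f0 d1.
(* Course-of-values recursion on the power of [x]: [l m] lists the rows [v (m-1), ..., v 0]. As [f]
   has no constant term, row [m] refers to earlier rows only, so the shift in [y] causes no
   circularity. *)
pose T (l : seq (nat -> C)) (n : nat) : C :=
  b (size l) n + \sum_(i < size l) f i.+1 * nth (fun=> 0) l i (n + d)%N.
pose l := fix l m := if m is m'.+1 then T (l m') :: l m' else [::].
have sl m : size (l m) = m by elim: m => //= m ->.
pose v m := T (l m).
have nthl m i : (i < m)%N -> nth (fun=> 0) (l m) i = v (m - i.+1)%N.
  elim: m i => // m IH [|i] im /=; first by rewrite subn1.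
  by rewrite IH// subSS.
have vE m n : v m n = b m n + \sum_(i < m.+1) f i * v (m - i)%N (n + d)%N.
  rewrite {1}/v /T sl big_ord_recl f0 mul0r add0r; congr (_ + _).
  by apply: eq_bigr => i _; rewrite nthl.
exists v; split=> // hb hf.
have [r [K [K' [r0 r1 {}hb {}hf]]]] := gbounded2 hb hf.
have K0 := gle_ge0 r0 hb; have K'0 := gle_ge0 r0 hf.
(* In the weights [t ^ m * r ^ n] the convolution with [f] has norm at most
   [K' (t/r) (1 + 1/2 + ..) / r <= 1/2], for [t] as below. *)
pose t := r * r / (4 * (K' + 1)).
have t0 : 0 < t by rewrite divr_gt0 ?mulr_gt0// ltr_wpDl.
have tK : 4 * (K' + 1) * t = r * r.
  by rewrite /t; field; rewrite gt_eqF// ltr_wpDl.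
have tr : t <= r * 2^-1.
  rewrite /t ler_pdivrMr ?mulr_gt0 ?ltr_wpDl//.
  have : r * r <= r by rewrite ler_piMl// ltW.
  by nra.
have t_r : t <= r by apply: le_trans tr _; nra.
suff h m n : cabs (v m n) * (t ^+ m * r ^+ n) <= 2 * K.
  exists t, (2 * K); split=> //; first exact: le_trans r1.
  move=> m n; apply: le_trans (h m n).
  rewrite exprD ler_wpM2l ?cabs_ge0// ler_wpM2l ?exprn_ge0 ?(ltW t0)//.
  by rewrite lerXn2r// nnegrE ltW.
elim/ltn_ind: m n => m IH n; rewrite vE.
apply: le_trans (_ : (cabs (b m n) + \sum_(i < m.+1)
    cabs (f i) * cabs (v (m - i)%N (n + d)%N)) * (t ^+ m * r ^+ n) <= _).
  rewrite ler_wpM2r ?mulr_ge0 ?exprn_ge0 ?(ltW t0) ?(ltW r0)//.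
  rewrite (le_trans (cabsD _ _))// lerD2l (le_trans (cabs_sum _ _ _))//.
  by apply: ler_sum => i _; rewrite cabsM.
rewrite mulrDl [leRHS]mulrDl mul1r; apply: lerD.
  apply: le_trans (hb m n); rewrite exprD ler_wpM2l ?cabs_ge0//.
  by rewrite ler_wpM2r ?exprn_ge0 ?(ltW r0)// lerXn2r// nnegrE ltW.
rewrite big_ord_recl f0 cabs0 mul0r add0r mulr_suml.
apply: le_trans (_ : \sum_(i < m) K * 2^-1 * 2^-1 ^+ i <= _); last first.
  by rewrite -mulr_sumr -mulrA ler_piMr// -ler_pdivlMl ?invr_gt0// invrK mulr1 sum_geo2.
apply: ler_sum => i _; rewrite /bump/=.
have im := ltn_ord i.
have IHi := IH (m - i.+1)%N _ (n + d)%N; have {}IHi := IHi ltac:(lia).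
have fi : cabs (f i.+1) * r ^+ i.+1 <= K'.
  by have := hf i.+1 0%N; rewrite /= /fps_const/= addn0.
have ti : t ^+ i.+1 * 2 * (K' + 1) <= r ^+ i.+1 * r * 2^-1 * 2^-1 ^+ i.
  rewrite !exprS.
  have -> : t * t ^+ i * 2 * (K' + 1) = (4 * (K' + 1) * t) * 2^-1 * t ^+ i by field.
  rewrite tK.
  have -> : r * r ^+ i * r * 2^-1 * 2^-1 ^+ i = r * r * 2^-1 * (r * 2^-1) ^+ i.
    by rewrite exprMn; ring.
  by rewrite ler_wpM2l ?mulr_ge0 ?invr_ge0 ?(ltW r0)// lerXn2r// nnegrE ?ltW// mulr_gt0.
have rd : r <= r ^+ d by case: d d1 {v T l sl nthl vE IH IHi} => [|[|]]//; rewrite expr0.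
have -> : (t ^+ m = t ^+ (m - i.+1) * t ^+ i.+1) by rewrite -exprD; congr (_ ^+ _); lia.
rewrite exprD in IHi.
rewrite -(ler_pM2r (mulr_gt0 (exprn_gt0 i.+1 r0) r0)).
set V := cabs (v _ _) in IHi *; set Fi := cabs (f _) in fi *.
have V0 : 0 <= V by exact: cabs_ge0.
have F0 : 0 <= Fi by exact: cabs_ge0.
have p0 k : 0 <= r ^+ k by rewrite exprn_ge0// ltW.
have q0 k : 0 <= t ^+ k by rewrite exprn_ge0// ltW.
apply: le_trans (_ : (Fi * r ^+ i.+1) * (V * (t ^+ (m - i.+1) * (r ^+ n * r ^+ d))) * t ^+ i.+1 <= _).
  rewrite [leRHS](_ : _ = Fi * V * (t ^+ (m - i.+1) * t ^+ i.+1 * r ^+ n) * (r ^+ i.+1 * r ^+ d)); last by ring.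
  by rewrite ler_wpM2l ?mulr_ge0// ler_wpM2l.
apply: le_trans (_ : K' * (2 * K) * t ^+ i.+1 <= _).
  by rewrite ler_wpM2r// ler_pM// ?mulr_ge0.
apply: le_trans (_ : K * (t ^+ i.+1 * 2 * (K' + 1)) <= _).
  have : 0 <= K * t ^+ i.+1 by rewrite mulr_ge0.
  by nra.
rewrite [leRHS](_ : _ = K * (r ^+ i.+1 * r * 2^-1 * 2^-1 ^+ i)); last by ring.
by rewrite ler_wpM2l.
Qed.

End GeometricBounds.

(** * Division by a branch and representatives *)

Section Division.
Variable R : realType.
Local Notation C := R[i].
Local Notation PS := (fps (fps C)).

Definition ofx (f : fps C) : PS := fun m => fps_const (f m).
Definition psY : PS := fps_const fpsX.
Definition polyf (c : {poly C}) : fps C := fun m => c`_m.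

Lemma ofxB f g : ofx (f - g) = ofx f - ofx g.
Proof. by apply/funext => m; rewrite /ofx fps_subE fps_constB. Qed.
Lemma ofxM f g : ofx (f * g) = ofx f * ofx g.
Proof.
apply/funext => m; rewrite /ofx !fps_mulE rmorph_sum/=.
by apply: eq_bigr => i _; rewrite fps_constM.
Qed.
Lemma ofx1 : ofx 1 = 1.
Proof.
apply/funext => m; rewrite /ofx !fps_oneE; case: eqP => // _.
exact: fps_const0.
Qed.
HB.instance Definition _ := GRing.isZmodMorphism.Build (fps C) PS ofx ofxB.
HB.instance Definition _ := GRing.isMonoidMorphism.Build (fps C) PS ofx (ofx1, ofxM).

Lemma ofx_const (c : C) : ofx (fps_const c) = fps_const (fps_const c).
Proof. by apply/funext => -[|m] //; exact: fps_const0. Qed.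

Lemma ofxME (f : fps C) (a : PS) m n :
  (ofx f * a) m n = \sum_(i < m.+1) f i * a (m - i)%N n.
Proof. by rewrite fps_mulE fps_sumE; apply: eq_bigr => i _; rewrite fps_constME. Qed.
Lemma psYME0 (a : PS) m : (psY * a) m 0%N = 0.
Proof. by rewrite fps_constME fpsXM0. Qed.
Lemma psYMES (a : PS) m n : (psY * a) m n.+1 = a m n.
Proof. by rewrite fps_constME fpsXME. Qed.

Lemma gbounded_shift (a : PS) k l : gbounded a ->
  gbounded (fun m n => a (m + k)%N (n + l)%N).
Proof.
move=> [r [K [r0 r1 h]]]; exists r, (K / r ^+ (k + l)); split=> // m n.
rewrite ler_pdivlMr ?exprn_gt0// -mulrA -exprD.
by have := h (m + k)%N (n + l)%N; rewrite addnACA.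
Qed.

Lemma gbounded_psY : gbounded psY.
Proof.
apply: (@gbounded_support _ _ 2) => -[|m] [|[|n]]//= _; rewrite /psY /fps_const.
Qed.

Lemma gbounded_polyf (c : {poly C}) : gbounded (ofx (polyf c)).
Proof.
apply: (@gbounded_support _ _ (size c)) => m [|n] h; rewrite /ofx /fps_const//=.
by rewrite /polyf nth_default//; rewrite addn0 in h.
Qed.

(** Comparing coefficients of [y^(n+1)] forces the quotient to satisfy
    [a'_n = a_(n+1) + f a'_(n+1)], which is the recursion with [d = 1]; the coefficient of [y^0]
    gives the remainder. The bound on the remainder follows from writing it as [a - (y - f) a']. *)
Lemma fps_div_linear (f : fps C) (a : PS) : f 0%N = 0 ->
  exists (r : fps C) (a' : PS), a = ofx r + (psY - ofx f) * a' /\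
    (gbounded a -> gbounded (ofx f) -> gbounded (ofx r) /\ gbounded a').
Proof.
move=> f0.
have [v [vE vb]] := @shift_recursion R 1 (fun m n => a m n.+1) f f0 isT.
pose r : fps C := fun m => a m 0%N + \sum_(i < m.+1) f i * v (m - i)%N 0%N.
have aE : a = ofx r + (psY - ofx f) * v.
  apply/funext => m; apply/funext => -[|n].
    by rewrite mulrBl !(fps_subE, fps_addE) psYME0 ofxME sub0r /ofx /fps_const/= addrK.
  rewrite mulrBl !(fps_subE, fps_addE) psYMES ofxME /ofx /fps_const/= add0r vE.
  rewrite -addrA [X in _ + X](_ : _ = 0) ?addr0//.
  by apply/eqP; rewrite subr_eq0; apply/eqP/eq_bigr => i _; rewrite addn1.
exists r, v; split=> // ab fb.
have {}vb : gbounded v.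
  apply: vb => //; have := gbounded_shift 0 1 ab.
  by congr (gbounded _); apply/funext => m; apply/funext => n; rewrite addn0 addn1.
split=> //.
have -> : ofx r = a - (psY - ofx f) * v by rewrite aE addrK.
by apply: gboundedB => //; apply: gboundedM => //; apply: gboundedB => //; exact: gbounded_psY.
Qed.

(** The coefficients of positive powers of [y] express each row of [v] through strictly lower rows,
    because [f] has no constant term; induction on the power of [x] kills [v]. *)
Lemma fps_div_linear_uniq (f r : fps C) (v : PS) : f 0%N = 0 ->
  ofx r = (psY - ofx f) * v -> r = 0 /\ v = 0.
Proof.
move=> f0 h.
have v0 : v = 0.
  apply/funext => m; elim/ltn_ind: m => m IH; apply/funext => n.
  have := congr1 (fun a => a m n.+1) h; rewrite /= mulrBl !fps_subE ofxME.
  rewrite psYMES /ofx /fps_const/= big_ord_recl f0 mul0r add0r big1.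
    by rewrite subr0 => <-.
  by move=> i _; rewrite IH ?mulr0//= /bump/=; have := ltn_ord i; lia.
split=> //; apply/funext => m.
by have := congr1 (fun a => a m 0%N) h; rewrite v0 mulr0 /ofx /fps_const/=.
Qed.

Lemma mul_linear_eq0 (f : fps C) (v : PS) : f 0%N = 0 ->
  (psY - ofx f) * v = 0 -> v = 0.
Proof.
move=> f0 h; have := @fps_div_linear_uniq f 0 v f0.
by rewrite rmorph0 h => /(_ erefl)[].
Qed.

(** Normalise [g] to [g(0) (1 - f)] with [f] vanishing at the origin; the recursion with [d = 0] and
    [b = 1] inverts [1 - f], and the inverse is read off the column [y^0]. *)
Lemma fps_inv (g : fps C) : g 0%N != 0 ->
  exists h : fps C, g * h = 1 /\ (gbounded (ofx g) -> gbounded (ofx h)).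
Proof.
move=> g0; pose f : fps C := 1 - fps_const (g 0%N)^-1 * g.
have f0 : f 0%N = 0 by rewrite /f fps_subE fps_constME fps_oneE/= mulVf ?subrr.
have [v [vE vb]] := @shift_recursion R 0 (1 : PS) f f0 isT.
pose w : fps C := fun m => v m 0%N.
have wE : w = 1 + f * w.
  apply/funext => m; rewrite {1}/w vE fps_addE fps_mulE !fps_oneE.
  by congr (_ + _); case: eqP.
exists (fps_const (g 0%N)^-1 * w); split.
  have -> : g * (fps_const (g 0%N)^-1 * w) = w - f * w.
    by rewrite /f mulrBl mul1r opprB addrCA subrr addr0 mulrCA mulrA.
  by rewrite {1}wE addrK.
move=> gb; rewrite rmorphM/=; apply: gboundedM.
  by rewrite ofx_const; exact: gbounded_const.
have {}vb : gbounded v.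
  apply: vb; first exact: gbounded1.
  rewrite -[X in gbounded X]/(ofx f) /f rmorphB rmorph1 rmorphM/=.
  apply: gboundedB; first exact: gbounded1.
  apply: gboundedM => //.
  by rewrite ofx_const; exact: gbounded_const.
have [r [K [r0 r1 h]]] := vb; exists r, K; split=> // m n.
rewrite /ofx /fps_const; case: eqP => [->|_]; first exact: h.
by rewrite cabs0 mul0r; exact: gle_ge0 h.
Qed.

(** [p] is [x^N] times an invertible series, so the tail of [r] from degree [N] on is a multiple of
    [p] and the truncation of [r] is the remainder. *)
Lemma fps_div_ord (p r : fps C) N : fps_ord p N ->
  exists (c : {poly C}) (e : fps C),
    [/\ (size c <= N)%N, r = polyf c + e * p &
     gbounded (ofx r) -> gbounded (ofx p) -> gbounded (ofx e)].
Proof.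
move=> [p0 pN].
have shiftb (a : fps C) : gbounded (ofx a) -> gbounded (ofx (fun m => a (m + N)%N)).
  move=> /(gbounded_shift N 0); congr (gbounded _).
  by apply/funext => m; apply/funext => n; rewrite /ofx addn0.
pose p' : fps C := fun m => p (m + N)%N.
have [h [ph hb]] := @fps_inv p' pN.
pose r' : fps C := fun m => r (m + N)%N.
exists (\poly_(i < N) r i), (r' * h); split; first exact: size_poly.
- rewrite (fps_ordXn p0) -/p' mulrCA -mulrA [h * _]mulrC ph mulr1.
  apply/funext => m; rewrite fps_addE fpsXnME /polyf coef_poly.
  by case: ltnP => h'; rewrite ?addr0// add0r /r' subnK.
- move=> rb pb; rewrite rmorphM/=; apply: gboundedM; first exact: shiftb.
  by apply: hb; exact: shiftb.
Qed.

Section Representatives.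
Variables (M : nat) (f : nat -> fps C) (N : nat -> nat) (P : PS).
Hypothesis f0 : forall k, (k < M)%N -> f k 0%N = 0.
Hypothesis PE : forall k, (k < M)%N -> exists p P', P = ofx p + (psY - ofx (f k)) * P' /\
  [/\ fps_ord p (N k), gbounded (ofx p) & gbounded P'].

(** Both ends vary: existence keeps the upper end at [M] and moves the lower one, while uniqueness
    strips factors from the upper end. *)
Let H k j : PS := \prod_(j <= l < k) (psY - ofx (f l)).

(** Induction with [Q] arbitrary. Divide [Q] by [y - f_k], then its remainder by [p], the
    restriction of [P] to the branch. Replacing [p] by [P - (y - f_k) P'] puts one part into the
    ideal, and what is left carries the extra factor [y - f_k], hence is [H M k] times a new series.
    At [k = 0] the whole product is in the ideal. *)
Lemma rep_exists k : (forall k, (k < M)%N -> gbounded (ofx (f k))) -> (k <= M)%N ->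
  forall Q, gbounded Q -> exists (c : nat -> {poly C}) (al be : PS),
    [/\ forall i, (size (c i) <= N i)%N, gbounded al, gbounded be &
      H M k * Q = \sum_(0 <= i < k) ofx (polyf (c i)) * H M i.+1 + al * P + be * H M 0].
Proof.
move=> fb; elim: k => [|k IH] kM Q Qb.
  exists (fun=> 0), 0, Q; split=> //.
  - by move=> i; rewrite size_poly0.
  - exact: gbounded0.
  - by rewrite big_geq// mul0r !add0r mulrC.
have [r [Q' [QE /(_ Qb (fb _ kM))[rb Qb']]]] := fps_div_linear Q (f0 kM).
have [p [P' [Pe [pN pb Pb']]]] := PE kM.
have [c [e [cN rE /(_ rb pb) eb]]] := fps_div_ord r pN.
have Q2b : gbounded (Q' - ofx e * P') by apply: gboundedB => //; exact: gboundedM.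
have Hb : gbounded (H M k.+1).
  rewrite /H big_seq; apply: gbounded_prod => i; rewrite mem_index_iota => /andP[_ iM].
  by apply: gboundedB; [exact: gbounded_psY|exact: fb].
have [c' [al [be [c'N alb beb E]]]] := IH (ltnW kM) _ Q2b.
exists (fun i => if i == k then c else c' i), (ofx e * H M k.+1 + al), be; split => //.
- by move=> i; case: eqP => [->|].
- by apply: gboundedD => //; exact: gboundedM.
rewrite big_nat_recr//= eqxx.
rewrite (eq_big_nat _ _ (F2 := fun i => ofx (polyf (c' i)) * H M i.+1)); last first.
  by move=> i /andP[_ ik]; rewrite ltn_eqF.
have HS : H M k = (psY - ofx (f k)) * H M k.+1 by rewrite /H big_ltn.
have -> : H M k.+1 * Q = ofx (polyf c) * H M k.+1 + ofx e * H M k.+1 * P +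
   H M k * (Q' - ofx e * P').
  by rewrite HS QE rE rmorphD rmorphM/= Pe; ring.
by rewrite E; ring.
Qed.

(** Modulo [y - f_k] for the last index only its own coefficient survives, as a multiple of [p]. Its
    size is at most the order of [p], so it vanishes together with the multiplier; the whole
    relation is then divisible by [y - f_k], which is cancelled. *)
Lemma rep_uniq (c : nat -> {poly C}) k : (k <= M)%N ->
  (forall i, (i < k)%N -> (size (c i) <= N i)%N) ->
  forall al be : PS,
  \sum_(0 <= i < k) ofx (polyf (c i)) * H k i.+1 = al * P + be * H k 0 ->
  forall i, (i < k)%N -> c i = 0.
Proof.
elim: k => // k IH kM cN al be E.
have HS j : (j <= k)%N -> H k.+1 j = H k j * (psY - ofx (f k)).
  by move=> jk; rewrite /H big_nat_recr.
have [p [P' [Pe [[p0 pN] _ _]]]] := PE kM.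
have [r [al' [alE _]]] := fps_div_linear al (f0 kM).
move: E; rewrite big_nat_recr//= (HS 0%N)//.
have -> : H k.+1 k.+1 = 1 by rewrite /H big_geq.
rewrite mulr1.
rewrite (eq_big_nat _ _ (F2 := fun i => (psY - ofx (f k)) * (ofx (polyf (c i)) * H k i.+1))); last first.
  by move=> i /andP[_ ik]; rewrite HS// mulrA mulrC mulrA.
rewrite -mulr_sumr; set S := \sum_(_ <= _ < _) _ => E.
have [] := @fps_div_linear_uniq (f k) (polyf (c k) - r * p)
  (al' * ofx p + al * P' + be * H k 0 - S) (f0 kM).
  rewrite rmorphB rmorphM/=.
  have -> : ofx (polyf (c k)) = al * P + be * (H k 0 * (psY - ofx (f k))) -
    (psY - ofx (f k)) * S by rewrite -E; ring.
  by rewrite Pe alE; ring.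
move=> E1 E2.
have ck : polyf (c k) = r * p by apply/eqP; rewrite -subr_eq0 E1.
have ck0 : c k = 0.
  apply/polyP => i; rewrite coef0.
  have [ik|ki] := ltnP i (N k); last first.
    by rewrite nth_default// (leq_trans (cN _ (ltnSn k))).
  have := congr1 (fun a => a i) ck; rewrite /polyf /= => ->.
  by rewrite (fps_ordXn p0) mulrCA fpsXnME ik.
have r0 : r = 0.
  have : fpsX ^+ N k * (r * (fun m => p (m + N k)%N)) = 0.
    rewrite mulrCA -(fps_ordXn p0) -ck ck0.
    by apply/funext => m; rewrite /polyf coef0.
  move=> /fps_mulXn_eq0 rp; have [h [ph _]] := @fps_inv (fun m => p (m + N k)%N) pN.
  by rewrite -[r]mulr1 -ph mulrA rp mul0r.
move=> i; rewrite ltnS leq_eqVlt => /orP[/eqP ->//|ik].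
apply: IH ik; [exact: ltnW|by move=> j jk; apply: cN; exact: ltnW| ].
instantiate (1 := be); instantiate (1 := al').
apply/eqP; rewrite -subr_eq0 -/S; apply/eqP.
apply: (mul_linear_eq0 (f0 kM)).
have -> : (psY - ofx (f k)) * (S - (al' * P + be * H k 0)) =
  ofx (polyf (c k)) + (psY - ofx (f k)) * S -
    ((ofx r + (psY - ofx (f k)) * al') * P + be * (H k 0 * (psY - ofx (f k)))).
  have -> : polyf (c k) = 0 by rewrite ck0; apply/funext => m; rewrite /polyf coef0.
  by rewrite r0 rmorph0; ring.
by rewrite -alE -E; ring.
Qed.

End Representatives.
End Division.

(** * Polynomials on intervals and the greedy order *)

Section PolynomialLowerBound.
Variable R : realType.
Local Notation C := R[i].

(* Each root is avoided by passing to a third of the current interval. *)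
Lemma roots_avoiding_itv (n : nat) (a T : R) (rs : seq C) (k : nat) (b0 : R) :
  (size rs + k <= n)%N -> 0 < T -> a <= b0 -> b0 + T / 3 ^+ k <= a + T ->
  exists b : R, [/\ b0 <= b, b + T / 3 ^+ (k + size rs) <= b0 + T / 3 ^+ k &
   forall y, b <= y -> y <= b + T / 3 ^+ (k + size rs) ->
     (1 + 6 * 3 ^+ n)^-1 ^+ size rs * \prod_(z <- rs) cabs ((a%:C)%C - z) <=
     \prod_(z <- rs) cabs ((y%:C)%C - z)].
Proof.
move=> + T0; elim: rs k b0 => [|z rs IH] k b0 /= kn ab bT.
  by exists b0; rewrite addn0; split=> // y _ _; rewrite !big_nil expr0 mulr1.
have p3 m : (0 : R) < 3 ^+ m by rewrite exprn_gt0.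
set l := T / 3 ^+ k in bT.
have l0 : 0 < l by rewrite divr_gt0.
have l3 : T / 3 ^+ k.+1 = l / 3 by rewrite /l exprS; field; rewrite gt_eqF.
have ln : T <= l * 3 ^+ n.
  rewrite /l mulrAC ler_pdivlMr// ler_pM2l// ler_weXn2l ?ler1n//; lia.
have [b1 [bb1 b1l far]] : exists b1, [/\ b0 <= b1, b1 + l / 3 <= b0 + l &
    forall y, b1 <= y -> y <= b1 + l / 3 -> l / 6 <= `|y - complex.Re z|].
  (* The outer third on the far side of the midpoint from [Re z] stays at distance
     [l / 2 - l / 3 = l / 6] from the root. *)
  have [zl|zl] := leP (b0 + l / 2) (complex.Re z).
    exists b0; split=> //; first lra.
    by move=> y y1 y2; rewrite ler0_norm; lra.
  exists (b0 + 2 * l / 3); split=> //; [lra|lra|].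
  by move=> y y1 y2; rewrite ger0_norm; lra.
have [|||b [b1b bl hb]] := IH k.+1 b1; [lia|lra|by rewrite l3; lra|].
have ke : (k.+1 + size rs = k + (size rs).+1)%N by rewrite addSnnS.
rewrite ke l3 in bl hb.
exists b; split; [lra|exact: le_trans bl b1l|] => y by1 by2.
rewrite !big_cons exprS mulrACA; apply: ler_pM.
- by rewrite mulr_ge0 ?cabs_ge0// invr_ge0 addr_ge0// mulr_ge0// ltW.
- rewrite mulr_ge0 ?exprn_ge0 ?invr_ge0 ?addr_ge0 ?mulr_ge0 ?(ltW (p3 _))//.
  by apply: prodr_ge0 => w _; exact: cabs_ge0.
(* Origin of the constant: [|a - z| <= T + |y - z|], and [T <= 3^n l <= 6 * 3^n |y - z|] because at
   most [n] thirds are ever taken. *)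
- rewrite ler_pdivrMl ?ltr_wpDr ?mulr_ge0 ?(ltW (p3 _))//.
  have hy : l / 6 <= cabs ((y%:C)%C - z).
    apply: le_trans (far y _ _) _; [lra|lra|].
    by apply: le_trans (cabs_Re _); case: z {far hb}.
  have : cabs ((a%:C)%C - z) <= cabs ((a%:C)%C - (y%:C)%C) + cabs ((y%:C)%C - z).
    by rewrite -(subrKA (y%:C)%C) cabsD.
  have : cabs ((a%:C)%C - (y%:C)%C) <= T.
    by rewrite -rmorphB/= cabs_real ler0_norm; lra.
  have : l * 3 ^+ n <= 6 * 3 ^+ n * cabs ((y%:C)%C - z).
    have := ler_wpM2r (ltW (p3 n)) hy; nra.
  by rewrite mulrDl mul1r; lra.
- exact: hb.
Qed.

(** Factor [h] over the algebraically closed field and avoid its roots. That [c] and the proportion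
    [3^-n] depend on the degree bound alone is essential: the lemma is applied to a polynomial in
    [y] whose coefficients vary with [x]. *)
Lemma poly_lower_itv (n : nat) : exists2 c : R, 0 < c &
  forall (h : {poly C}) (a T : R), (size h <= n.+1)%N -> 0 < T ->
  exists b : R, [/\ a <= b, b + T / 3 ^+ n <= a + T &
    forall y, b <= y -> y <= b + T / 3 ^+ n ->
      c * cabs h.[(a%:C)%C] <= cabs h.[(y%:C)%C]].
Proof.
have k0 : (0 : R) < 1 + 6 * 3 ^+ n by rewrite ltr_wpDr// mulr_ge0// exprn_ge0.
exists ((1 + 6 * 3 ^+ n)^-1 ^+ n); first by rewrite exprn_gt0// invr_gt0.
move=> h a T hn T0.
have p3 m : (0 : R) < 3 ^+ m by rewrite exprn_gt0.
have [h0|h0] := eqVneq h 0.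
  exists a; split=> // [|y _ _]; last by rewrite h0 !horner0 cabs0 mulr0.
  by rewrite lerD2l ler_pdivrMr// ler_peMr ?(ltW T0)// exprn_ege1// ler1n.
have [rs hE] := closed_field_poly_normal h.
have srs : (size rs <= n)%N.
  move: hn; rewrite hE size_scale ?lead_coef_eq0//.
  by rewrite (big_nth 0) big_mkord size_prod_XsubC ?size_tuple// /index_enum -enumT size_enum_ord.
have aT : a + T / 3 ^+ 0 <= a + T by rewrite expr0 divr1.
have sn : (size rs + 0 <= n)%N by rewrite addn0.
have [b [ab bT hb]] := @roots_avoiding_itv n a T rs 0 a sn T0 (lexx a) aT.
rewrite add0n in bT hb.
have le3 : T / 3 ^+ n <= T / 3 ^+ size rs.
  by rewrite ler_pM2l// lef_pV2 ?posrE// ler_weXn2l ?ler1n.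
exists b; split=> //; first by rewrite expr0 divr1 in bT; lra.
move=> y y1 y2; rewrite hE !hornerZ !cabsM mulrCA ler_wpM2l ?cabs_ge0//.
rewrite !horner_prod !cabs_prod.
have e x : \prod_(z <- rs) cabs ('X - z%:P).[x] = \prod_(z <- rs) cabs (x - z) :> R.
  by apply: eq_bigr => z _; rewrite !hornerE.
rewrite !e; apply: le_trans (hb y y1 _); last by rewrite (le_trans y2)// lerD2l.
rewrite ler_wpM2r ?prodr_ge0// => [z _|]; first exact: cabs_ge0.
rewrite ler_wiXn2l ?invr_ge0 ?(ltW k0)// invf_le1// lerDl mulr_ge0//.
Qed.

End PolynomialLowerBound.

Section GreedyOrder.
Variable R : realType.

(** The weight depends on the set still available, so the list is built from its end: a maximiser
    for [S] goes last and the rest is ordered recursively. Each prefix is then exactly the set from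
    which its last element was chosen. *)
Lemma greedy_seq (T : finType) (w : {set T} -> T -> R) n (S : {set T}) : #|S| = n ->
  exists l : seq T, [/\ uniq l, size l = n, [set x in l] = S &
   forall x0 i k, (i <= k)%N -> (k < n)%N ->
     w [set x in take k.+1 l] (nth x0 l i) <= w [set x in take k.+1 l] (nth x0 l k)].
Proof.
elim: n S => [|n IH] S Sn.
  exists [::]; split=> //; apply/setP => x; rewrite !inE.
  by move/eqP: Sn; rewrite cards_eq0 => /eqP ->; rewrite inE.
have [y yS] : exists y, y \in S by apply/card_gt0P; rewrite Sn.
pose x := [arg max_(x > y in S) w S x]%O.
have [xS xmax] : x \in S /\ forall y, y \in S -> w S y <= w S x.
  by rewrite /x; case: arg_maxP => // x' ? ?; split.
have [l [ul sl lS hl]] : exists l : seq T, [/\ uniq l, size l = n, [set x in l] = S :\ x &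
   forall x0 i k, (i <= k)%N -> (k < n)%N ->
     w [set x in take k.+1 l] (nth x0 l i) <= w [set x in take k.+1 l] (nth x0 l k)].
  by apply: IH; move: Sn; rewrite (cardsD1 x) xS => -[].
have xl : x \notin l by have := setD11 x S; rewrite -lS inE => ->.
have lxS : [set z in rcons l x] = S.
  apply/setP => z; rewrite inE mem_rcons inE.
  have := congr1 (fun A : {set T} => z \in A) lS; rewrite !inE => ->.
  by case: eqVneq => [->|].
exists (rcons l x); split=> //.
- by rewrite rcons_uniq xl.
- by rewrite size_rcons sl.
move=> x0 i k ik; rewrite ltnS leq_eqVlt => /orP[/eqP kn|kn].
  rewrite kn take_oversize ?size_rcons ?sl// lxS.
  rewrite [in leRHS]nth_rcons sl ltnn eqxx; apply: xmax.
  rewrite -lxS inE mem_nth// size_rcons sl ltnS -kn.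
  exact: ik.
have -> : take k.+1 (rcons l x) = take k.+1 l by rewrite -cats1 takel_cat// sl.
by rewrite !nth_rcons sl (leq_ltn_trans ik kn) kn; exact: hl.
Qed.

Lemma greedy_perm M (w : {set 'I_M} -> 'I_M -> R) : exists s : {perm 'I_M},
  forall i k : 'I_M, (i <= k)%N ->
    w [set s j | j : 'I_M & (j <= k)%N] (s i) <= w [set s j | j : 'I_M & (j <= k)%N] (s k).
Proof.
have [l [ul sl lS hl]] := greedy_seq w (cardsT 'I_M).
rewrite card_ord in sl hl.
pose tl : M.-tuple 'I_M := Tuple (introT eqP sl).
have injt : injective (tnth tl) by apply/tuple_uniqP.
exists (perm injt) => i k ik.
have -> : [set perm injt j | j : 'I_M & (j <= k)%N] = [set x in take k.+1 l].
  apply/setP => x; rewrite inE; apply/imsetP/idP => [[j]|].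
    rewrite inE => jk ->; rewrite permE (tnth_nth x)/=.
    rewrite -(nth_take x (n0 := k.+1)) ?ltnS// mem_nth// size_take sl.
    by case: ifP => _; [exact: jk|exact: ltn_ord].
  move=> /(nthP x)[m]; rewrite size_take sl => mk <-.
  have mk1 : (m < k.+1)%N by move: mk; case: ifP => // /negbT; have := ltn_ord k; lia.
  have mM : (m < M)%N by have := ltn_ord k; lia.
  exists (Ordinal mM); first by rewrite inE/= -ltnS.
  by rewrite permE (tnth_nth x)/= nth_take.
rewrite !permE !(tnth_nth (perm injt k))/=.
exact: hl.
Qed.

End GreedyOrder.

Local Open Scope classical_set_scope.

(** * Evaluation *)

Section Limits.
Variable R : realType.

Lemma le0_geo2 (x B : R) : (forall N, x <= B * 2^-1 ^+ N) -> x <= 0.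
Proof.
move=> h.
have half1 : `|2^-1 : R| < 1 by rewrite gtr0_norm ?invf_lt1// ltr1n.
by apply: (cvgr_to_ge (cvg_geometric B half1)); apply: nearW => N; exact: h.
Qed.

Lemma geo_cauchy (u : nat -> R) (B : R) :
  (forall N, `|u N.+1 - u N| <= B * 2^-1 ^+ N) ->
  cvgn u /\ forall N, `|u N - limn u| <= 2 * B * 2^-1 ^+ N.
Proof.
move=> h.
have half1 : `|2^-1 : R| < 1 by rewrite gtr0_norm ?invf_lt1// ltr1n.
have B0 : 0 <= B by have := h 0%N; rewrite expr0 mulr1; apply: le_trans.
have h2 N k : `|u (N + k)%N - u N| <= 2 * B * (2^-1 ^+ N - 2^-1 ^+ (N + k)).
  elim: k => [|k IH]; first by rewrite addn0 !subrr normr0 mulr0.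
  rewrite addnS (le_trans (ler_distD (u (N + k)%N) _ _))//.
  apply: le_trans (lerD (h _) IH) _; rewrite exprS.
  by set e := _ ^+ (N + k); set e' := _ ^+ N; lra.
have hb N k : `|u (N + k)%N - u N| <= 2 * B * 2^-1 ^+ N.
  apply: le_trans (h2 N k) _; rewrite ler_wpM2l ?mulr_ge0// lerBlDr lerDl.
  by rewrite exprn_ge0// invr_ge0.
have cu : cvgn u.
  (* Subtracting twice the error bound makes the sequence nondecreasing, so convergence follows from
     boundedness. *)
  pose v N := u N - 2 * B * 2^-1 ^+ N.
  have cv : cvgn v.
    apply: nondecreasing_is_cvgn.
      apply/nondecreasing_seqP => N; rewrite /v exprS.
      have := h N; rewrite ler_norml => /andP[+ _].
      by set e := _ ^+ N; lra.
    exists (u 0%N + 2 * B) => _ [N _ <-]; rewrite /v.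
    have := hb 0%N N; rewrite add0n expr0 ler_norml => /andP[_].
    have : 0 <= 2 * B * 2^-1 ^+ N by rewrite !mulr_ge0 ?exprn_ge0 ?invr_ge0.
    by lra.
  have -> : u = (fun N => v N + geometric (2 * B) 2^-1 N).
    by apply/funext => N; rewrite /v /geometric/= subrK.
  by apply: is_cvgD => //; apply: cvgP (cvg_geometric _ half1).
split=> // N; rewrite distrC.
have cN : (fun k => `|u (N + k)%N - u N|) @ \oo --> `|limn u - u N|.
  apply: cvg_norm; apply: cvgB; last exact: cvg_cst.
  rewrite (_ : (fun k => u (N + k)%N) = (fun k => u (k + N)%N)); last first.
    by apply/funext => k; rewrite addnC.
  by rewrite cvg_shiftn.
by apply: (cvgr_to_le cN); apply: nearW => k; exact: hb.
Qed.

End Limits.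

Section Evaluation.
Variable R : realType.
Local Notation C := R[i].
Local Notation PS := (fps (fps C)).
Implicit Types (a b : PS) (z w : C).

Lemma cabs_sum_geo2 N (B : R) (F : nat -> C) : 0 <= B ->
  (forall i, cabs (F i) <= B * 2^-1 ^+ i) -> cabs (\sum_(i < N) F i) <= 2 * B.
Proof.
move=> B0 hF; apply: le_trans (cabs_sum _ _ _) _.
apply: le_trans (_ : \sum_(i < N) B * 2^-1 ^+ i <= _).
  by apply: ler_sum => i _.
by rewrite -mulr_sumr mulrC ler_wpM2r// sum_geo2.
Qed.

Lemma gle_term r K a z w t m n : 0 < r -> gle r K a -> 0 <= t ->
  cabs z <= r * t -> cabs w <= r * t ->
  cabs (a m n * z ^+ m * w ^+ n) <= K * (t ^+ m * t ^+ n).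
Proof.
move=> r0 h t0 zr wr; rewrite !cabsM !cabsX.
have e v k : cabs v <= r * t -> cabs v ^+ k <= r ^+ k * t ^+ k :> R.
  by move=> vr; rewrite -exprMn lerXn2r// nnegrE ?cabs_ge0// mulr_ge0// ltW.
apply: le_trans (_ : cabs (a m n) * (r ^+ m * t ^+ m) * (r ^+ n * t ^+ n) <= _).
  apply: ler_pM; rewrite ?mulr_ge0 ?cabs_ge0 ?exprn_ge0 ?cabs_ge0 ?e//.
  by rewrite ler_wpM2l ?cabs_ge0// e.
have := h m n; rewrite exprD => h'.
rewrite [leLHS](_ : _ = cabs (a m n) * (r ^+ m * r ^+ n) * (t ^+ m * t ^+ n)); last by ring.
by rewrite ler_wpM2r// mulr_ge0// exprn_ge0.
Qed.

Lemma half_ge0 : 0 <= (2^-1 : R). Proof. by rewrite invr_ge0. Qed.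
Lemma halfX_ge0 n : 0 <= (2^-1 : R) ^+ n. Proof. by rewrite exprn_ge0// half_ge0. Qed.
Local Hint Resolve half_ge0 halfX_ge0 : core.

Lemma ps_partialS a z w N : ps_partial a z w N.+1 - ps_partial a z w N =
  \sum_(m < N) a m N * z ^+ m * w ^+ N + \sum_(n < N.+1) a N n * z ^+ N * w ^+ n.
Proof.
rewrite /ps_partial big_ord_recr/=.
under eq_bigr do rewrite big_ord_recr/=.
by rewrite big_split/=; ring.
Qed.

(** Enlarging the square by one row and one column changes the partial sum by at most
    [4 * K * 2^-N]. Summing the tail doubles this, and treating real and imaginary parts separately
    doubles it again, whence 16. *)
Lemma ps_eval_cvg r K a z w : 0 < r -> gle r K a ->
  cabs z <= r * 2^-1 -> cabs w <= r * 2^-1 ->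
  [/\ cvgn (fun N => complex.Re (ps_partial a z w N)),
      cvgn (fun N => complex.Im (ps_partial a z w N)) &
  forall N, cabs (ps_partial a z w N - ps_eval a z w) <= 16 * K * 2^-1 ^+ N].
Proof.
move=> r0 h zr wr; have K0 := gle_ge0 r0 h.
have hN N : cabs (ps_partial a z w N.+1 - ps_partial a z w N) <= 4 * K * 2^-1 ^+ N.
  rewrite ps_partialS (le_trans (cabsD _ _))//.
  rewrite [leRHS](_ : _ = 2 * (K * 2^-1 ^+ N) + 2 * (K * 2^-1 ^+ N)); last by ring.
  apply: lerD.
    apply: (@cabs_sum_geo2 _ _ (fun i => a i N * z ^+ i * w ^+ N)) => [|i].
      by rewrite mulr_ge0.
    apply: le_trans (gle_term _ _ r0 h half_ge0 zr wr) _.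
    by rewrite -mulrA (mulrC (_ ^+ N)).
  apply: (@cabs_sum_geo2 _ _ (fun i => a N i * z ^+ N * w ^+ i)) => [|i].
    by rewrite mulr_ge0.
  apply: le_trans (gle_term _ _ r0 h half_ge0 zr wr) _.
  by rewrite -mulrA.
pose u := fun N => complex.Re (ps_partial a z w N).
pose v := fun N => complex.Im (ps_partial a z w N).
have [cu hu] := @geo_cauchy R u (4 * K) (fun N => le_trans
   (le_trans (eq_ind _ (fun x => `|x| <= _) (cabs_Re _) _
   (raddfB (@complex.Re R : Rcomplex R -> R) _ _)) (lexx _)) (hN N)).
have [cv hv] := @geo_cauchy R v (4 * K) (fun N => le_trans
   (le_trans (eq_ind _ (fun x => `|x| <= _) (cabs_Im _) _
   (raddfB (@complex.Im R : Rcomplex R -> R) _ _)) (lexx _)) (hN N)).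
split=> // N; apply: le_trans (cabs_ReIm _) _.
have -> : complex.Re (ps_partial a z w N - ps_eval a z w) = u N - limn u.
  exact: (raddfB (@complex.Re R : Rcomplex R -> R)).
have -> : complex.Im (ps_partial a z w N - ps_eval a z w) = v N - limn v.
  exact: (raddfB (@complex.Im R : Rcomplex R -> R)).
apply: le_trans (lerD (hu N) (hv N)) _.
by lra.
Qed.

Lemma ps_eval_eq r K a z w v B : 0 < r -> gle r K a ->
  cabs z <= r * 2^-1 -> cabs w <= r * 2^-1 ->
  (forall N, cabs (ps_partial a z w N - v) <= B * 2^-1 ^+ N) -> ps_eval a z w = v.
Proof.
move=> r0 h zr wr hv; have [_ _ hN] := ps_eval_cvg r0 h zr wr.
apply/eqP; rewrite -subr_eq0 -cabs_eq0 eq_le cabs_ge0 andbT.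
apply: (@le0_geo2 _ _ (16 * K + B)) => N.
rewrite -(subrKA (ps_partial a z w N)) (le_trans (cabsD _ _))// cabsBC mulrDl.
by apply: lerD.
Qed.

Lemma ps_eval_bound r K a z w : 0 < r -> gle r K a ->
  cabs z <= r * 2^-1 -> cabs w <= r * 2^-1 -> cabs (ps_eval a z w) <= 16 * K.
Proof.
move=> r0 h zr wr; have [_ _ /(_ 0%N)] := ps_eval_cvg r0 h zr wr.
by rewrite /ps_partial big_ord0 sub0r cabsN expr0 mulr1.
Qed.

Lemma sum_triangle N (F : nat -> nat -> C) :
  \sum_(m < N) \sum_(i < m.+1) F i (m - i)%N =
  \sum_(i < N) \sum_(j < N) (if (i + j < N)%N then F i j else 0).
Proof.
transitivity (\sum_(i < N) \sum_(j < N - i) F i j).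
  elim: N => [|N IH]; first by rewrite !big_ord0.
  rewrite big_ord_recr/= IH [RHS]big_ord_recr/= subSnn big_ord1.
  rewrite big_ord_recr/= subnn addrA; congr (_ + _).
  rewrite -big_split/=; apply: eq_bigr => i _.
  by rewrite subSn ?big_ord_recr//= ltnW.
apply: eq_bigr => i _; rewrite (big_ord_widen N (F i)) ?leq_subr// big_mkcond/=.
by apply: eq_bigr => j _; rewrite ltn_subRL.
Qed.

Lemma ps_partialM a b z w N : ps_partial (a * b) z w N =
  \sum_(i < N) \sum_(i' < N) \sum_(j < N) \sum_(j' < N)
    (if (i + i' < N)%N && (j + j' < N)%N then
     (a i j * z ^+ i * w ^+ j) * (b i' j' * z ^+ i' * w ^+ j') else 0).
Proof.
pose T i i' j j' := (a i j * z ^+ i * w ^+ j) * (b i' j' * z ^+ i' * w ^+ j').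
transitivity (\sum_(m < N) \sum_(i < m.+1) \sum_(n < N) \sum_(j < n.+1)
   T i (m - i)%N j (n - j)%N).
  apply: eq_bigr => m _; rewrite exchange_big/=; apply: eq_bigr => n _.
  rewrite fps2_mulE !mulr_suml; apply: eq_bigr => i _.
  rewrite !mulr_suml; apply: eq_bigr => j _.
  rewrite /T; have im := ltn_ord i; have jn := ltn_ord j.
  rewrite -[in z ^+ m](@subnKC i m)// -[in w ^+ n](@subnKC j n)// !exprD.
  by ring.
rewrite (sum_triangle _ (fun i i' => \sum_(n < N) \sum_(j < n.+1) T i i' j (n - j)%N)).
apply: eq_bigr => i _; apply: eq_bigr => i' _.
case: ifP => _ /=; last by rewrite big1// => j _; rewrite big1.
exact: (sum_triangle _ (T i i')).
Qed.

(** The product of the partial sums exceeds the partial sum of the product by the quadruples with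
    [i + i' >= N] or [j + j' >= N]. At a quarter of the radius each such term carries
    [4^-(i+i'+j+j')]: one square root of this pays the factor [2^-N], the other is summed over four
    geometric series, giving [2^4 = 16]. *)
Lemma ps_evalM r K K' a b z w : 0 < r -> gle r K a -> gle r K' b ->
  cabs z <= r * (2^-1 * 2^-1) -> cabs w <= r * (2^-1 * 2^-1) ->
  ps_eval (a * b) z w = ps_eval a z w * ps_eval b z w.
Proof.
move=> r0 ha hb zr wr.
have K0 := gle_ge0 r0 ha; have K'0 := gle_ge0 r0 hb.
have r20 : 0 < r * 2^-1 by rewrite mulr_gt0// invr_gt0.
have hab : gle (r * 2^-1) (K * K') (a * b).
  move=> m n.
  rewrite [leLHS](_ : _ = cabs ((a * b) m n) * r ^+ (m + n) *
    (2^-1 ^+ m * 2^-1 ^+ n)); last by rewrite exprMn !exprD; ring.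
  apply: le_trans (_ : K * K' * (m.+1%:R * n.+1%:R) * (2^-1 ^+ m * 2^-1 ^+ n) <= _).
    by rewrite ler_wpM2r ?mulr_ge0//; exact: gleM.
  rewrite -mulrA ler_piMr ?mulr_ge0// mulrACA.
  by apply: mulr_ile1; rewrite ?mulr_ge0// succ_le_exp2.
have q4 : r * (2^-1 * 2^-1) <= r * 2^-1.
  by rewrite mulrA ler_piMr ?(ltW r20)// invf_le1// ler1n.
have zr2 := le_trans zr q4; have wr2 := le_trans wr q4.
have [_ _ ea] := ps_eval_cvg r0 ha zr2 wr2.
have [_ _ eb] := ps_eval_cvg r0 hb zr2 wr2.
have ba := ps_eval_bound r0 ha zr2 wr2.
apply: (@ps_eval_eq _ _ _ _ _ _ (16 * (K * K') + 16 * K * (32 * K') + 16 * K * (16 * K')) r20 hab);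
  rewrite -?mulrA//.
move=> N.
pose T i i' j j' := (a i j * z ^+ i * w ^+ j) * (b i' j' * z ^+ i' * w ^+ j').
have D : cabs (ps_partial (a * b) z w N - ps_partial a z w N * ps_partial b z w N) <=
   16 * (K * K') * 2^-1 ^+ N.
  have -> : ps_partial a z w N * ps_partial b z w N =
    \sum_(i < N) \sum_(i' < N) \sum_(j < N) \sum_(j' < N) T i i' j j'.
    rewrite /ps_partial mulr_suml; apply: eq_bigr => i _.
    rewrite mulr_sumr; apply: eq_bigr => i' _.
    by rewrite mulr_suml; apply: eq_bigr => j _; rewrite mulr_sumr.
  rewrite ps_partialM cabsBC -sumrB.
  pose h n : R := 2^-1 ^+ n.
  have h0 n : 0 <= h n by exact: halfX_ge0.
  have KK : 0 <= K * K' * h N by rewrite !mulr_ge0.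
  have Tle i i' j j' : (N <= i + i')%N || (N <= j + j')%N ->
    cabs (T i i' j j') <= K * K' * h N * h i * h i' * h j * h j'.
    move=> hN; rewrite /T cabsM.
    have q0 : (0 : R) <= 2^-1 * 2^-1 by rewrite mulr_ge0.
    apply: le_trans (ler_pM (cabs_ge0 _) (cabs_ge0 _)
      (gle_term i j r0 ha q0 zr wr) (gle_term i' j' r0 hb q0 zr wr)) _.
    rewrite !exprMn -/(h i) -/(h i') -/(h j) -/(h j').
    have hle : h i * h i' * h j * h j' <= h N.
      rewrite /h -!exprD ler_wiXn2l//; first by rewrite invf_le1// ler1n.
      by move: hN; clear; lia.
    rewrite [leLHS](_ : _ = K * K' * (h i * h i' * h j * h j') *
      (h i * h i' * h j * h j')); last by ring.
    rewrite [leRHS](_ : _ = K * K' * h N * (h i * h i' * h j * h j')); last by ring.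
    by rewrite ler_wpM2r ?mulr_ge0// ler_wpM2l// mulr_ge0.
  rewrite [leRHS](_ : _ = 2 * (2 * (2 * (2 * (K * K' * h N))))); last by rewrite /h; ring.
  rewrite [X in cabs X](_ : _ = \sum_(i < N) \sum_(i' < N) \sum_(j < N) \sum_(j' < N)
     (if (i + i' < N)%N && (j + j' < N)%N then 0 else T i i' j j')); last first.
    apply: eq_bigr => i _; rewrite -sumrB; apply: eq_bigr => i' _.
    rewrite -sumrB; apply: eq_bigr => j _; rewrite -sumrB; apply: eq_bigr => j' _.
    by case: ifP => _; rewrite ?subrr ?subr0.
  apply: (@cabs_sum_geo2 _ _ (fun i => \sum_(i' < N) \sum_(j < N) \sum_(j' < N)
     (if (i + i' < N)%N && (j + j' < N)%N then 0 else T i i' j j'))) => [|i].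
    by rewrite !mulr_ge0.
  rewrite [leRHS](_ : _ = 2 * (2 * (2 * (K * K' * h N * h i)))); last by rewrite -!mulrA.
  apply: (@cabs_sum_geo2 _ _ (fun i' => \sum_(j < N) \sum_(j' < N)
     (if (i + i' < N)%N && (j + j' < N)%N then 0 else T i i' j j'))) => [|i'].
    by rewrite !mulr_ge0.
  rewrite [leRHS](_ : _ = 2 * (2 * (K * K' * h N * h i * h i'))); last by rewrite -!mulrA.
  apply: (@cabs_sum_geo2 _ _ (fun j => \sum_(j' < N)
     (if (i + i' < N)%N && (j + j' < N)%N then 0 else T i i' j j'))) => [|j].
    by rewrite !mulr_ge0.
  rewrite [leRHS](_ : _ = 2 * (K * K' * h N * h i * h i' * h j)); last by rewrite -!mulrA.
  apply: (@cabs_sum_geo2 _ _ (fun j' =>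
     (if (i + i' < N)%N && (j + j' < N)%N then 0 else T i i' j j'))) => [|j'].
    by rewrite !mulr_ge0.
  case: ifP => hN; first by rewrite cabs0 !mulr_ge0.
  apply: le_trans (Tle _ _ _ _ _) _; last by [].
  by move/negbT: hN; rewrite negb_and -!leqNgt.
set pa := ps_partial a z w N in D *; set pb := ps_partial b z w N in D *.
rewrite -(subrKA (pa * pb)) (le_trans (cabsD _ _))//.
apply: le_trans (lerD D (lexx _)) _.
rewrite [leRHS](_ : _ = 16 * (K * K') * 2^-1 ^+ N + (16 * K * 2^-1 ^+ N * (32 * K') + 16 * K * (16 * K' * 2^-1 ^+ N))); last by ring.
rewrite lerD2l.
have -> : pa * pb - ps_eval a z w * ps_eval b z w =
  (pa - ps_eval a z w) * pb + ps_eval a z w * (pb - ps_eval b z w) by ring.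
rewrite (le_trans (cabsD _ _))// !cabsM; apply: lerD.
  apply: ler_pM; rewrite ?cabs_ge0// ?ea//.
  have -> : pb = (pb - ps_eval b z w) + ps_eval b z w by rewrite subrK.
  rewrite (le_trans (cabsD _ _))//.
  rewrite [leRHS](_ : _ = 16 * K' + 16 * K'); last by ring.
  apply: lerD; last exact: ps_eval_bound hb zr2 wr2.
  apply: le_trans (eb N) _; rewrite ler_piMr ?mulr_ge0//.
  by rewrite exprn_ile1// invf_le1// ler1n.
by apply: ler_pM; rewrite ?cabs_ge0// ?eb.
Qed.

End Evaluation.

(** * Values at real points near the origin *)

Section NearOrigin.
Variable R : realType.
Local Notation C := R[i].
Local Notation PS := (fps (fps C)).
Implicit Types (a b : PS) (z : R * R).

(** [ps_eval] is built from [limn], which is meaningful only where the partial sums converge; hence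
    algebraic identities for [evR] are stated for points near the origin. *)
Definition evR a z : C := ps_eval a ((z.1)%:C)%C ((z.2)%:C)%C.

Definition box (r : R) : set (R * R) := [set z | `|z.1| <= r /\ `|z.2| <= r].

Lemma near_box (r : R) : 0 < r -> \forall z \near ((0 : R), (0 : R)), box r z.
Proof.
move=> r0; exists ([set x | `|x| <= r], [set x | `|x| <= r]); last by move=> z [].
by split=> /=; apply/nbhs_ballP; exists r => //= x; rewrite /ball/= sub0r normrN => /ltW.
Qed.

Lemma near_boxE (Q : R * R -> Prop) : (\forall z \near ((0 : R), (0 : R)), Q z) ->
  exists2 r : R, 0 < r & forall z, box r z -> Q z.
Proof.
move=> [[U V] /= [/nbhs_ballP[e e0 eU] /nbhs_ballP[e' e'0 eV]] UV].
have m0 : 0 < Num.min e e' by rewrite lt_min; apply/andP.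
exists (Num.min e e' / 2); first by rewrite divr_gt0.
move=> [x y] [/= xr yr]; apply: UV; split=> /=.
  apply: eU; rewrite /ball/= sub0r normrN (le_lt_trans xr)//.
  by rewrite ltr_pdivrMr// (le_lt_trans (_ : _ <= e))// ?ge_min ?lexx// ltr_pMr// ltr1n.
apply: eV; rewrite /ball/= sub0r normrN (le_lt_trans yr)//.
rewrite ltr_pdivrMr// (le_lt_trans (_ : _ <= e'))// ?ge_min ?lexx ?orbT// ltr_pMr// ltr1n//.
Qed.

Lemma near_cabs (r : R) : 0 < r -> \forall z \near ((0 : R), (0 : R)),
  cabs ((z.1)%:C)%C <= r /\ cabs ((z.2)%:C)%C <= r.
Proof. by move=> /near_box; apply: filterS => z []; rewrite !cabs_real. Qed.

Lemma evR_bounded a : gbounded a ->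
  exists2 K : R, 0 <= K & \forall z \near ((0 : R), (0 : R)), cabs (evR a z) <= K.
Proof.
move=> [r [K [r0 _ h]]]; exists (16 * K); first by rewrite mulr_ge0// (gle_ge0 r0 h).
have r20 : 0 < r * 2^-1 by rewrite mulr_gt0// invr_gt0.
apply: filterS (near_cabs r20) => z [z1 z2].
exact: ps_eval_bound h z1 z2.
Qed.

Lemma evRM a b : gbounded a -> gbounded b ->
  \forall z \near ((0 : R), (0 : R)), evR (a * b) z = evR a z * evR b z.
Proof.
move=> ha hb; have [r [K [K' [r0 r1 {}ha {}hb]]]] := gbounded2 ha hb.
have r20 : 0 < r * (2^-1 * 2^-1) by rewrite !mulr_gt0// invr_gt0.
apply: filterS (near_cabs r20) => z [z1 z2].
exact: ps_evalM ha hb z1 z2.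
Qed.

Lemma ps_partialD a b (z w : C) N :
  ps_partial (a + b) z w N = ps_partial a z w N + ps_partial b z w N.
Proof.
rewrite /ps_partial -big_split/=; apply: eq_bigr => i _.
by rewrite -big_split/=; apply: eq_bigr => j _; rewrite !fps_addE !mulrDl.
Qed.

Lemma evRD a b : gbounded a -> gbounded b ->
  \forall z \near ((0 : R), (0 : R)), evR (a + b) z = evR a z + evR b z.
Proof.
move=> ha hb; have [r'' [K'' [r0'' _ hab]]] := gboundedD ha hb.
have [r [K [K' [r0 r1 {}ha {}hb]]]] := gbounded2 ha hb.
have r20 : 0 < r * 2^-1 by rewrite mulr_gt0// invr_gt0.
have r20'' : 0 < r'' * 2^-1 by rewrite mulr_gt0// invr_gt0.
apply: filterS2 (near_cabs r20) (near_cabs r20'') => z [z1 z2] [z1' z2'].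
apply: (ps_eval_eq (B := 16 * K + 16 * K') r0'' hab z1' z2') => N.
have [_ _ ea] := ps_eval_cvg r0 ha z1 z2.
have [_ _ eb] := ps_eval_cvg r0 hb z1 z2.
rewrite ps_partialD opprD addrACA (le_trans (cabsD _ _))// mulrDl.
exact: lerD (ea N) (eb N).
Qed.

Lemma evR_const (c : C) :
  \forall z \near ((0 : R), (0 : R)), evR (fps_const (fps_const c)) z = c.
Proof.
have [r [K [r0 _ h]]] := gbounded_const c.
have r20 : 0 < r * 2^-1 by rewrite mulr_gt0// invr_gt0.
apply: filterS (near_cabs r20) => z [z1 z2].
apply: (ps_eval_eq (B := cabs c) r0 h z1 z2) => -[|N].
  by rewrite /ps_partial big_ord0 sub0r cabsN mulr1.
have -> : ps_partial (fps_const (fps_const c)) ((z.1)%:C)%C ((z.2)%:C)%C N.+1 = c.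
  rewrite /ps_partial big_ord_recl [X in _ + X]big1 ?addr0 => [|i _]; last first.
    by rewrite big1// => j _; rewrite /fps_const/= !mul0r.
  rewrite big_ord_recl [X in _ + X]big1 ?addr0 => [|j _].
    by rewrite /= !mulr1.
  by rewrite /fps_const/= !mul0r.
by rewrite subrr cabs0 mulr_ge0 ?cabs_ge0// halfX_ge0.
Qed.

Lemma evR0 : \forall z \near ((0 : R), (0 : R)), evR 0 z = 0.
Proof. by have := evR_const 0; rewrite !fps_const0. Qed.
Lemma evR1 : \forall z \near ((0 : R), (0 : R)), evR 1 z = 1.
Proof. exact: evR_const 1. Qed.

Lemma evR_support2 a v :
  (forall m n, (1 < m + n)%N -> a m n = 0) ->
  (\forall z \near ((0 : R), (0 : R)), ps_partial a ((z.1)%:C)%C ((z.2)%:C)%C 2 = v z) ->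
  \forall z \near ((0 : R), (0 : R)), evR a z = v z.
Proof.
move=> a0 av.
have [r [K [r0 _ h]]] := gbounded_support a0.
have r20 : 0 < r * 2^-1 by rewrite mulr_gt0// invr_gt0.
apply: filterS2 av (near_cabs r20) => z hv [z1 z2].
set p := ps_partial a _ _ in hv *.
(* The partial sums are exact from [N = 2] on, so [B] has to cover [N = 0] and [N = 1] only; the 2
   compensates the factor 1/2 at [N = 1]. *)
apply: (ps_eval_eq (B := cabs (p 0%N - v z) + 2 * cabs (p 1%N - v z)) r0 h z1 z2).
have P2 k : p k.+2 = v z.
  elim: k => // k <-; apply/eqP; rewrite -subr_eq0 /p ps_partialS.
  rewrite big1 ?add0r ?big1// => i _; rewrite a0 ?mul0r//.
  by rewrite addnC.
case=> [|[|N]].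
- by rewrite expr0 mulr1 lerDl mulr_ge0 ?cabs_ge0.
- rewrite -/(p 1%N) expr1 mulrDl mulrAC divff ?pnatr_eq0// mul1r lerDr.
  by rewrite mulr_ge0 ?cabs_ge0 ?half_ge0.
- by rewrite -/(p N.+2) P2 subrr cabs0 mulr_ge0 ?halfX_ge0// addr_ge0 ?mulr_ge0 ?cabs_ge0.
Qed.

Lemma evRY : \forall z \near ((0 : R), (0 : R)), evR (psY R) z = ((z.2)%:C)%C.
Proof.
apply: evR_support2 => [[|m] [|[|n]]//|].
apply: filterS (near_box ltr01) => z _; rewrite /ps_partial !big_ord_recl !big_ord0/=.
by rewrite /psY /fps_const /fpsX/= !(mul0r, mulr0, addr0, add0r, mul1r, mulr1, expr1).
Qed.

Lemma evRX : \forall z \near ((0 : R), (0 : R)), evR (ofx fpsX) z = ((z.1)%:C)%C.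
Proof.
apply: evR_support2 => [[|[|m]] [|n]//|].
apply: filterS (near_box ltr01) => z _; rewrite /ps_partial !big_ord_recl !big_ord0/=.
by rewrite /ofx /fps_const /fpsX/= !(mul0r, mulr0, addr0, add0r, mul1r, mulr1, expr1).
Qed.

Lemma evR_prod I (r : seq I) (F : I -> PS) : (forall i, gbounded (F i)) ->
  \forall z \near ((0 : R), (0 : R)),
    evR (\prod_(i <- r) F i) z = \prod_(i <- r) evR (F i) z.
Proof.
move=> hF; elim: r => [|i r IH].
  by apply: filterS evR1 => z; rewrite !big_nil.
have := evRM (hF i) (gbounded_prod r (fun i _ => hF i) (Q := xpredT)).
by apply: filterS2 IH => z e; rewrite !big_cons => ->; rewrite e.
Qed.

Lemma evR_sum I (r : seq I) (F : I -> PS) : (forall i, gbounded (F i)) ->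
  \forall z \near ((0 : R), (0 : R)),
    evR (\sum_(i <- r) F i) z = \sum_(i <- r) evR (F i) z.
Proof.
move=> hF; elim: r => [|i r IH].
  by apply: filterS evR0 => z; rewrite !big_nil.
have := evRD (hF i) (gbounded_sum r (fun i _ => hF i) (Q := xpredT)).
by apply: filterS2 IH => z e; rewrite !big_cons => ->; rewrite e.
Qed.

Lemma evRN a : gbounded a -> \forall z \near ((0 : R), (0 : R)), evR (- a) z = - evR a z.
Proof.
move=> ha; have hN := gboundedN ha; have := evRD ha hN.
apply: filterS2 evR0 => z z0; rewrite subrr z0 => /esym/eqP.
by rewrite addrC addr_eq0 => /eqP.
Qed.

Lemma evRB a b : gbounded a -> gbounded b ->
  \forall z \near ((0 : R), (0 : R)), evR (a - b) z = evR a z - evR b z.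
Proof.
move=> ha hb; have := evRD ha (gboundedN hb).
by apply: filterS2 (evRN hb) => z <-.
Qed.

Lemma ps_partial_conj a (x y : R) N :
  ps_partial (ps_conj a) (x%:C)%C (y%:C)%C N = ((ps_partial a (x%:C)%C (y%:C)%C N)^*)%C.
Proof.
rewrite /ps_partial rmorph_sum/=; apply: eq_bigr => i _.
rewrite rmorph_sum/=; apply: eq_bigr => j _.
have cr (t : R) k : (((t%:C)%C ^+ k)^*)%C = (t%:C)%C ^+ k.
  by rewrite -rmorphXn/= /conjc/= oppr0.
by rewrite !rmorphM/= !cr.
Qed.

Lemma evR_conj a : gbounded a ->
  \forall z \near ((0 : R), (0 : R)), evR (ps_conj a) z = ((evR a z)^*)%C.
Proof.
move=> ha; have [r' [K' [r0' _ h']]] := gbounded_conj ha.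
have [r [K [r0 _ h]]] := ha.
have r20 : 0 < r * 2^-1 by rewrite mulr_gt0// invr_gt0.
have r20' : 0 < r' * 2^-1 by rewrite mulr_gt0// invr_gt0.
apply: filterS2 (near_cabs r20) (near_cabs r20') => z [z1 z2] [z1' z2'].
apply: (ps_eval_eq (B := 16 * K) r0' h' z1' z2') => N.
have [_ _ ea] := ps_eval_cvg r0 h z1 z2.
by rewrite ps_partial_conj -rmorphB/= cabs_conj.
Qed.

Lemma evR_ofx_fst (f : fps C) z : evR (ofx f) z = evR (ofx f) (z.1, 0).
Proof.
rewrite /evR /=.
suff h w N : ps_partial (ofx f) ((z.1)%:C)%C w N = \sum_(m < N) f m * ((z.1)%:C)%C ^+ m.
  suff e : ps_partial (ofx f) ((z.1)%:C)%C ((z.2)%:C)%C = ps_partial (ofx f) ((z.1)%:C)%C (0%:C)%C.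
    by rewrite /ps_eval e.
  by apply/funext => N; rewrite !h.
apply: eq_bigr => m _; case: N m => [[]//|N m]; rewrite big_ord_recl/= mulr1 big1 ?addr0// => i _.
by rewrite /ofx /fps_const/= !mul0r.
Qed.

Lemma evR_real a z : (forall m n, complex.Im (a m n) = 0) -> complex.Im (evR a z) = 0.
Proof.
move=> a0; rewrite /evR /ps_eval/=.
suff -> : (fun N => complex.Im (ps_partial a ((z.1)%:C)%C ((z.2)%:C)%C N)) = fun=> 0.
  by rewrite lim_cst.
apply/funext => N; rewrite /ps_partial (raddf_sum (@complex.Im R : Rcomplex R -> R)).
rewrite big1// => i _; rewrite (raddf_sum (@complex.Im R : Rcomplex R -> R)) big1// => j _.
rewrite -!rmorphXn/=; have := a0 i j; case: (a i j) => x y /= ->.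
by rewrite !(mulr0, mul0r, addr0).
Qed.

Lemma gbounded_shiftx (f : fps C) n : gbounded (ofx f) ->
  gbounded (ofx (fun m => f (m + n)%N)).
Proof.
move=> /(gbounded_shift n 0); congr (gbounded _).
by apply/funext => m; apply/funext => k; rewrite /ofx addn0.
Qed.

Lemma gbounded_fpsX : gbounded (ofx (fpsX : fps C)).
Proof. by apply: (@gbounded_support _ _ 2) => -[|[|m]] [|n]. Qed.

Lemma evR_ofxXn n : \forall z \near ((0 : R), (0 : R)),
  evR (ofx (fpsX ^+ n)) z = ((z.1)%:C)%C ^+ n.
Proof.
have -> : ofx (fpsX ^+ n : fps C) = \prod_(0 <= i < n) ofx fpsX.
  by rewrite rmorphXn/= prodr_const_nat subn0.
have := evR_prod (index_iota 0 n) (fun=> gbounded_fpsX).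
by apply: filterS2 evRX => z zX ->; rewrite zX prodr_const_nat subn0.
Qed.

Lemma gbounded_fpsXn n : gbounded (ofx (fpsX ^+ n : fps C)).
Proof.
rewrite rmorphXn/= -[n]subn0 -prodr_const_nat.
by apply: gbounded_prod => i _; exact: gbounded_fpsX.
Qed.

Lemma evR_shiftx (f : fps C) n : gbounded (ofx f) -> (forall m, (m < n)%N -> f m = 0) ->
  \forall z \near ((0 : R), (0 : R)),
    evR (ofx f) z = ((z.1)%:C)%C ^+ n * evR (ofx (fun m => f (m + n)%N)) z.
Proof.
move=> fb f0; have := evRM (gbounded_fpsXn n) (gbounded_shiftx n fb).
rewrite -rmorphM/= -(fps_ordXn f0).
by apply: filterS2 (evR_ofxXn n) => z ->.
Qed.

Lemma evR_ord_upper (f : fps C) n : gbounded (ofx f) -> (forall m, (m < n)%N -> f m = 0) ->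
  exists2 K : R, 0 <= K & \forall z \near ((0 : R), (0 : R)),
    cabs (evR (ofx f) z) <= K * `|z.1| ^+ n.
Proof.
move=> fb f0; have [K K0 hK] := evR_bounded (gbounded_shiftx n fb).
exists K => //; apply: filterS2 hK (evR_shiftx fb f0) => z hz ->.
by rewrite cabsM cabsX cabs_real mulrC ler_wpM2r// exprn_ge0.
Qed.

Lemma evR_ord_lower (f : fps C) n : gbounded (ofx f) -> fps_ord f n ->
  exists2 c : R, 0 < c & \forall z \near ((0 : R), (0 : R)),
    c * `|z.1| ^+ n <= cabs (evR (ofx f) z).
Proof.
move=> fb [f0 fn]; pose g : fps C := fun m => f (m + n)%N.
have gb := gbounded_shiftx n fb; rewrite -/g in gb.
pose h : fps C := g - fps_const (f n).
have hE : ofx h = ofx g - fps_const (fps_const (f n)).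
  by rewrite /h rmorphB/= ofx_const.
have hb : gbounded (ofx h) by rewrite hE; apply: gboundedB => //; exact: gbounded_const.
have h0 m : (m < 1)%N -> h m = 0.
  by case: m => // _; rewrite /h fps_subE /g add0n /fps_const/= subrr.
have [K K0 hK] := evR_ord_upper hb h0.
have cn : 0 < cabs (f n) by rewrite cabs_gt0.
exists (cabs (f n) / 2); first by rewrite divr_gt0.
have d0 : 0 < cabs (f n) / (2 * (K + 1)) by rewrite divr_gt0// mulr_gt0// ltr_wpDl.
have := evRB gb (gbounded_const (f n)); rewrite -hE => E1.
have E2 := evR_const (f n); have E3 := evR_shiftx fb f0; have E4 := near_box d0.
near=> z.
have -> : evR (ofx f) z = ((z.1)%:C)%C ^+ n * evR (ofx g) z by near: z.
rewrite cabsM cabsX cabs_real mulrC ler_wpM2l ?exprn_ge0//.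
have e1 : evR (ofx h) z = evR (ofx g) z - evR (fps_const (fps_const (f n))) z by near: z.
have e2 : evR (fps_const (fps_const (f n))) z = f n by near: z.
have e4 : box (cabs (f n) / (2 * (K + 1))) z by near: z.
have eK : cabs (evR (ofx h) z) <= K * `|z.1| ^+ 1 by near: z.
have : cabs (f n) <= cabs (evR (ofx g) z) + cabs (evR (ofx h) z).
  have -> : f n = evR (ofx g) z - evR (ofx h) z by rewrite e1 e2 opprB addrC subrK.
  exact: cabsB.
have : K * `|z.1| ^+ 1 <= cabs (f n) / 2.
  have [z1 _] := e4; rewrite expr1.
  apply: le_trans (_ : (K + 1) * (cabs (f n) / (2 * (K + 1))) <= _).
    by apply: ler_pM => //; rewrite lerDl.
  rewrite le_eqVlt; apply/orP; left; apply/eqP; field.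
  by rewrite gt_eqF// ltr_wpDl.
by move: eK; lra.
Unshelve. all: by end_near.
Qed.

End NearOrigin.

(** * Local integrability *)

Section Measurability.
Variable R : realType.
Local Notation C := R[i].
Local Notation PS := (fps (fps C)).

Definition cmeas (D : set (R * R)) (f : R * R -> C) :=
  measurable_fun D (fun z => complex.Re (f z)) /\
  measurable_fun D (fun z => complex.Im (f z)).

Lemma cmeasS D D' f : measurable D -> D' `<=` D -> cmeas D f -> cmeas D' f.
Proof. by move=> mD DD [h1 h2]; split; apply: measurable_funS DD _. Qed.

Lemma cmeas_div D f g : cmeas D f -> cmeas D g -> cmeas D (fun z => f z / g z).
Proof.
move=> [f1 f2] [g1 g2].
pose n z := complex.Re (g z) ^+ 2 + complex.Im (g z) ^+ 2.
have mn : measurable_fun D (fun z => (n z)^-1).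
  rewrite [X in measurable_fun _ X](_ : _ = (fun x => x `^ (-1)) \o n); last first.
    by apply/funext => z /=; rewrite powR_inv1// addr_ge0// sqr_ge0.
  apply: measurableT_comp; first exact: measurable_powR.
  by apply: measurable_funD; apply: measurable_funX.
split.
- rewrite [X in measurable_fun _ X](_ : _ = fun z =>
    complex.Re (f z) * (complex.Re (g z) * (n z)^-1) +
    complex.Im (f z) * (complex.Im (g z) * (n z)^-1)); last first.
    apply/funext => z; rewrite /n; case: (f z) => a b; case: (g z) => c d /=.
    by rewrite mulrN opprK.
  by apply: measurable_funD; do 2 (apply: measurable_funM => //).
- rewrite [X in measurable_fun _ X](_ : _ = fun z =>
    complex.Im (f z) * (complex.Re (g z) * (n z)^-1) -
    complex.Re (f z) * (complex.Im (g z) * (n z)^-1)); last first.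
    apply/funext => z; rewrite /n; case: (f z) => a b; case: (g z) => c d /=.
    by rewrite mulrN addrC.
  by apply: measurable_funB; do 2 (apply: measurable_funM => //).
Qed.

Lemma cmeasD D f g : cmeas D f -> cmeas D g -> cmeas D (fun z => f z + g z).
Proof.
move=> [f1 f2] [g1 g2]; split.
- rewrite [X in measurable_fun _ X](_ : _ = fun z =>
    complex.Re (f z) + complex.Re (g z)); first exact: measurable_funD.
  by apply/funext => z; case: (f z) => a b; case: (g z).
- rewrite [X in measurable_fun _ X](_ : _ = fun z =>
    complex.Im (f z) + complex.Im (g z)); first exact: measurable_funD.
  by apply/funext => z; case: (f z) => a b; case: (g z).
Qed.

Lemma measurable_cabs D f : cmeas D f -> measurable_fun D (fun z => cabs (f z)).
Proof.
move=> [f1 f2].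
rewrite [X in measurable_fun _ X](_ : _ = (fun x => x `^ 2^-1) \o
  (fun z => complex.Re (f z) ^+ 2 + complex.Im (f z) ^+ 2)); last first.
  by apply/funext => z /=; rewrite powR12_sqrt// addr_ge0// sqr_ge0.
apply: measurableT_comp; first exact: measurable_powR.
by apply: measurable_funD; apply: measurable_funX.
Qed.

Lemma measurable_cabs_powR D f p : cmeas D f ->
  measurable_fun D (fun z => (cabs (f z) `^ p)%:E).
Proof.
move=> mf; apply/measurable_EFinP.
apply: (@measurableT_comp _ _ _ _ _ _ (fun x => x `^ p) D (fun z => cabs (f z))).
  exact: measurable_powR.
exact: measurable_cabs.
Qed.

Lemma measurable_box r : measurable (box r : set (R * R)).
Proof.
rewrite (_ : box r = `[- r, r] `*` `[- r, r]).
  by apply: measurableX; exact: measurable_itv.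
by apply/seteqP; split => -[x y] /=; rewrite !in_itv/= -!ler_norml.
Qed.

Lemma ReM_real (c : C) (x y : R) m n :
  complex.Re (c * (x%:C)%C ^+ m * (y%:C)%C ^+ n) = complex.Re c * (x ^+ m * y ^+ n).
Proof. by rewrite -!rmorphXn/=; case: c => a b /=; ring. Qed.
Lemma ImM_real (c : C) (x y : R) m n :
  complex.Im (c * (x%:C)%C ^+ m * (y%:C)%C ^+ n) = complex.Im c * (x ^+ m * y ^+ n).
Proof. by rewrite -!rmorphXn/=; case: c => a b /=; ring. Qed.

Lemma evR_measurable (a : PS) : gbounded a ->
  exists2 r : R, 0 < r & forall D, D `<=` box r -> cmeas D (evR a).
Proof.
move=> [r [K [r0 _ h]]].
have r20 : 0 < r * 2^-1 by rewrite mulr_gt0// invr_gt0.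
exists (r * 2^-1) => // D Db.
have mon (F : nat -> nat -> R) N D' : measurable_fun D'
  (fun z : R * R => \sum_(m < N) \sum_(n < N) F m n * (z.1 ^+ m * z.2 ^+ n)).
  apply: (@measurable_sum _ _ _ _ _ _ (fun (m : 'I_N) (z : R * R) =>
    \sum_(n < N) F m n * (z.1 ^+ m * z.2 ^+ n))) => m.
  apply: (@measurable_sum _ _ _ _ _ _ (fun (n : 'I_N) (z : R * R) =>
    F m n * (z.1 ^+ m * z.2 ^+ n))) => n.
  apply: measurable_funM => //; apply: measurable_funM; apply: measurable_funX.
    by apply: measurable_funS (@measurable_fst _ _ _ _).
  by apply: measurable_funS (@measurable_snd _ _ _ _).
have cv z : D z -> [/\ cvgn (fun N => complex.Re (ps_partial a ((z.1)%:C)%C ((z.2)%:C)%C N)) &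
   cvgn (fun N => complex.Im (ps_partial a ((z.1)%:C)%C ((z.2)%:C)%C N))].
  move=> /Db [z1 z2]; have [] := @ps_eval_cvg R r K a ((z.1)%:C)%C ((z.2)%:C)%C r0 h.
  - by rewrite cabs_real.
  - by rewrite cabs_real.
  - by [].
split.
- apply: (@measurable_fun_cvg _ _ R D (fun N (z : R * R) =>
    complex.Re (ps_partial a ((z.1)%:C)%C ((z.2)%:C)%C N))
    (fun z => complex.Re (evR a z))) => [N|z /cv[]//].
  rewrite [X in measurable_fun _ X](_ : _ = fun z => \sum_(m < N) \sum_(n < N)
    complex.Re (a m n) * (z.1 ^+ m * z.2 ^+ n)) => [|]; first exact: (mon (fun m n => complex.Re (a m n))).
  apply/funext => z; rewrite (raddf_sum (@complex.Re R : Rcomplex R -> R)).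
  apply: eq_bigr => m _; rewrite (raddf_sum (@complex.Re R : Rcomplex R -> R)).
  by apply: eq_bigr => n _; exact: ReM_real.
- apply: (@measurable_fun_cvg _ _ R D (fun N (z : R * R) =>
    complex.Im (ps_partial a ((z.1)%:C)%C ((z.2)%:C)%C N))
    (fun z => complex.Im (evR a z))) => [N|z /cv[]//].
  rewrite [X in measurable_fun _ X](_ : _ = fun z => \sum_(m < N) \sum_(n < N)
    complex.Im (a m n) * (z.1 ^+ m * z.2 ^+ n)) => [|]; first exact: (mon (fun m n => complex.Im (a m n))).
  apply/funext => z; rewrite (raddf_sum (@complex.Im R : Rcomplex R -> R)).
  apply: eq_bigr => m _; rewrite (raddf_sum (@complex.Im R : Rcomplex R -> R)).
  by apply: eq_bigr => n _; exact: ImM_real.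
Qed.

Lemma subset_box (r s : R) : r <= s -> box r `<=` box s.
Proof. by move=> rs z [z1 z2]; split; apply: le_trans rs. Qed.

Lemma quot_measurable (a b : PS) : gbounded a -> gbounded b ->
  exists2 r : R, 0 < r & forall D, D `<=` box r -> cmeas D (quot_fun a b).
Proof.
move=> /evR_measurable[r r0 hr] /evR_measurable[s s0 hs].
exists (Num.min r s); first by rewrite lt_min r0.
move=> D Db; apply: (@cmeas_div D (evR a) (evR b)).
  by apply: hr; apply: subset_trans Db _; apply: subset_box; rewrite ge_min lexx.
by apply: hs; apply: subset_trans Db _; apply: subset_box; rewrite ge_min lexx orbT.
Qed.

End Measurability.

Section LocalLp.
Variables (R : realType) (p : R).
Hypothesis p1 : 1 <= p.
Local Notation C := R[i].
Local Notation mu := (@lebesgue_measure R).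
Local Notation mu2 := (mu \x mu)%E.

Lemma p_ge0 : 0 <= p. Proof. exact: le_trans p1. Qed.

Definition Lp_box (r : R) (f : R * R -> C) :=
  (\int[mu2]_(z in box r) (cabs (f z) `^ p)%:E < +oo)%E.

Lemma Lp_boxE f : Lp_loc p f -> exists2 r : R, 0 < r &
  forall s : R, s <= r -> cmeas (box s) f /\ Lp_box s f.
Proof.
move=> [U [nU [mU [m1 [m2 fin]]]]].
have [r r0 rU] := near_boxE nU.
exists r => // s sr.
have sU : box s `<=` U by move=> z /(subset_box sr)/rU.
have mf : cmeas (box s) f by apply: (@cmeasS _ U) => //; split.
split=> //; apply: le_lt_trans fin.
apply: ge0_subset_integral => //; first exact: measurable_box.
  by apply: measurable_cabs_powR; split.
by move=> z _; rewrite lee_fin powR_ge0.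
Qed.

Lemma box_Lp r f : 0 < r -> cmeas (box r) f -> Lp_box r f -> Lp_loc p f.
Proof.
move=> r0 [m1 m2] fin; exists (box r); split; first exact: near_box.
by split; [exact: measurable_box|split; [|split]].
Qed.

Lemma cmeas_eq D (f g : R * R -> C) : {in D, f =1 g} -> cmeas D f -> cmeas D g.
Proof.
move=> fg [m1 m2]; split; [move: m1|move: m2]; apply: eq_measurable_fun => z zD;
  by rewrite fg.
Qed.

Lemma Lp_near_eq f g : (\forall z \near ((0 : R), (0 : R)), f z = g z) ->
  Lp_loc p f -> Lp_loc p g.
Proof.
move=> /near_boxE[s s0 hs] /Lp_boxE[r r0 hr].
have m0 : 0 < Num.min r s by rewrite lt_min r0.
have [mf fin] := hr (Num.min r s) ltac:(by rewrite ge_min lexx).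
have fg : {in box (Num.min r s), f =1 g}.
  move=> z; rewrite inE => zb; apply: hs.
  by apply: subset_box zb; rewrite ge_min lexx orbT.
apply: (box_Lp m0); first exact: cmeas_eq mf.
rewrite /Lp_box; under eq_integral => z zb do rewrite -fg//.
exact: fin.
Qed.

Lemma powR_add_le (x y : R) : 0 <= x -> 0 <= y ->
  (x + y) `^ p <= 2 `^ p * x `^ p + 2 `^ p * y `^ p.
Proof.
move=> x0 y0.
apply: le_trans (_ : (2 * Num.max x y) `^ p <= _).
  apply: ge0_ler_powR; rewrite ?nnegrE ?p_ge0 ?addr_ge0// ?mulr_ge0// ?le_max ?x0//.
  by rewrite mulr_natl mulr2n lerD// le_max lexx ?orbT.
rewrite powRM// ?le_max ?x0//; case: (leP x y) => xy.
  by rewrite lerDr mulr_ge0 ?powR_ge0.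
by rewrite lerDl mulr_ge0 ?powR_ge0.
Qed.

Lemma LpD f g : Lp_loc p f -> Lp_loc p g -> Lp_loc p (fun z => f z + g z).
Proof.
move=> /Lp_boxE[r r0 hr] /Lp_boxE[s s0 hs].
have m0 : 0 < Num.min r s by rewrite lt_min r0.
set m := Num.min r s in m0.
have [mf ff] := hr m ltac:(by rewrite /m ge_min lexx).
have [mg gf] := hs m ltac:(by rewrite /m ge_min lexx orbT).
apply: (box_Lp m0); first exact: cmeasD.
have mb := @measurable_box R m.
apply: le_lt_trans (_ : (\int[mu2]_(z in box m)
    ((2 `^ p)%:E * (cabs (f z) `^ p)%:E + (2 `^ p)%:E * (cabs (g z) `^ p)%:E) < _))%E.
  apply: ge0_le_integral => //.
  - by move=> z _; rewrite lee_fin powR_ge0.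
  - by apply: measurable_cabs_powR; exact: cmeasD.
  - by apply: emeasurable_funD; apply: measurable_funeM; exact: measurable_cabs_powR.
  - move=> z _; rewrite -!EFinM -EFinD lee_fin.
    apply: le_trans (powR_add_le (cabs_ge0 _) (cabs_ge0 _)).
    by apply: ge0_ler_powR; rewrite ?nnegrE ?p_ge0 ?cabs_ge0 ?addr_ge0 ?cabs_ge0// cabsD.
have k0 : (0 <= (2 `^ p)%:E)%E by rewrite lee_fin powR_ge0.
have pos (h : R * R -> C) z : (0 <= (2 `^ p)%:E * (cabs (h z : C) `^ p)%:E)%E.
  by rewrite mule_ge0// lee_fin powR_ge0.
have mp h : cmeas (box m) h -> measurable_fun (box m) (fun z => (cabs (h z : C) `^ p)%:E).
  exact: measurable_cabs_powR.
have mk h : cmeas (box m) h ->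
  measurable_fun (box m) (fun z => (2 `^ p)%:E * (cabs (h z : C) `^ p)%:E)%E.
  by move=> mh; apply: measurable_funeM; exact: mp.
have pp (h : R * R -> C) z : (0 <= (cabs (h z : C) `^ p)%:E)%E by rewrite lee_fin powR_ge0.
rewrite ge0_integralD//; do ?[exact: mk].
rewrite ge0_integralZl//; do ?[exact: mp].
rewrite ge0_integralZl//; do ?[exact: mp].
apply: lte_add_pinfty; (apply: lte_mul_pinfty; [exact: k0|by rewrite fin_numE|]).
  exact: ff.
exact: gf.
Qed.

Lemma LpN f : Lp_loc p f -> Lp_loc p (fun z => - f z).
Proof.
move=> /Lp_boxE[r r0 /(_ r (lexx r)) [[m1 m2] hr]].
apply: (box_Lp r0).
  split.
    rewrite [X in measurable_fun _ X](_ : _ = \- (fun z => complex.Re (f z))).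
      exact: measurable_funN.
    by apply/funext => z; rewrite /=; case: (f z).
  rewrite [X in measurable_fun _ X](_ : _ = \- (fun z => complex.Im (f z))).
    exact: measurable_funN.
  by apply/funext => z; rewrite /=; case: (f z).
by rewrite /Lp_box; under eq_integral => z zb do rewrite cabsN.
Qed.

(** The dominating function takes extended values so that it may be infinite on a null set; the
    bound along [x = 0] is disposed of in this way. *)
Lemma Lp_dominated f (g : R * R -> \bar R) (r : R) : 0 < r ->
  (forall s, s <= r -> cmeas (box s) f) ->
  measurable_fun (box r) g -> (forall z, 0 <= g z)%E ->
  (\int[mu2]_(z in box r) g z < +oo)%E ->
  (\forall z \near ((0 : R), (0 : R)), ((cabs (f z) `^ p)%:E <= g z)%E) ->
  Lp_loc p f.
Proof.
move=> r0 mf mg g0 fin /near_boxE[s s0 hs].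
have m0 : 0 < Num.min r s by rewrite lt_min r0.
set m := Num.min r s in m0.
have mr : m <= r by rewrite ge_min lexx.
have ms : m <= s by rewrite ge_min lexx orbT.
apply: (box_Lp m0 (mf _ mr)).
apply: le_lt_trans fin.
apply: (@le_trans _ _ (\int[mu2]_(z in box m) g z)%E).
  apply: ge0_le_integral; rewrite ?measurable_box//.
  - exact: measurable_box.
  - by move=> z _; rewrite lee_fin powR_ge0.
  - by apply: measurable_cabs_powR; exact: mf.
  - by apply: measurable_funS mg; [exact: measurable_box|exact: subset_box].
  - by move=> z zb; apply: hs; apply: subset_box zb.
apply: ge0_subset_integral => //; try exact: measurable_box.
exact: subset_box.
Qed.

Lemma box_finite (r : R) : 0 <= r -> (mu2 (box r) < +oo)%E.
Proof.
move=> r0; rewrite (_ : box r = `[- r, r] `*` `[- r, r]); last first.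
  by apply/seteqP; split => -[x y] /=; rewrite !in_itv/= -!ler_norml.
rewrite product_measure1E; [|exact: measurable_itv..].
pose I : set R := `[- r, r]%classic.
have h : (mu I < +oo)%E.
  by rewrite /I lebesgue_measure_itv/=; case: ifP => // _; rewrite -EFinB ltry.
apply: lte_mul_pinfty => //; rewrite ge0_fin_numE//.
Qed.

Lemma Lp_bounded f (r K : R) : 0 < r ->
  (forall s, s <= r -> cmeas (box s) f) ->
  (\forall z \near ((0 : R), (0 : R)), cabs (f z) <= K) -> Lp_loc p f.
Proof.
move=> r0 mf hK.
apply: (@Lp_dominated f (cst (K `^ p)%:E) r r0 mf).
- exact: measurable_cst.
- by move=> z; rewrite lee_fin powR_ge0.
- rewrite integral_cst; last exact: measurable_box.
  by rewrite lte_mul_pinfty ?lee_fin ?powR_ge0//; apply: box_finite; exact: ltW.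
- apply: filterS hK => z zK; rewrite lee_fin; apply: ge0_ler_powR => //;
    rewrite ?nnegrE ?p_ge0 ?cabs_ge0//.
  by apply: le_trans zK; exact: cabs_ge0.
Qed.

End LocalLp.

(** * Singular integrals on the plane *)

Section Integrals.
Variable R : realType.
Local Notation mu := (@lebesgue_measure R).
Local Notation mu2 := (mu \x mu)%E.

Lemma mu_itvcc (a b : R) : a <= b -> mu (`[a, b]%classic : set R) = (b - a)%:E.
Proof.
by move=> ab; rewrite lebesgue_measure_itv/= lte_fin; case: ltgtP ab => // -> _; rewrite subrr.
Qed.
Lemma mu_itvoc (a b : R) : a <= b -> mu (`]a, b]%classic : set R) = (b - a)%:E.
Proof.
by move=> ab; rewrite lebesgue_measure_itv/= lte_fin; case: ltgtP ab => // -> _; rewrite subrr.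
Qed.

Lemma powR_halfN (al : R) n : 0 <= al -> (2^-1 ^+ n) `^ (- al) = (2 `^ al) ^+ n :> R.
Proof.
move=> al0; have -> : 2^-1 ^+ n = 2 `^ (- n%:R) :> R.
  by rewrite powRN powR_mulrn// exprVn.
by rewrite -powRrM mulrNN mulrC powRrM powR_mulrn ?powR_ge0.
Qed.

Lemma measurable_dist_powR (D : set R) (c t s : R) :
  measurable_fun D (fun y : R => ((`|y + c| + t) `^ s)%:E).
Proof.
apply/measurable_EFinP.
apply: (@measurableT_comp _ _ _ _ _ _ (fun x : R => x `^ s) D (fun y : R => `|y + c| + t)).
  exact: measurable_powR.
apply: measurable_funD => //.
apply: (@measurableT_comp _ _ _ _ _ _ (fun x : R => `|x|) D (fun y : R => y + c)).
  exact: normr_measurable.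
by apply: measurable_funD.
Qed.

Lemma dyadic_scale (t : R) : 0 < t -> t <= 1 ->
  exists n, 2^-1 ^+ n.+1 < t /\ t <= 2^-1 ^+ n.
Proof.
move=> t0 t1.
have ex : exists n, (2^-1 : R) ^+ n < t.
  have half1 : `|2^-1 : R| < 1 by rewrite gtr0_norm ?invf_lt1// ltr1n.
  apply: contrapT => /forallNP h.
  have : t <= 0 by apply: (@le0_geo2 R t 1) => N; rewrite mul1r leNgt; apply/negP.
  by rewrite leNgt t0.
case: (ex_minnP ex) => -[|n] hn mn; first by rewrite expr0 ltNge t1 in hn.
exists n; split=> //; rewrite leNgt; apply/negP => /mn.
by rewrite ltnn.
Qed.

(* Dyadic layers [|y + c| <= 2 ^ -n] make the bound uniform in [c] and [t]. *)
Lemma integral_sing (al : R) : 0 <= al -> al < 1 ->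
  exists2 K : R, 0 <= K & forall (c t : R) (D : set R), 0 <= t -> measurable D ->
    D `<=` `[(-1)%R, 1%R] -> (\int[mu]_(y in D) ((`|y + c| + t) `^ (- al))%:E <= K%:E)%E.
Proof.
move=> al0 al1; pose w : R := 2 `^ al.
have w0 : 0 < w by rewrite powR_gt0.
have w1 : 1 <= w by rewrite -[leLHS](powRr0 2) ler_powR// ler1n.
have w2 : w / 2 < 1.
  rewrite ltr_pdivrMr// mul1r.
  have e : w * 2 `^ (1 - al) = 2.
    by rewrite /w -powRD ?pnatr_eq0 ?implybT// addrC subrK powRr1.
  have gt1 : 1 < 2 `^ (1 - al) :> R.
    rewrite lt_def powR_eq1 -[X in _ && (X <= _)](powRr0 2) ler_powR ?ler1n ?subr_ge0 ?(ltW al1)//.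
    have -> : (2 == 1 :> R) = false by rewrite pnatr_eq1.
    by rewrite andbT !negb_or subr_eq0/= -leNgt ler0n/= gt_eqF.
  by rewrite -[ltRHS]e ltr_pMr.
(* Layer [n] has length [2 * 2^-n] and carries the value [w^(n+1)], so [B] is the sum of the series
   [2 w (w/2)^n]. The other 2 in the constant is the length of [[-1, 1]], for the points where the
   base is at least 1. *)
pose B := 2 * w / (1 - w / 2).
have B0 : 0 <= B by rewrite divr_ge0 ?mulr_ge0 ?subr_ge0 ?(ltW w0)// ltW.
exists (2 + B); first by rewrite addr_ge0.
move=> c t D t_ge0 mD D1.
pose A n : set R := `[- c - 2^-1 ^+ n, - c + 2^-1 ^+ n]%classic.
have mA n : measurable (A n) by exact: measurable_itv.
pose f n (y : R) : \bar R := ((w ^+ n.+1)%:E * (\1_(A n) y)%:E)%E.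
have f0 n y : (0 <= f n y)%E.
  by rewrite /f mule_ge0// lee_fin ?exprn_ge0 ?(ltW w0)//.
have mf n : measurable_fun D (f n).
  apply: measurable_funeM; apply/measurable_EFinP.
  by apply: measurable_indic.
have AE n y : A n y = (`|y + c| <= 2^-1 ^+ n) :> Prop.
  rewrite /A /= in_itv/= ler_norml; apply/propext; split => /andP[h1 h2]; apply/andP; split; lra.
have bound (y : R) : (((`|y + c| + t) `^ (- al))%:E <= 1%:E + \sum_(0 <= n <oo) f n y)%E.
  have s0 : (0 <= \sum_(0 <= n <oo) f n y)%E by apply: nneseries_ge0.
  (* At base 0 the negative power is 0 by convention, or 1 when [al = 0]; the summand 1 covers
     both. *)
  have [->|t0] := eqVneq (`|y + c| + t) 0.
    apply: le_trans (leeDl _ s0); rewrite lee_fin.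
    have [->|aln0] := eqVneq al 0; first by rewrite oppr0 powRr0.
    by rewrite powR0 ?oppr_eq0.
  have tp : 0 < `|y + c| + t by rewrite lt_def t0 addr_ge0.
  have [t1|t1] := leP 1 (`|y + c| + t).
    apply: le_trans (leeDl _ s0); rewrite lee_fin powRN invf_le1 ?powR_gt0//.
    apply: le_trans (_ : 1 `^ al <= _); first by rewrite powR1.
    by rewrite ge0_ler_powR ?nnegrE// ltW.
  have [n [n1 n2]] := dyadic_scale tp (ltW t1).
  apply: le_trans (_ : f n y <= _)%E.
    rewrite /f indicE mem_set ?AE; last by apply: le_trans n2; rewrite lerDl.
    rewrite mule1 lee_fin.
    have h0 : 0 < 2^-1 ^+ n.+1 :> R by rewrite exprn_gt0// invr_gt0.
    rewrite -powR_halfN// !powRN lef_pV2 ?posrE ?powR_gt0//.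
    by rewrite ge0_ler_powR ?nnegrE ?halfX_ge0// ltW.
  apply: le_trans (_ : \sum_(0 <= k <oo) f k y <= _)%E; last by rewrite leeDr// lee_fin.
  apply: le_trans (nneseries_lim_ge n.+1 (fun k _ _ => f0 k y)).
  by rewrite big_nat_recr//= leeDr// sume_ge0.
apply: le_trans (_ : \int[mu]_(y in D) (1%:E + \sum_(0 <= n <oo) f n y) <= _)%E.
  apply: ge0_le_integral => //.
  - by move=> y _; rewrite lee_fin powR_ge0.
  - exact: measurable_dist_powR.
  - apply: emeasurable_funD => //.
    rewrite (_ : (fun y => _) = (fun y => \sum_(0 <= n <oo | n \in predT) f n y)%E)//.
    by apply: ge0_emeasurable_sum => *; [exact: f0|exact: mf].
rewrite ge0_integralD//; last 2 first.
- by move=> y _; apply: nneseries_ge0.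
- rewrite (_ : (fun y => _) = (fun y => \sum_(0 <= n <oo | n \in predT) f n y)%E)//.
  by apply: ge0_emeasurable_sum => *; [exact: f0|exact: mf].
rewrite EFinD; apply: leeD.
  apply: (@le_trans _ _ (mu D)).
    have := integral_cst mu mD 1%:E; rewrite mul1e => e.
    by rewrite le_eqVlt; apply/orP; left; apply/eqP; exact: e.
  apply: le_trans (_ : mu (`[(-1)%R, 1%R]%classic : set R) <= _)%E.
    by apply: le_measure; rewrite ?inE//; exact: measurable_itv.
  by rewrite mu_itvcc ?lee_fin//; lra.
rewrite integral_nneseries//.
apply: lime_le; first by apply: is_cvg_nneseries => n _ _; apply: integral_ge0.
apply: nearW => N.
apply: le_trans (_ : \sum_(0 <= n < N) (geometric (2 * w) (w / 2) n)%:E <= _)%E.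
  apply: lee_sum => n _.
  have mi : measurable_fun D (fun y => (\1_(A n) y)%:E : \bar R).
    by apply/measurable_EFinP; apply: measurable_indic.
  have wn : (0 <= (w ^+ n.+1)%:E)%E by rewrite lee_fin exprn_ge0// ltW.
  have ez : (\int[mu]_(y in D) f n y = (w ^+ n.+1)%:E * \int[mu]_(y in D) (\1_(A n) y)%:E)%E.
    by apply: ge0_integralZl => //; exact: mi.
  have ei : (\int[mu]_(y in D) (\1_(A n) y)%:E = mu (A n `&` D))%E.
    by apply: integral_indic; [exact: mD|exact: mA].
  rewrite ez ei.
  apply: le_trans (_ : (w ^+ n.+1)%:E * (2 * 2^-1 ^+ n)%:E <= _)%E.
    apply: lee_wpmul2l; first by rewrite lee_fin exprn_ge0// ltW.
    apply: le_trans (_ : mu (A n) <= _)%E.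
      by apply: le_measure; rewrite ?inE; [apply: measurableI; [exact: mA|exact: mD]|exact: mA|exact: subIsetl].
    rewrite mu_itvcc ?lee_fin; first by lra.
    by have := halfX_ge0 R n; lra.
  by rewrite -EFinM lee_fin /geometric/= exprMn exprS; lra.
rewrite sumEFin lee_fin.
apply: geometric_le_lim; rewrite ?mulr_ge0 ?(ltW w0)//; first by rewrite divr_gt0.
by rewrite ger0_norm// divr_ge0// ltW.
Qed.

Lemma fubini_box (r : R) (g : R * R -> \bar R) : measurable_fun (box r) g ->
  (forall z, 0 <= g z)%E ->
  measurable_fun (`[- r, r] : set R) (fun x => \int[mu]_(y in `[(- r)%R, r]) g (x, y))%E /\
  (\int[mu2]_(z in box r) g z =
   \int[mu]_(x in `[(- r)%R, r]) \int[mu]_(y in `[(- r)%R, r]) g (x, y))%E.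
Proof.
move=> mg g0; have mb := @measurable_box R r.
have mI : measurable (`[- r, r]%classic : set R) by exact: measurable_itv.
have mg' := (measurable_restrictT g mb).1 mg.
have g0' z : (0 <= (g \_ (box r)) z)%E by rewrite patchE; case: ifP.
pose F (x : R) : \bar R := (\int[mu]_(y in `[(- r)%R, r]) g (x, y))%E.
have E x : fubini_F mu (g \_ (box r)) x = (F \_ (`[- r, r]%classic : set R)) x.
  rewrite /fubini_F patchE; case: ifPn => xI.
    rewrite /F [RHS]integral_mkcond; apply: eq_integral => y _; rewrite !patchE.
    congr (if _ then _ else _); apply/idP/idP; rewrite !inE /box/= !in_itv/= -!ler_norml.
      by case.
    by move=> yr; split=> //; move: xI; rewrite inE/= in_itv/= -ler_norml.
  apply: integral0_eq => y _; rewrite patchE ifN//.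
  apply: contra xI; rewrite !inE /box/= in_itv/= -ler_norml.
  by case.
have mF := measurable_fun_fubini_tonelli_F (m2 := mu) (g \_ (box r)) mg' g0'.
have E' := funext E; rewrite E' in mF.
split; first by apply/measurable_restrictT.
rewrite integral_mkcond fubini_tonelli1// [RHS]integral_mkcond.
by apply: eq_integral => x _; exact: E.
Qed.

(** Integrate in [y] first. The bound of [integral_sing] is uniform in the translation [q x] and the
    offset [v x], so these disappear and an integral of [|x|^(-al)] remains. *)
Lemma integral_sing2 (al be r : R) (q v : R -> R) : 0 <= al -> al < 1 -> 0 <= be -> be < 1 ->
  r <= 1 -> measurable_fun (box r) (fun z : R * R => q z.1) ->
  (forall x, 0 <= v x) -> measurable_fun (box r) (fun z : R * R => v z.1) ->
  let g := fun z : R * R => (`|z.1| `^ (- al) * (`|z.2 + q z.1| + v z.1) `^ (- be))%:E in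
  measurable_fun (box r) g /\ (\int[mu2]_(z in box r) g z < +oo)%E.
Proof.
move=> al0 al1 be0 be1 r1 mq v0 mv g.
have mpw (f : R * R -> R) s : measurable_fun (box r) f ->
  measurable_fun (box r) (fun z => f z `^ s).
  move=> mf.
  apply: (@measurableT_comp _ _ _ _ _ _ (fun x => x `^ s) (box r) f).
    exact: measurable_powR.
  exact: mf.
have mnorm (f : R * R -> R) : measurable_fun (box r) f ->
  measurable_fun (box r) (fun z => `|f z|).
  by move=> mf; apply: (@measurableT_comp _ _ _ _ _ _ (fun x : R => `|x|) (box r) f).
have mg : measurable_fun (box r) g.
  apply/measurable_EFinP; apply: measurable_funM; apply: mpw.
    by apply: mnorm; apply: measurable_funS (@measurable_fst _ _ _ _).
  apply: measurable_funD => //; apply: mnorm; apply: measurable_funD => //.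
  by apply: measurable_funS (@measurable_snd _ _ _ _).
have g0 z : (0 <= g z)%E by rewrite lee_fin mulr_ge0// powR_ge0.
split=> //.
have [mF ->] := fubini_box mg g0.
have mI : measurable (`[- r, r]%classic : set R) by exact: measurable_itv.
have I1 : `[- r, r]%classic `<=` (`[(-1)%R, 1%R]%classic : set R).
  by move=> x /=; rewrite !in_itv/= => /andP[h1 h2]; apply/andP; split; lra.
have [K K0 hK] := integral_sing be0 be1.
have [K' K'0 hK'] := integral_sing al0 al1.
have mx : measurable_fun (`[- r, r]%classic : set R) (fun x => ((`|x + 0| + 0) `^ (- al))%:E).
  exact: measurable_dist_powR.
apply: le_lt_trans (_ : \int[mu]_(x in `[(- r)%R, r]) (K%:E * ((`|x + 0| + 0) `^ (- al))%:E) < _)%E.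
  apply: ge0_le_integral => //.
  - by move=> x _; apply: integral_ge0.
  - exact: measurable_funeM.
  - move=> x _; rewrite /g/=; under eq_integral do rewrite EFinM.
    rewrite ge0_integralZl//; do ?[exact: measurable_dist_powR
      | by move=> ? _; rewrite lee_fin powR_ge0 | by rewrite lee_fin powR_ge0].
    rewrite !addr0 muleC; apply: lee_wpmul2r; first by rewrite lee_fin powR_ge0.
    exact: hK.
rewrite ge0_integralZl//; do ?[by move=> ? _; rewrite lee_fin powR_ge0].
apply: le_lt_trans (_ : K%:E * K'%:E < _)%E; last by rewrite -EFinM ltry.
by apply: lee_wpmul2l; rewrite ?lee_fin//; by apply: hK'.
Qed.

Lemma sum_pow2_le (s : R) N : 0 <= s -> \sum_(n < N) (if 2 ^+ n <= s then 2 ^+ n else 0) <= 2 * s.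
Proof.
move=> s0; have tot M : \sum_(n < M) (2 : R) ^+ n <= 2 ^+ M.
  elim: M => [|M IH]; first by rewrite big_ord0.
  by rewrite big_ord_recr/= exprS; lra.
elim: N => [|N IH]; first by rewrite big_ord0 mulr_ge0.
rewrite big_ord_recr/=; case: ifP => [h|_]; last by rewrite addr0.
have : \sum_(n < N) (if 2 ^+ n <= s then 2 ^+ n else 0) <= \sum_(n < N) (2 : R) ^+ n.
  by apply: ler_sum => n _; case: ifP => // _; rewrite exprn_ge0.
by have := tot N; lra.
Qed.

(** The function [c / x] dominates the sums of the step functions [c 2^n / (2 d)] on []0, d 2^-n]]:
    at [x] only the [n] with [2^n <= d / x] contribute, and these powers add up to at most
    [2 d / x]. Each step has integral [c / 2], so the integral exceeds every multiple of [c / 2]. *)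
Lemma integral_box_diverges (r c d : R) (g : R * R -> \bar R) : measurable_fun (box r) g ->
  (forall z, 0 <= g z)%E -> 0 < c -> 0 < d -> d <= r ->
  (forall x : R, 0 < x -> x <= d -> ((c / x)%:E <= \int[mu]_(y in `[(- r)%R, r]) g (x, y))%E) ->
  (\int[mu2]_(z in box r) g z = +oo)%E.
Proof.
move=> mg g0 c0 d0 dr h; have [mF ->] := fubini_box mg g0.
pose F (x : R) : \bar R := (\int[mu]_(y in `[(- r)%R, r]) g (x, y))%E.
have {}mF : measurable_fun (`[- r, r]%classic : set R) F := mF.
rewrite -[LHS]/(\int[mu]_(x in `[(- r)%R, r]) F x)%E.
have mI : measurable (`[- r, r]%classic : set R) by exact: measurable_itv.
pose A n : set R := `]0, d * 2^-1 ^+ n]%classic.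
have mA n : measurable (A n) by exact: measurable_itv.
pose f (n : nat) (x : R) : \bar R := ((c * 2 ^+ n / (2 * d))%:E * (\1_(A n) x)%:E)%E.
have k0 n : 0 <= c * 2 ^+ n / (2 * d).
  by rewrite divr_ge0 ?mulr_ge0 ?exprn_ge0 ?(ltW c0) ?(ltW d0).
have f0 n x : (0 <= f n x)%E by rewrite /f mule_ge0// lee_fin.
have F0 x : (0 <= F x)%E by apply: integral_ge0.
have mi n : measurable_fun (`[- r, r]%classic : set R) (fun x => (\1_(A n) x)%:E : \bar R).
  by apply/measurable_EFinP; apply: measurable_indic.
have mf n : measurable_fun (`[- r, r]%classic : set R) (f n) by apply: measurable_funeM.
have AI n : A n `<=` `[- r, r]%classic.
  move=> x; rewrite /A/= !in_itv/= => /andP[x0 xd].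
  have : d * 2^-1 ^+ n <= d by rewrite ler_piMr ?(ltW d0)// exprn_ile1// ?invf_le1 ?ler1n.
  move=> dd; have xr := le_trans xd (le_trans dd dr).
  by rewrite xr andbT (le_trans _ (ltW x0))// oppr_le0 (le_trans (ltW d0)).
have low N : ((N%:R * (c / 2))%:E <= \int[mu]_(x in `[(- r)%R, r]) F x)%E.
  apply: le_trans (_ : \int[mu]_(x in `[(- r)%R, r]) (\sum_(n <- index_iota 0 N) f n x)%R <= _)%E.
    rewrite ge0_integral_sum//.
    apply: le_trans (_ : \sum_(n <- index_iota 0 N) (c / 2)%:E <= _)%E.
      by rewrite sumEFin big_const_nat iter_addr_0 subn0 mulr_natl.
    apply: lee_sum => n _.
    have ei : (\int[mu]_(x in `[(- r)%R, r]) (\1_(A n) x)%:E = (d * 2^-1 ^+ n)%:E)%E.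
      transitivity (mu (A n `&` `[- r, r]%classic)); first by apply: integral_indic; [exact: mI|exact: mA].
      transitivity (mu (A n)); first by congr (mu _); apply: setIidl; exact: AI.
      rewrite mu_itvoc ?subr0// mulr_ge0 ?halfX_ge0//; exact: ltW.
    have ez : (\int[mu]_(x in `[(- r)%R, r]) f n x =
      (c * 2 ^+ n / (2 * d))%:E * \int[mu]_(x in `[(- r)%R, r]) (\1_(A n) x)%:E)%E.
      by apply: ge0_integralZl => //; [exact: mi|rewrite lee_fin].
    rewrite ez ei -EFinM lee_fin le_eqVlt; apply/orP; left; apply/eqP.
    have e : (2 : R) ^+ n * 2^-1 ^+ n = 1 by rewrite -exprMn divff ?expr1n// pnatr_eq0.
    rewrite [RHS](_ : _ = c / 2 * (2 ^+ n * 2^-1 ^+ n)); last by field; lra.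
    by rewrite e mulr1.
  apply: ge0_le_integral => //.
  - by move=> x _; apply: sume_ge0.
  - exact: emeasurable_sum.
  - move=> x _.
    have [/andP[x0 xd]|xn] := boolP ((0 < x) && (x <= d)); last first.
      rewrite big1 ?F0// => n _; rewrite /f indicE memNset ?mule0// => /=.
      rewrite /A/= in_itv/= => /andP[x0 xd]; case/negP: xn; rewrite x0 (le_trans xd)//.
      by rewrite ler_piMr ?(ltW d0)// exprn_ile1// ?invf_le1 ?ler1n.
    apply: le_trans (h x x0 xd).
    rewrite (eq_bigr (fun n => (c / (2 * d) * (if 2 ^+ n <= d / x then 2 ^+ n else 0))%:E)).
      rewrite sumEFin lee_fin -mulr_sumr big_mkord.
      apply: le_trans (ler_wpM2l _ (sum_pow2_le N _)) _.
      - by rewrite divr_ge0 ?mulr_ge0 ?(ltW c0) ?(ltW d0).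
      - by rewrite divr_ge0 ?ltW.
      - by rewrite le_eqVlt; apply/orP; left; apply/eqP; field; rewrite !gt_eqF.
    move=> n _; rewrite /f indicE.
    have -> : (x \in A n) = (2 ^+ n <= d / x).
      rewrite ler_pdivlMr//; apply/idP/idP.
        rewrite inE /A/= in_itv/= => /andP[_]; rewrite exprVn ler_pdivlMr ?exprn_gt0//.
        by rewrite mulrC.
      move=> hx; rewrite inE /A/= in_itv/= x0 /= exprVn ler_pdivlMr ?exprn_gt0//.
      by rewrite mulrC.
    case: ifP => _; rewrite -EFinM; congr EFin; first by rewrite mulr1 mulrAC.
    by rewrite !mulr0.
apply/eqP; rewrite -leye_eq leNgt; apply/negP => fin.
have Ifin : (\int[mu]_(x in `[(- r)%R, r]) F x)%E \is a fin_num.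
  by rewrite ge0_fin_numE// integral_ge0.
have K N : N%:R * (c / 2) <= fine (\int[mu]_(x in `[(- r)%R, r]) F x)%E.
  by rewrite -lee_fin fineK.
have c2 : 0 < c / 2 by rewrite divr_gt0.
set S := fine _ in K.
have S0 : 0 <= S by have := K 0%N; rewrite mul0r.
have := K (Num.truncn (S / (c / 2))).+1.
rewrite -ler_pdivlMr// leNgt.
by rewrite truncnS_gt.
Qed.

Lemma integral_ge_itv (r l b v : R) (g : R -> \bar R) :
  measurable_fun (`[- r, r]%classic : set R) g -> (forall y, 0 <= g y)%E ->
  0 <= l -> - r <= b -> b + l <= r -> 0 <= v ->
  (forall y, b <= y -> y <= b + l -> (v%:E <= g y)%E) ->
  ((v * l)%:E <= \int[mu]_(y in `[(- r)%R, r]) g y)%E.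
Proof.
move=> mg g0 l0 rb bl v0 h.
have mI : measurable (`[- r, r]%classic : set R) by exact: measurable_itv.
have mJ : measurable (`[b, b + l]%classic : set R) by exact: measurable_itv.
have JI : `[b, b + l]%classic `<=` (`[- r, r]%classic : set R).
  by move=> y /=; rewrite !in_itv/= => /andP[h1 h2]; apply/andP; split; lra.
apply: le_trans (_ : \int[mu]_(y in `[b, (b + l)%R]) g y <= _)%E; last first.
  exact: ge0_subset_integral.
apply: le_trans (_ : \int[mu]_(y in `[b, (b + l)%R]) (cst v%:E y) <= _)%E.
  have e : mu (`[b, b + l]%classic : set R) = l%:E.
    by rewrite mu_itvcc ?lerDl//; congr EFin; lra.
  rewrite integral_cst// EFinM; apply: lee_wpmul2l => //.
  by rewrite le_eqVlt; apply/orP; left; apply/eqP; exact: esym e.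
apply: ge0_le_integral => //.
- exact: measurable_funS JI mg.
- by move=> y /=; rewrite in_itv/= => /andP[]; exact: h.
Qed.

End Integrals.

(** * The branches of P and of A + tB *)

Section Branches.
Variable R : realType.
Local Notation C := R[i].
Local Notation PS := (fps (fps C)).
Variables (M : nat) (L : 'I_M -> nat) (q : 'I_M -> {poly R}) (psi : 'I_M -> nat -> R).

(* In the notation of the statement, y + [branch_series j] is y - a_j(x;t),
   y + [Pseries j] is the j-th factor of P, [contact j k] is O_jk, and
   [contact_full] extends it to the diagonal by 2 L_k. *)
Definition qseries (j : 'I_M) : fps C := fun m => (((q j)`_m)%:C)%C.
Definition branch_series (j : 'I_M) : fps C :=
  fun m => (((q j)`_m + xshift (2 * L j) (psi j) m)%:C)%C.
Definition Pseries (j : 'I_M) : fps C :=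
  fun m => (((q j)`_m)%:C)%C + (if m == (2 * L j)%N then 'i%C else 0).
Definition Pbar_series (j : 'I_M) : fps C := fun m => ((Pseries j m)^*)%C.
Definition contact (j k : 'I_M) := Oidx (L j) (L k) (q j) (q k).
Definition contact_full (j k : 'I_M) := if j == k then (2 * L k)%N else contact j k.

Hypothesis L0 : forall j, (0 < L j)%N.
Hypothesis q0 : forall j, (q j)`_0 = 0.
Hypothesis psic : forall j, rseries_convergent (psi j).
Hypothesis proper : forall i j : 'I_M, i != j ->
  ord_is (fun m => (q j - q i)`_m + xshift (2 * L j) (psi j) m
                                  - xshift (2 * L i) (psi i) m) (contact i j).

Lemma O_leqL i j : (contact i j <= 2 * L i)%N /\ (contact i j <= 2 * L j)%N.
Proof.
rewrite /contact /Oidx; case: ifP => _; rewrite !geq_min !leqnn ?orbT//.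
Qed.

Lemma ord_polyP (p : {poly R}) : p != 0 ->
  (forall m, (m < ord_poly p)%N -> p`_m = 0) /\ p`_(ord_poly p) != 0.
Proof.
move=> p0; split=> [m /(before_find 0)/negbFE/eqP//|].
have := @nth_find _ 0 (fun c : R => c != 0) p; apply; apply/hasP; exists (lead_coef p); last by rewrite lead_coef_eq0.
by rewrite /lead_coef mem_nth// prednK ?size_poly_gt0.
Qed.

(** The disjunction records which of the three orders attains the minimum; when [q j = q i] only the
    last two can. *)
Lemma O_polyP i j :
  (forall m, (m < contact i j)%N -> (q j - q i)`_m = 0) /\
  [\/ (q j - q i)`_(contact i j) != 0, contact i j = (2 * L i)%N | contact i j = (2 * L j)%N].
Proof.
rewrite /contact /Oidx; have [->|/ord_polyP[p0 p1]] := eqVneq (q j - q i) 0.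
  split=> [m _|]; first by rewrite coef0.
  by rewrite /minn; case: ifP => _; [constructor 3|constructor 2].
split=> [m|].
  by rewrite leq_min => /andP[/p0].
rewrite /=; have [h|h] := leqP (ord_poly (q j - q i)) (minn (2 * L j) (2 * L i)).
  by constructor 1.
rewrite /minn.
by case: ifP => _; [constructor 3|constructor 2].
Qed.

Lemma complex_neq0_Re (z : C) : complex.Re z != 0 -> z != 0.
Proof. by apply: contra => /eqP ->. Qed.
Lemma complex_neq0_Im (z : C) : complex.Im z != 0 -> z != 0.
Proof. by apply: contra => /eqP ->. Qed.

Lemma hs_neq2L j m : m != (2 * L j)%N -> Pseries j m = (((q j)`_m)%:C)%C.
Proof. by rewrite /Pseries => /negbTE ->; rewrite addr0. Qed.

Lemma ord_gg i j : i != j -> fps_ord (branch_series j - branch_series i) (contact i j).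
Proof.
move=> /proper [D0 DO]; split=> [m mO|]; rewrite fps_subE /branch_series -rmorphB/=.
  have := D0 m mO; rewrite coefB => e; rewrite (_ : _ - _ = 0) ?rmorph0//.
  by etransitivity; [|exact: e]; ring.
apply: complex_neq0_Re => /=; move: DO; rewrite coefB; congr (_ != _).
by ring.
Qed.

(** Below degree [2 L_j] the two series of index [j] agree, so the order is that of a difference of
    branches. If the contact reaches [2 L_j], or [j = k], the coefficient [i] of [x^(2 L_j)] cannot
    cancel against a real branch. *)
Lemma ord_hg j k : fps_ord (Pseries j - branch_series k) (contact_full j k).
Proof.
rewrite /contact_full; have [->|jk] := eqVneq j k.
  split=> [m mL|].
    rewrite fps_subE hs_neq2L ?ltn_eqF// /branch_series /xshift leqNgt mL/= addr0 subrr//.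
  apply: complex_neq0_Im; rewrite fps_subE /Pseries /branch_series eqxx /= subr0 add0r.
  exact: oner_neq0.
have [D0 DO] := ord_gg jk; have [OL _] := O_leqL j k.
have e m : (m < 2 * L j)%N -> Pseries j m - branch_series k m = - (branch_series k m - branch_series j m).
  move=> mL; rewrite hs_neq2L ?ltn_eqF// opprB; congr (_ - _).
  by rewrite /branch_series /xshift leqNgt mL/= addr0.
split=> [m mO|].
  rewrite fps_subE e ?(leq_trans mO)//.
  by have := D0 m mO; rewrite fps_subE => ->; rewrite oppr0.
move: OL; rewrite leq_eqVlt => /orP[/eqP OE|OL]; last first.
  by rewrite fps_subE e// oppr_eq0.
apply: complex_neq0_Im; rewrite fps_subE /Pseries /branch_series OE eqxx /= subr0 add0r.
exact: oner_neq0.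
Qed.

(** The real part is [q_j - q_i] and the imaginary part is [x^(2 L_j) + x^(2 L_i)], which never
    cancels; the order is therefore the minimum of the three orders on the nose. *)
Lemma ord_hhb i j : i != j -> fps_ord (Pseries j - Pbar_series i) (contact i j).
Proof.
move=> ij; have [p0 p1] := O_polyP i j; have [OLi OLj] := O_leqL i j.
have Re m : complex.Re ((Pseries j - Pbar_series i) m) = (q j - q i)`_m.
  rewrite fps_subE /Pbar_series /Pseries coefB.
  by case: (m == _); case: (m == _); rewrite /= ?addr0.
have Im m : complex.Im ((Pseries j - Pbar_series i) m) =
  (m == (2 * L j)%N)%:R + (m == (2 * L i)%N)%:R.
  rewrite fps_subE /Pbar_series /Pseries.
  by case: (m == _); case: (m == _); rewrite /=; ring.
split=> [m mO|].
  have mj : (m == (2 * L j)%N) = false by rewrite ltn_eqF// (leq_trans mO).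
  have mi : (m == (2 * L i)%N) = false by rewrite ltn_eqF// (leq_trans mO).
  have := Re m; have := Im m; rewrite p0// mj mi addr0.
  by case: (_ m) => x y /= -> ->.
case: p1 => h.
- by apply: complex_neq0_Re; rewrite Re.
- apply: complex_neq0_Im; rewrite Im h eqxx gt_eqF// ltr_wpDl// ler0n.
- apply: complex_neq0_Im; rewrite Im h eqxx gt_eqF// ltr_wpDr// ler0n.
Qed.

Lemma gs0 j : branch_series j 0%N = 0.
Proof. by rewrite /branch_series q0 /xshift leqn0 muln_eq0/= eqn0Ngt L0 /= addr0. Qed.

Lemma gbounded_qs j : gbounded (ofx (qseries j)).
Proof.
have -> : qseries j = polyf (map_poly (real_complex R) (q j)).
  by apply/funext => m; rewrite /polyf coef_map.
exact: gbounded_polyf.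
Qed.

Lemma hsE j : Pseries j = qseries j + fps_const 'i%C * fpsX ^+ (2 * L j).
Proof.
apply/funext => m; rewrite fps_addE fps_constME fpsXnE /Pseries; congr (_ + _).
by case: eqP => _; rewrite ?mulr1 ?mulr0.
Qed.

Lemma gbounded_hs j : gbounded (ofx (Pseries j)).
Proof.
rewrite hsE rmorphD rmorphM/=; apply: gboundedD; first exact: gbounded_qs.
apply: gboundedM; last exact: gbounded_fpsXn.
by rewrite ofx_const; exact: gbounded_const.
Qed.

Lemma gbounded_gs j : gbounded (ofx (branch_series j)).
Proof.
have -> : branch_series j = qseries j + fpsX ^+ (2 * L j) * (fun m => ((psi j m)%:C)%C).
  apply/funext => m; rewrite fps_addE fpsXnME /branch_series /xshift rmorphD/=; congr (_ + _).
  by case: leqP.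
rewrite rmorphD rmorphM/=; apply: gboundedD; first exact: gbounded_qs.
apply: gboundedM; first exact: gbounded_fpsXn.
by have /convergent_gbounded := psic j.
Qed.

Definition Pfactor j : PS := psY R + ofx (Pseries j).
Definition branch_factor j : PS := psY R + ofx (branch_series j).

Lemma gbounded_hfac j : gbounded (Pfactor j).
Proof. by apply: gboundedD; [exact: gbounded_psY|exact: gbounded_hs]. Qed.
Lemma gbounded_gfac j : gbounded (branch_factor j).
Proof. by apply: gboundedD; [exact: gbounded_psY|exact: gbounded_gs]. Qed.

Definition Pprod : PS := \prod_(j < M) Pfactor j.
Definition branch_prod : PS := \prod_(j < M) branch_factor j.
Definition tail_prod (k : 'I_M) : PS := \prod_(j < M | (k < j)%N) branch_factor j.

Lemma gbounded_PP : gbounded Pprod.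
Proof. by apply: gbounded_prod => j _; exact: gbounded_hfac. Qed.
Lemma gbounded_FF k : gbounded (tail_prod k).
Proof. by apply: gbounded_prod => j _; exact: gbounded_gfac. Qed.

Lemma fps_ord_prod I (r : seq I) (F : I -> fps C) (n : I -> nat) :
  (forall i, fps_ord (F i) (n i)) ->
  fps_ord (\prod_(i <- r) F i) (\sum_(i <- r) n i).
Proof.
move=> h; elim: r => [|i r IH]; first by rewrite !big_nil; exact: fps_ord1.
by rewrite !big_cons; exact: fps_ordM.
Qed.

(** Each factor of P is [Pseries j - branch_series k] plus [branch_factor k]. Expanding the product
    leaves the product of the differences, which is P on branch [k], of order the sum of the full
    contacts. *)
Lemma PP_mod_gfac k : exists p P', Pprod = ofx p + (psY R - ofx (- branch_series k)) * P' /\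
  [/\ fps_ord p (\sum_(j < M) contact_full j k), gbounded (ofx p) & gbounded P'].
Proof.
have db j : gbounded (ofx (Pseries j - branch_series k)).
  by rewrite rmorphB/=; apply: gboundedB; [exact: gbounded_hs|exact: gbounded_gs].
have [P' [Pb PE]] : exists P', gbounded P' /\
  Pprod = ofx (\prod_(j < M) (Pseries j - branch_series k)) + branch_factor k * P'.
  rewrite /Pprod; elim: (index_enum _) => [|j r [P' [Pb IH]]].
    by exists 0; split; [exact: gbounded0|rewrite !big_nil rmorph1 mulr0 addr0].
  exists (ofx (\prod_(j <- r) (Pseries j - branch_series k)) + Pfactor j * P'); split.
    apply: gboundedD; last by apply: gboundedM => //; exact: gbounded_hfac.
    by rewrite rmorph_prod/=; apply: gbounded_prod => i _; exact: db.
  rewrite !big_cons IH rmorphM rmorphB/= /Pfactor /branch_factor.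
  by ring.
exists (\prod_(j < M) (Pseries j - branch_series k)), P'; split.
  by rewrite PE rmorphN opprK.
split=> //; first by apply: fps_ord_prod => j; exact: ord_hg.
by rewrite rmorph_prod/=; apply: gbounded_prod => i _; exact: db.
Qed.

(** The division argument moves the ends of the index range, so the families are extended from
    ['I_M] to [nat]; the sign turns [y + branch] into [y - f]. *)
Definition fnat (n : nat) : fps C := if insub n is Some k then - branch_series k else 0.
Definition Nnat (n : nat) : nat :=
  if insub n is Some k then (\sum_(j < M) contact_full j k)%N else 0%N.

Lemma fnatE (k : 'I_M) : fnat k = - branch_series k. Proof. by rewrite /fnat valK. Qed.
Lemma NnatE (k : 'I_M) : Nnat k = (\sum_(j < M) contact_full j k)%N.
Proof. by rewrite /Nnat valK. Qed.

Lemma prod_fnat i : \prod_(i <= l < M) (psY R - ofx (fnat l)) = \prod_(j < M | (i <= j)%N) branch_factor j.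
Proof.
rewrite big_geq_mkord; apply: eq_bigr => j _.
by rewrite fnatE rmorphN opprK.
Qed.

Lemma PP_mod_fnat n : (n < M)%N -> exists p P', Pprod = ofx p + (psY R - ofx (fnat n)) * P' /\
  [/\ fps_ord p (Nnat n), gbounded (ofx p) & gbounded P'].
Proof.
by move=> nM; rewrite -[n]/(val (Ordinal nM)) fnatE NnatE; exact: PP_mod_gfac.
Qed.

Lemma fnat0 n : (n < M)%N -> fnat n 0%N = 0.
Proof. by move=> nM; rewrite -[n]/(val (Ordinal nM)) fnatE fps_oppE gs0 oppr0. Qed.

Lemma core_rep_exists (Q : PS) : gbounded Q ->
  exists (c : 'I_M -> {poly C}) (al be : PS),
  [/\ forall k, (size (c k) <= \sum_(j < M) contact_full j k)%N, gbounded al, gbounded be &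
    Q = \sum_(k < M) ofx (polyf (c k)) * tail_prod k + al * Pprod + be * branch_prod].
Proof.
move=> Qb.
have fb n : (n < M)%N -> gbounded (ofx (fnat n)).
  move=> nM; rewrite -[n]/(val (Ordinal nM)) fnatE rmorphN/=.
  by apply: gboundedN; exact: gbounded_gs.
have [c [al [be [cN alb beb E]]]] := rep_exists fnat0 PP_mod_fnat fb (leqnn M) Qb.
exists (fun k => c k), al, be; split=> //; first by move=> k; rewrite -NnatE.
move: E; rewrite big_geq// mul1r => ->; rewrite !prod_fnat big_mkord; congr (_ + _ + _ * _).
by apply: eq_bigr => k _; rewrite prod_fnat.
Qed.

Lemma core_rep_uniq (c : 'I_M -> {poly C}) (al be : PS) :
  (forall k, (size (c k) <= \sum_(j < M) contact_full j k)%N) ->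
  \sum_(k < M) ofx (polyf (c k)) * tail_prod k = al * Pprod + be * branch_prod -> forall k, c k = 0.
Proof.
move=> cN E k.
pose c' n : {poly C} := if insub n is Some k then c k else 0.
have c'E (i : 'I_M) : c' i = c i by rewrite /c' valK.
have := @rep_uniq R M fnat Nnat Pprod fnat0 PP_mod_fnat c' M (leqnn M).
rewrite -(c'E k) => /(_ _ al be); apply; last exact: ltn_ord.
  by move=> n nM; rewrite -[n]/(val (Ordinal nM)) c'E NnatE.
rewrite prod_fnat big_mkord (eq_bigr (fun k => ofx (polyf (c k)) * tail_prod k)) => [|i _].
  exact: E.
by rewrite c'E prod_fnat.
Qed.

End Branches.

(** * Arithmetic of the exponents *)

Section Exponents.
Variable R : realType.

(** With [E >= |x|^(2l)], the factor [E^(-p)] is split: [E^(-be)] with [be < 1] is kept for the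
    integration in [y], and the rest is traded for [|x|^(-2l(p - be))]. The hypothesis says exactly
    that at [be = 1] the resulting power of [|x|] exceeds -1. *)
Lemma exponent_choice (p n S l : R) : 1 <= p -> 0 <= l ->
  S + 2 * l * (1 - p^-1) - p^-1 < n ->
  exists al be : R, [/\ 0 <= al, al < 1, 0 <= be, be < 1 &
    - al <= p * (n - S) - 2 * l * (p - be)].
Proof.
move=> p1 l0 h; have p0 : 0 < p by apply: lt_le_trans p1.
(* The distance of the exponent of [|x|] from -1 at [be = 1]. *)
pose d := p * (n - S) - 2 * l * (p - 1) + 1.
have d0 : 0 < d.
  have := h; rewrite -(ltr_pM2l p0) => h'.
  have e : p * (S + 2 * l * (1 - p^-1) - p^-1) = p * S + 2 * l * (p - 1) - 1.
    by field; rewrite gt_eqF.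
  by move: h'; rewrite e /d; lra.
(* Lowering [be] to [1 - e] costs [2 l e], which is kept within half of the slack [d]; the summand 2
   keeps the denominator positive at [l = 0]. *)
pose e := Num.min 1 (d / (4 * l + 2)).
have l2 : 0 < 4 * l + 2 by lra.
have e0 : 0 < e by rewrite lt_min ltr01 divr_gt0.
have e1 : e <= 1 by rewrite ge_min lexx.
have el : 2 * l * e <= d / 2.
  apply: le_trans (_ : 2 * l * (d / (4 * l + 2)) <= _).
    by rewrite ler_wpM2l ?mulr_ge0// ge_min lexx orbT.
  rewrite mulrA ler_pdivrMr//; nra.
exists (Num.max 0 (1 - d / 2)), (1 - e); split.
- by rewrite le_max lexx.
- by rewrite gt_max ltr01/=; lra.
- by lra.
- by lra.
- rewrite lerNl le_max; apply/orP; right.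
  have -> : p * (n - S) - 2 * l * (p - (1 - e)) = d - 1 - 2 * l * e by rewrite /d; ring.
  by lra.
Qed.

Lemma powR_quot_bound (p t E K al be : R) (n S l : nat) : 1 <= p ->
  0 < t -> t <= 1 -> 0 <= K -> 0 <= be -> be <= 1 -> t ^+ l <= E ->
  - al <= p * (n%:R - S%:R) - l%:R * (p - be) ->
  (K * t ^+ n / (E * t ^+ S)) `^ p <= K `^ p * (t `^ (- al) * E `^ (- be)).
Proof.
move=> p1 t0 t1 K0 be0 be1 tE hal.
have p0 : 0 < p by apply: lt_le_trans p1.
have E0 : 0 < E by apply: lt_le_trans tE; rewrite exprn_gt0.
have tn0 : t != 0 by rewrite gt_eqF.
have -> : K * t ^+ n / (E * t ^+ S) = K * (t `^ (n%:R - S%:R) * E `^ (-1)).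
  rewrite powRD ?tn0 ?implybT// powRN !powR_mulrn ?(ltW t0)// powR_inv1 ?(ltW E0)//.
  by field; rewrite !gt_eqF// exprn_gt0.
rewrite !powRM ?mulr_ge0 ?powR_ge0// ler_wpM2l ?powR_ge0//.
rewrite -!powRrM mulN1r.
have -> : - p = - be + - (p - be) by ring.
rewrite powRD; last by rewrite (gt_eqF E0) implybT.
have hE : E `^ (- (p - be)) <= t `^ (- (l%:R * (p - be))).
  rewrite !powRN lef_pV2 ?posrE ?powR_gt0// powRrM powR_mulrn ?(ltW t0)//.
  have pb0 : 0 <= p - be by rewrite subr_ge0 (le_trans be1).
  by apply: ge0_ler_powR => //; rewrite nnegrE ?exprn_ge0 ?(ltW t0) ?(ltW E0).
apply: le_trans (_ : t `^ ((n%:R - S%:R) * p) * (E `^ (- be) * t `^ (- (l%:R * (p - be)))) <= _).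
  by rewrite ler_wpM2l ?powR_ge0// ler_wpM2l ?powR_ge0.
rewrite [leLHS](_ : _ = t `^ ((n%:R - S%:R) * p) * t `^ (- (l%:R * (p - be))) * E `^ (- be)); last by ring.
rewrite ler_wpM2r ?powR_ge0// -powRD; last by rewrite tn0 implybT.
apply: ger_powR; first by rewrite t0.
by lra.
Qed.

End Exponents.

Section NullLine.
Variables (R : realType) (p : R).
Local Notation C := R[i].
Local Notation mu := (@lebesgue_measure R).
Local Notation mu2 := (mu \x mu)%E.

(** The line [x = 0] is null for the product measure, so adding [+oo] on it to [g] leaves the
    integral unchanged and makes the domination hold there too. *)
Lemma Lp_dominated_off_line f (g : R * R -> \bar R) (r : R) : 0 < r ->
  (forall s, s <= r -> cmeas (box s) f) ->
  measurable_fun (box r) g -> (forall z, 0 <= g z)%E ->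
  (\int[mu2]_(z in box r) g z < +oo)%E ->
  (\forall z \near ((0 : R), (0 : R)), z.1 != 0 -> ((cabs (f z) `^ p)%:E <= g z)%E) ->
  Lp_loc p f.
Proof.
move=> r0 mf mg g0 fin h.
pose A : set (R * R) := [set 0] `*` setT.
have mA : measurable A by apply: measurableX.
have A0 : mu2 A = 0%E.
  rewrite product_measure1E; [|exact: measurable_set1|exact: measurableT].
  have e0 : mu ([set 0] : set R) = 0%E by exact: lebesgue_measure_set1.
  transitivity (0 * mu setT)%E; last by rewrite mul0e.
  by congr (_ * _)%E; exact: e0.
pose g' z : \bar R := (g z + +oo * (\1_A z)%:E)%E.
have i0 z : (0 <= +oo * (\1_A z)%:E :> \bar R)%E by rewrite mule_ge0.
have mi : measurable_fun (box r) (fun z => (\1_A z)%:E : \bar R).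
  by apply/measurable_EFinP; apply: measurable_indic.
have mi' : measurable_fun (box r) (fun z => +oo * (\1_A z)%:E : \bar R)%E.
  by apply: measurable_funeM.
have mb := @measurable_box R r.
apply: (@Lp_dominated R p f g' r r0 mf).
- exact: emeasurable_funD.
- by move=> z; rewrite adde_ge0.
- have ea : (\int[mu2]_(z in box r) g' z =
    \int[mu2]_(z in box r) g z + \int[mu2]_(z in box r) (+oo * (\1_A z)%:E))%E.
    by apply: ge0_integralD.
  have eb : (\int[mu2]_(z in box r) (+oo * (\1_A z)%:E) = +oo * \int[mu2]_(z in box r) (\1_A z)%:E)%E.
    by apply: ge0_integralZl.
  have ec : (\int[mu2]_(z in box r) (\1_A z)%:E = mu2 (A `&` box r))%E.
    by apply: integral_indic.
  have ed : (mu2 (A `&` box r) = 0)%E.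
    apply/eqP; rewrite eq_le measure_ge0 andbT -A0.
    by apply: le_measure; rewrite ?inE//; exact: measurableI.
  by rewrite ea eb ec ed mule0 adde0.
- apply: filterS h => z hz; rewrite /g'.
  have [z0|z0] := eqVneq z.1 0; last by apply: le_trans (hz z0) _; rewrite leeDl.
  have Az : A z by split.
  rewrite indicE mem_set//.
  by rewrite mule1 addey ?leey//; apply: contraTneq (g0 z) => ->.
Qed.

End NullLine.

Section Uniform.
Variables (R : realType) (I : finType).

Lemma near_unif_upper (Q : pred I) (a b : I -> R * R -> R) : (forall j z, 0 <= b j z) ->
  (forall j, Q j -> exists2 K : R, 0 <= K &
     \forall z \near ((0 : R), (0 : R)), a j z <= K * b j z) ->
  exists2 K : R, 0 <= K &
     \forall z \near ((0 : R), (0 : R)), forall j, Q j -> a j z <= K * b j z.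
Proof.
move=> b0 h.
have /choice[K hK] : forall j, exists K : R, 0 <= K /\
   \forall z \near ((0 : R), (0 : R)), Q j -> a j z <= K * b j z.
  move=> j; have [Qj|Qj] := boolP (Q j).
    by have [K K0 hK] := h j Qj; exists K; split=> //; apply: filterS hK.
  by exists 0; split=> //; apply: filterS (near_box ltr01).
exists (\sum_j K j); first by apply: sumr_ge0 => j _; have [] := hK j.
apply: filterS (filter_forall _ (fun j => (hK j).2)) => z hz j Qj.
apply: le_trans (hz j Qj) _; rewrite ler_wpM2r// (bigD1 j)//= lerDl.
by apply: sumr_ge0 => i _; have [] := hK i.
Qed.

Lemma near_unif_lower (Q : pred I) (a b : I -> R * R -> R) : (forall j z, 0 <= a j z) ->
  (forall j, Q j -> exists2 c : R, 0 < c &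
     \forall z \near ((0 : R), (0 : R)), c * b j z <= a j z) ->
  exists2 c : R, 0 < c &
     \forall z \near ((0 : R), (0 : R)), forall j, Q j -> c * b j z <= a j z.
Proof.
move=> a0 h.
have [|K K0 hK] := @near_unif_upper Q b a a0.
  move=> j /h[c c0 hc]; exists c^-1; first by rewrite invr_ge0 ltW.
  by apply: filterS hc => z hz; rewrite ler_pdivlMl.
have K1 : 0 < K + 1 by rewrite ltr_wpDl.
exists (K + 1)^-1; first by rewrite invr_gt0.
apply: filterS hK => z hz j /hz hj; rewrite ler_pdivrMl// (le_trans hj)//.
by rewrite ler_wpM2r// lerDl.
Qed.

End Uniform.

(** * Integrability criterion *)

(** The contribution of a strip of width [x^l]: the p-th power of the quotient times the width is at
    least of order [1/x] once the total exponent is at most -1. *)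
Lemma powR_quot_lower (R : realType) (p x ka : R) (n S l : nat) : 1 <= p ->
  0 < x -> x <= 1 -> 0 < ka -> p * (n%:R - S%:R - l%:R) + l%:R <= -1 ->
  ka `^ p / x <= (ka * x ^+ n / x ^+ (S + l)) `^ p * x ^+ l.
Proof.
move=> p1 x0 x1 ka0 h; have xn0 : x != 0 by rewrite gt_eqF.
have xge0 := ltW x0.
have -> : ka * x ^+ n / x ^+ (S + l) = ka * x `^ (n%:R - S%:R - l%:R).
  rewrite !powRD ?xn0 ?implybT// !powRN !powR_mulrn// exprD.
  by field; rewrite !gt_eqF// exprn_gt0.
rewrite powRM ?powR_ge0 ?(ltW ka0)// -powRrM -mulrA ler_wpM2l ?powR_ge0//.
rewrite -(powR_mulrn l xge0) -powRD ?xn0 ?implybT// -powR_inv1//.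
by apply: ger_powR; [rewrite x0|lra].
Qed.

Lemma near0I (R : realType) (P Q : R * R -> Prop) :
  (\forall z \near ((0 : R), (0 : R)), P z) -> (\forall z \near ((0 : R), (0 : R)), Q z) ->
  \forall z \near ((0 : R), (0 : R)), P z /\ Q z.
Proof. by move=> hP hQ; apply: filterS2 hP hQ. Qed.

(** * Sufficiency: each term of the representative is integrable *)

Section Integrability.
Variable R : realType.
Local Notation C := R[i].
Local Notation PS := (fps (fps C)).
Local Notation mu := (@lebesgue_measure R).
Local Notation mu2 := (mu \x mu)%E.
Variables (M : nat) (L : 'I_M -> nat) (q : 'I_M -> {poly R}) (psi : 'I_M -> nat -> R).
Hypothesis L0 : forall j, (0 < L j)%N.
Hypothesis q0 : forall j, (q j)`_0 = 0.
Hypothesis psic : forall j, rseries_convergent (psi j).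
Hypothesis proper : forall i j : 'I_M, i != j ->
  ord_is (fun m => (q j - q i)`_m + xshift (2 * L j) (psi j) m
                                  - xshift (2 * L i) (psi i) m) (contact L q i j).
Variable p : R.
Hypothesis p1 : 1 <= p.

Local Notation gs := (branch_series L q psi).
Local Notation hs := (Pseries L q).
Local Notation O := (contact L q).
Local Notation oo := (contact_full L q).
Local Notation gfac := (branch_factor L q psi).
Local Notation hfac := (Pfactor L q).
Local Notation PP := (Pprod L q).
Local Notation FF := (tail_prod L q psi).

Let gbg j : gbounded (ofx (gs j)). Proof. exact: gbounded_gs. Qed.
Let gbh j : gbounded (ofx (hs j)). Proof. exact: gbounded_hs. Qed.

Definition Pfactor_abs j z : R := cabs (evR (hfac j) z).
Definition qv j (x : R) : R := complex.Re (evR (ofx (qseries q j)) (x, 0)).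

Lemma Dv_ge0 j z : 0 <= Pfactor_abs j z. Proof. exact: cabs_ge0. Qed.
Local Hint Resolve Dv_ge0 : core.

Lemma evR_addY (f : fps C) : gbounded (ofx f) -> \forall z \near ((0 : R), (0 : R)),
  evR (psY R + ofx f) z = ((z.2)%:C)%C + evR (ofx f) (z.1, 0).
Proof.
move=> fb; have := evRD (gbounded_psY R) fb.
by apply: filterS2 (evRY R) => z zY ->; rewrite zY (evR_ofx_fst f z).
Qed.

Lemma evR_hfac_ReIm j : \forall z \near ((0 : R), (0 : R)),
  evR (hfac j) z = ((z.2 + qv j z.1) +i* z.1 ^+ (2 * L j))%C.
Proof.
have e := hsE L q j.
have ib : gbounded (ofx (fps_const 'i%C : fps C)).
  by rewrite ofx_const; exact: gbounded_const.
have xb := @gbounded_fpsXn R (2 * L j).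
have E1 : \forall z \near ((0 : R), (0 : R)),
  evR (hfac j) z = ((z.2)%:C)%C + evR (ofx (hs j)) (z.1, 0) := evR_addY (gbh j).
have E2 := evRD (gbounded_qs q j) (gboundedM ib xb).
have E345 := near0I (evRM ib xb) (near0I (@evR_const R 'i%C) (@evR_ofxXn R (2 * L j))).
apply: filterS3 E1 E2 E345 => z e1 e2 [e3 [e4 e5]].
rewrite e1 -evR_ofx_fst e rmorphD rmorphM/= e2 e3 ofx_const e4 e5.
rewrite (evR_ofx_fst (qseries q j)) -rmorphXn/= /qv.
have : complex.Im (evR (ofx (qseries q j)) (z.1, 0)) = 0.
  by apply: evR_real => m n; rewrite /ofx /fps_const; case: (n == 0)%N.
case: (evR _ _) => a b /= ->.
by apply/eqP; rewrite eq_complex/=; apply/andP; split; apply/eqP; ring.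
Qed.

Lemma Dv_lower : \forall z \near ((0 : R), (0 : R)), forall j,
  `|z.1| ^+ (2 * L j) <= Pfactor_abs j z /\
  `|z.2 + qv j z.1| + `|z.1| ^+ (2 * L j) <= 2 * Pfactor_abs j z.
Proof.
apply: filterS (filter_forall _ evR_hfac_ReIm) => z hz j.
have h1 := cabs_Re (evR (hfac j) z); have h2 := cabs_Im (evR (hfac j) z).
rewrite -!/(Pfactor_abs j z) in h1 h2.
by rewrite hz/= ?normrX in h1 h2; split=> //; lra.
Qed.

(** Corresponding factors of A + tB and P differ by at most a multiple of [|x|^(2 L_j)], itself at
    most the modulus of the factor of P. In [c_k F_k / P] this cancels all indices above [k]. *)
Lemma gfac_upper : exists2 K : R, 0 <= K & \forall z \near ((0 : R), (0 : R)),
  forall j, cabs (evR (gfac j) z) <= K * Pfactor_abs j z.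
Proof.
have [|j _|K K0 hK] := @near_unif_upper R _ xpredT (fun j z => cabs (evR (gfac j) z)) Pfactor_abs.
- by move=> j z.
- have db : gbounded (ofx (hs j - gs j)) by rewrite rmorphB/=; exact: gboundedB.
  have [K K0 hK] := evR_ord_upper db (ord_hg proper j j).1.
  rewrite /oo eqxx in hK.
  exists (1 + K); first by rewrite addr_ge0.
  have hb := gbounded_hfac L q j.
  have e : hfac j - ofx (hs j - gs j) = gfac j by rewrite rmorphB/= /Pfactor /branch_factor; ring.
  apply: filterS3 (evRB hb db) hK Dv_lower => z; rewrite e => -> h1 h2.
  apply: le_trans (cabsB _ _) _; rewrite mulrDl mul1r lerD//.
  by apply: le_trans h1 _; rewrite ler_wpM2l// (h2 j).1.
- by exists K => //; apply: filterS hK => z hz j; exact: hz.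
Qed.

(** Subtracting from factor [j] the conjugate of factor [i] eliminates [y]; the difference has order
    [O i j] by [ord_hhb], and conjugation preserves the modulus at real points. *)
Lemma Dv_pair : exists2 c : R, 0 < c & \forall z \near ((0 : R), (0 : R)),
  forall i j, i != j -> c * `|z.1| ^+ O i j <= Pfactor_abs i z + Pfactor_abs j z.
Proof.
have [|[i j] /= ij|c c0 hc] := @near_unif_lower R _ (fun ij : 'I_M * 'I_M => ij.1 != ij.2)
  (fun ij z => Pfactor_abs ij.1 z + Pfactor_abs ij.2 z) (fun ij z => `|z.1| ^+ O ij.1 ij.2).
- by move=> ij z; rewrite addr_ge0.
- have hbb : gbounded (ps_conj (ofx (hs i))) by apply: gbounded_conj.
  have hbE : ps_conj (ofx (hs i)) = ofx (Pbar_series L q i).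
    apply/funext => m; apply/funext => n; rewrite /ps_conj /ofx /fps_const.
    by case: (n == 0)%N => //; rewrite rmorph0.
  have facE : ps_conj (hfac i) = psY R + ofx (Pbar_series L q i).
    rewrite -hbE; apply/funext => m; apply/funext => n.
    rewrite /ps_conj !fps_addE rmorphD/=; congr (_ + _).
    by rewrite /psY /fps_const /fpsX; case: (m == 0)%N; case: (n == 1)%N; rewrite ?rmorph1 ?rmorph0.
  have db : gbounded (ofx (hs j - Pbar_series L q i)).
    by rewrite rmorphB/= -hbE; exact: gboundedB.
  have [c c0 hc] := evR_ord_lower db (ord_hhb L q ij).
  exists c => //.
  have hbj := gbounded_hfac L q j.
  have hbi := gbounded_conj (gbounded_hfac L q i).
  have e : hfac j - ps_conj (hfac i) = ofx (hs j - Pbar_series L q i).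
    by rewrite facE rmorphB/= /Pfactor; ring.
  apply: filterS3 hc (evRB hbj hbi) (evR_conj (gbounded_hfac L q i)) => z h1 h2 h3.
  apply: le_trans h1 _; rewrite -e h2 h3.
  by apply: le_trans (cabsB _ _) _; rewrite cabs_conj addrC.
- by exists c => //; apply: filterS hc => z hz i j ij; exact: (hz (i, j)).
Qed.

Lemma evR_PP : \forall z \near ((0 : R), (0 : R)), evR PP z = \prod_(j < M) evR (hfac j) z.
Proof. exact: evR_prod (gbounded_hfac L q). Qed.

Lemma evR_FF k : \forall z \near ((0 : R), (0 : R)),
  evR (FF k) z = \prod_(j < M | (k < j)%N) evR (gfac j) z.
Proof.
have := evR_prod [seq j : 'I_M <- index_enum 'I_M | (k < j)%N] (fun j : 'I_M => gbounded_gfac L q psic j).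
by apply: filterS => z; rewrite !big_filter.
Qed.

Lemma gbounded_term (c : {poly C}) k : gbounded (ofx (polyf c) * FF k).
Proof. by apply: gboundedM; [exact: gbounded_polyf|exact: gbounded_FF]. Qed.

Lemma evR_term (c : {poly C}) k : \forall z \near ((0 : R), (0 : R)),
  evR (ofx (polyf c) * FF k) z =
  evR (ofx (polyf c)) z * \prod_(j < M | (k < j)%N) evR (gfac j) z.
Proof.
have := evRM (gbounded_polyf c) (gbounded_FF L q psic k).
by apply: filterS2 (evR_FF k) => z <-.
Qed.

Lemma measurable_qv j : exists2 r : R, 0 < r & forall s, s <= r ->
  measurable_fun (box s) (fun z : R * R => qv j z.1).
Proof.
have [r r0 hr] := evR_measurable (gbounded_qs q j); exists r => // s sr.
have [m1 _] := hr (box s) (subset_box sr); move: m1.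
by apply: eq_measurable_fun => z _; rewrite (evR_ofx_fst (qseries q j) z).
Qed.

Let Sle (k i : 'I_M) : nat := (\sum_(j < M | (j <= k)%N && (j != i)) O j i)%N.

(** If [i], depending on the point, minimises the factors up to [k], then every other factor is at
    least half of its sum with factor [i], to which [Dv_pair] applies. *)
Lemma prod_Dv_lower (k : 'I_M) : exists2 c : R, 0 < c & \forall z \near ((0 : R), (0 : R)),
  z.1 != 0 -> exists2 i : 'I_M, (i <= k)%N &
    c * ((`|z.2 + qv i z.1| + `|z.1| ^+ (2 * L i)) * `|z.1| ^+ Sle k i) <=
    \prod_(j < M | (j <= k)%N) Pfactor_abs j z.
Proof.
have [c c0 hc] := Dv_pair.
(* Capped at 1 so that [c' ^+ M] bounds the product of constants whatever the number of factors. *)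
pose c' := Num.min 1 (c / 2).
have c'0 : 0 < c' by rewrite lt_min ltr01 divr_gt0.
have c'1 : c' <= 1 by rewrite ge_min lexx.
have c'c : c' <= c / 2 by rewrite ge_min lexx orbT.
exists (2^-1 * c' ^+ M); first by rewrite mulr_gt0 ?invr_gt0 ?exprn_gt0.
apply: filterS2 hc Dv_lower => z hz hD z0.
pose i := [arg min_(i < k | (i <= k)%N) Pfactor_abs i z]%O.
have [ik imin] : (i <= k)%N /\ forall j : 'I_M, (j <= k)%N -> Pfactor_abs i z <= Pfactor_abs j z.
  by rewrite /i; case: Order.TotalTheory.arg_minP => // i' ? ?; split.
exists i => //; rewrite (bigD1 i)//=.
have x0 : 0 <= `|z.1| by [].
have -> : `|z.1| ^+ Sle k i = \prod_(j < M | (j <= k)%N && (j != i)) `|z.1| ^+ O j i.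
  by rewrite /Sle; elim/big_rec2 : _ => // j a b _ <-; rewrite exprD.
rewrite mulrACA.
apply: ler_pM.
- by rewrite mulr_ge0 ?invr_ge0// addr_ge0// exprn_ge0.
- rewrite mulr_ge0 ?exprn_ge0 ?(ltW c'0)//; apply: prodr_ge0 => j _.
  by rewrite exprn_ge0.
- by rewrite ler_pdivrMl//; have [] := hD i.
apply: le_trans (_ : \prod_(j < M | (j <= k)%N && (j != i)) (c' * `|z.1| ^+ O j i) <= _).
  rewrite big_split/= ler_wpM2r ?prodr_ge0//.
  rewrite prodr_const ler_wiXn2l ?(ltW c'0)//.
  by rewrite (leq_trans (max_card _))// card_ord.
apply: ler_prod => j /andP[jk ji]; rewrite mulr_ge0 ?exprn_ge0 ?(ltW c'0)//=.
apply: le_trans (_ : c / 2 * `|z.1| ^+ O j i <= _).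
  by rewrite ler_wpM2r ?exprn_ge0.
rewrite mulrAC ler_pdivrMr// (le_trans (hz j i ji))//.
by rewrite mulr_natr mulr2n lerD2l imin.
Qed.

Local Notation bnd k := (Num.floor ((2 * L k + 1)%:R * (1 - p^-1) : R)
                     + (\sum_(j < M | (nat_of_ord j < nat_of_ord k)%N) O j k)%:Z)%R.

Let pV1 : p^-1 <= 1. Proof. by rewrite invf_le1// (lt_le_trans _ p1). Qed.

Hypothesis order : forall i k : 'I_M, (i <= k)%N ->
  (Sle k i)%:R + (2 * L i)%:R * (1 - p^-1) <= (Sle k k)%:R + (2 * L k)%:R * (1 - p^-1).

Let SleE k : Sle k k = (\sum_(j < M | (j < k)%N) O j k)%N.
Proof. by apply: eq_bigl => j; rewrite ltn_neqAle andbC. Qed.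

Lemma term_integrable k (c : {poly C}) : (forall m : nat, (m%:Z < bnd k)%R -> c`_m = 0) ->
  Lp_loc p (quot_fun (ofx (polyf c) * FF k) PP).
Proof.
move=> c0.
set v := (2 * L k + 1)%:R * (1 - p^-1) : R.
have v0 : 0 <= v by rewrite mulr_ge0// subr_ge0.
have fl0 : 0 <= Num.floor v by rewrite floor_ge0.
pose n := (`|Num.floor v|%N + Sle k k)%N.
have nE : n%:Z = bnd k by rewrite /n PoszD gez0_abs// SleE.
have cn m : (m < n)%N -> polyf c m = 0.
  by move=> mn; apply: c0; rewrite -nE ltz_nat.
(* From [v < floor v + 1]: the remaining share [1 - 1/p] of [v], less the 1, is [- 1/p]. The strict
   inequality is what [exponent_choice] consumes. *)
have nlow : (Sle k k)%:R + (2 * L k)%:R * (1 - p^-1) - p^-1 < n%:R.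
  have := lt_succ_floor v; rewrite intrD /n natrD.
  have -> : (`|Num.floor v|%N)%:R = (Num.floor v)%:~R :> R.
    by rewrite -[in RHS](gez0_abs fl0).
  by rewrite /v natrD mulrDl mul1r; lra.
have /choice[al hal] : forall i : 'I_M, exists al : R, exists be : R,
  [/\ 0 <= al, al < 1, 0 <= be, be < 1 &
   (i <= k)%N -> - al <= p * (n%:R - (Sle k i)%:R) - (2 * L i)%:R * (p - be)].
  (* Indices above [k] are never minimisers; zero exponents just keep their dominating functions
     integrable. *)
  move=> i; have [ik|ik] := leqP i k; last by exists 0, 0; split.
  have [|al [be [h1 h2 h3 h4 h5]]] := @exponent_choice R p n%:R (Sle k i)%:R (L i)%:R p1 (ler0n _ _).
    have := order ik; rewrite !natrM => h.
    by move: nlow; rewrite !natrM; lra.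
  by exists al, be; split=> // _; rewrite natrM.
have {hal}/choice[be hab] := hal.
have [K1 K10 hK1] := evR_ord_upper (gbounded_polyf c) cn.
have [K2 K20 hK2] := gfac_upper.
have [c3 c30 hc3] := prod_Dv_lower k.
pose K := K1 * (\prod_(j < M | (k < j)%N) K2) / c3.
have K0 : 0 <= K by rewrite divr_ge0 ?(ltW c30)// mulr_ge0// prodr_ge0.
pose E i (z : R * R) := `|z.2 + qv i z.1| + `|z.1| ^+ (2 * L i).
pose g i (z : R * R) : \bar R := (`|z.1| `^ (- al i) * E i z `^ (- be i))%:E.
have bound : \forall z \near ((0 : R), (0 : R)), z.1 != 0 ->
  exists2 i : 'I_M, (i <= k)%N &
    cabs (quot_fun (ofx (polyf c) * FF k) PP z) `^ p <=
    K `^ p * (`|z.1| `^ (- al i) * E i z `^ (- be i)).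
  have := near0I (near0I (evR_term c k) evR_PP) (near0I Dv_lower (near_box (@ltr01 R))).
  apply: filterS3 hc3 (near0I hK1 hK2).
  move=> z hz [h1 h2] [[eT eP] [hD [z1 _]]] z0; have [i ik hi] := hz z0.
  exists i => //.
  have x0 : 0 < `|z.1| by rewrite normr_gt0.
  have E0 : 0 < E i z by rewrite /E ltr_wpDl// exprn_gt0.
  have Dp j : 0 < Pfactor_abs j z by apply: lt_le_trans (hD j).1; rewrite exprn_gt0.
  have [_ _ be0 be1 hi'] := hab i.
  apply: le_trans (powR_quot_bound p1 x0 z1 K0 be0 (ltW be1) _ (hi' ik)); last first.
    by rewrite /E lerDr.
  apply: ge0_ler_powR; rewrite ?nnegrE ?cabs_ge0 ?(le_trans _ p1)//.
    by apply: divr_ge0; apply: mulr_ge0 => //; rewrite ?exprn_ge0 ?normr_ge0 ?(ltW E0).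
  rewrite /quot_fun -!/(evR _ z).
  rewrite eT eP !cabsM cabsV !cabs_prod.
  have -> : \prod_(j < M) cabs (evR (hfac j) z) =
    (\prod_(j < M | (k < j)%N) Pfactor_abs j z) * \prod_(j < M | (j <= k)%N) Pfactor_abs j z.
    rewrite (bigID (fun j : 'I_M => (k < j)%N))/=; congr (_ * _).
    by apply: eq_bigl => j; rewrite -leqNgt.
  set A1 := \prod_(j < M | (k < j)%N) Pfactor_abs j z; set A2 := \prod_(j < M | _) Pfactor_abs j z.
  have A10 : 0 < A1 by apply: prodr_gt0.
  have A20 : 0 < A2 by apply: prodr_gt0.
  have h3 : \prod_(j < M | (k < j)%N) cabs (evR (gfac j) z) <=
     (\prod_(j < M | (k < j)%N) K2) * A1.
    rewrite -big_split/=; apply: ler_prod => j _; rewrite cabs_ge0/=.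
    exact: h2.
  have S0 : 0 < `|z.1| ^+ Sle k i by rewrite exprn_gt0.
  apply: le_trans (_ : (K1 * `|z.1| ^+ n) * ((\prod_(j < M | (k < j)%N) K2) * A1) / (A1 * A2) <= _).
    rewrite ler_wpM2r ?invr_ge0 ?mulr_ge0 ?(ltW A10) ?(ltW A20)//.
    by apply: ler_pM => //; rewrite ?cabs_ge0// prodr_ge0// => j _; exact: cabs_ge0.
  have -> : (K1 * `|z.1| ^+ n) * ((\prod_(j < M | (k < j)%N) K2) * A1) / (A1 * A2) =
     (K1 * `|z.1| ^+ n * (\prod_(j < M | (k < j)%N) K2)) / A2.
    by field; rewrite !gt_eqF.
  rewrite /K -/(E i z).
  have -> : K1 * (\prod_(j < M | (k < j)%N) K2) / c3 * `|z.1| ^+ n / (E i z * `|z.1| ^+ Sle k i) =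
    (K1 * `|z.1| ^+ n * (\prod_(j < M | (k < j)%N) K2)) / (c3 * (E i z * `|z.1| ^+ Sle k i)).
    by field; rewrite !gt_eqF.
  rewrite ler_wpM2l ?mulr_ge0 ?prodr_ge0 ?exprn_ge0// lef_pV2 ?posrE ?mulr_gt0//.
have [rq rq0 hrq] := quot_measurable (gbounded_term c k) (gbounded_PP L q).
have /choice[rj hrj] : forall j, exists r : R, 0 < r /\ forall s, s <= r ->
  measurable_fun (box s) (fun z : R * R => qv j z.1).
  by move=> j; have [r r0 hr] := measurable_qv j; exists r.
pose r := \big[Num.min/Num.min 1 rq]_(j < M) rj j.
have r0 : 0 < r.
  by rewrite /r; apply: lt_bigmin => [|j _]; [rewrite lt_min ltr01|have [] := hrj j].
have r_id : r <= Num.min 1 rq by exact: bigmin_le_id.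
have r1 : r <= 1 by apply: le_trans r_id _; rewrite ge_min lexx.
have rrq : r <= rq by apply: le_trans r_id _; rewrite ge_min lexx orbT.
have gi i : measurable_fun (box r) (g i) /\ (\int[mu2]_(z in box r) g i z < +oo)%E.
  have [h1 h2 h3 h4 _] := hab i.
  apply: (@integral_sing2 R (al i) (be i) r (qv i) (fun x => `|x| ^+ (2 * L i))) => //.
  - by apply: (hrj i).2; exact: bigmin_le_cond.
  - apply: measurable_funX.
    apply: (@measurableT_comp _ _ _ _ _ _ (fun x : R => `|x|) (box r) fst) => //.
    by apply: measurable_funS (@measurable_fst _ _ _ _).
have g0 i z : (0 <= g i z)%E by rewrite lee_fin mulr_ge0// powR_ge0.
have Kp0 : (0 <= (K `^ p)%:E)%E by rewrite lee_fin powR_ge0.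
have mk i : measurable_fun (box r) (fun z => (K `^ p)%:E * g i z)%E.
  by apply: measurable_funeM; have [] := gi i.
have pk i z : (0 <= (K `^ p)%:E * g i z)%E by rewrite mule_ge0.
have mb := @measurable_box R r.
(* The minimising index varies with the point, so the dominating function sums the bounds over all
   indices. *)
apply: (@Lp_dominated_off_line R p _
  (fun z => \sum_(i <- index_enum 'I_M) ((K `^ p)%:E * g i z))%E r r0).
- by move=> s sr; apply: hrq; apply: subset_box; apply: le_trans rrq.
- exact: emeasurable_sum.
- by move=> z; apply: sume_ge0.
- have es : (\int[mu2]_(z in box r) (\sum_(i <- index_enum 'I_M) ((K `^ p)%:E * g i z)) =
    \sum_(i <- index_enum 'I_M) \int[mu2]_(z in box r) ((K `^ p)%:E * g i z))%E.
    by apply: ge0_integral_sum.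
  rewrite es; apply: lte_sum_pinfty => i _.
  have ez : (\int[mu2]_(z in box r) ((K `^ p)%:E * g i z) =
    (K `^ p)%:E * \int[mu2]_(z in box r) g i z)%E.
    by apply: ge0_integralZl => //; have [] := gi i.
  by rewrite ez lte_mul_pinfty//; have [] := gi i.
- apply: filterS bound => z hz z0; have [i ik hi] := hz z0.
  rewrite (bigD1 i)//=; apply: le_trans (_ : (K `^ p)%:E * g i z <= _)%E.
    by rewrite /g -EFinM lee_fin.
  by rewrite leeDl// sume_ge0.
Qed.

End Integrability.

Lemma near0_forall (R : realType) (I : finType) (P : I -> R * R -> Prop) :
  (forall i, \forall z \near ((0 : R), (0 : R)), P i z) ->
  \forall z \near ((0 : R), (0 : R)), forall i, P i z.
Proof. by move=> h; apply: filterS (filter_forall _ h). Qed.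

Lemma section_measurable (R : realType) (r x : R) (g : R * R -> \bar R) :
  measurable_fun (box r) g -> `|x| <= r ->
  measurable_fun (`[- r, r]%classic : set R) (fun y => g (x, y)).
Proof.
move=> mg xr; apply: (@measurable_comp _ _ _ _ _ _ (box r) g _ (pair x)).
- exact: measurable_box.
- move=> _ [y yr <-]; split=> //=; move: yr; rewrite /= in_itv/= -ler_norml.
  by [].
- exact: mg.
- by apply: measurable_funS (pair1_measurable x).
Qed.

(** * Necessity of the vanishing orders *)

Section Necessity.
Variable R : realType.
Local Notation C := R[i].
Local Notation PS := (fps (fps C)).
Local Notation mu := (@lebesgue_measure R).
Local Notation mu2 := (mu \x mu)%E.
Variables (M : nat) (L : 'I_M -> nat) (q : 'I_M -> {poly R}) (psi : 'I_M -> nat -> R).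
Hypothesis L0 : forall j, (0 < L j)%N.
Hypothesis q0 : forall j, (q j)`_0 = 0.
Hypothesis psic : forall j, rseries_convergent (psi j).
Hypothesis proper : forall i j : 'I_M, i != j ->
  ord_is (fun m => (q j - q i)`_m + xshift (2 * L j) (psi j) m
                                  - xshift (2 * L i) (psi i) m) (contact L q i j).
Variable p : R.
Hypothesis p1 : 1 <= p.

Local Notation gs := (branch_series L q psi).
Local Notation hs := (Pseries L q).
Local Notation O := (contact L q).
Local Notation oo := (contact_full L q).
Local Notation gfac := (branch_factor L q psi).
Local Notation hfac := (Pfactor L q).
Local Notation PP := (Pprod L q).
Local Notation FF := (tail_prod L q psi).
Local Notation Dv := (Pfactor_abs L q).

Let gbg j : gbounded (ofx (gs j)). Proof. exact: gbounded_gs. Qed.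
Let gbh j : gbounded (ofx (hs j)). Proof. exact: gbounded_hs. Qed.

Local Notation bnd k := (Num.floor ((2 * L k + 1)%:R * (1 - p^-1) : R)
                     + (\sum_(j < M | (nat_of_ord j < nat_of_ord k)%N) O j k)%:Z)%R.

Variables (c : 'I_M -> {poly C}) (k : 'I_M).

Let cv i (x : R) : C := evR (ofx (polyf (c i))) (x, 0).
Let gv j (x : R) : C := evR (ofx (gs j)) (x, 0).

(* The part of [\sum_(i <= k) c_i F_i] left after removing the branches above
   [k], as a polynomial in [y] at a fixed [x]; its value on branch [k] is
   [c_k(x)]. *)
Let hpoly (x : R) : {poly C} :=
  \sum_(i < M | (i <= k)%N) (cv i x) *: \prod_(j < M | (i < j)%N && (j <= k)%N) ('X - (- gv j x)%:P).

Lemma size_hpoly x : (size (hpoly x) <= M.+1)%N.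
Proof.
apply: (leq_trans (size_sum _ _ _)); apply/bigmax_leqP => i _.
apply: (leq_trans (size_scale_leq _ _)).
rewrite -big_filter size_prod_XsubC ltnS size_filter.
by rewrite (leq_trans (count_size _ _))// /index_enum -enumT size_enum_ord.
Qed.

Lemma hpoly_branch x : (hpoly x).[- gv k x] = cv k x.
Proof.
rewrite horner_sum (bigD1 k)//= big_pred0 => [|j]; last by apply/negbTE; rewrite negb_and -leqNgt -ltnNge; case: ltngtP.
rewrite hornerZ hornerC mulr1 big1 ?addr0// => i /andP[ik ink].
rewrite hornerZ horner_prod (bigD1 k)/=; last by rewrite leqnn andbT ltn_neqAle ik andbT.
by rewrite hornerXsubC subrr mul0r mulr0.
Qed.

(** The factors of [F_i] with [j > k] are common to all [i <= k] and come out; those with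
    [i < j <= k] make up [hpoly]. *)
Lemma evR_partial_sum : \forall z \near ((0 : R), (0 : R)),
  evR (\sum_(i < M | (i <= k)%N) ofx (polyf (c i)) * FF i) z =
  (\prod_(j < M | (k < j)%N) (((z.2)%:C)%C + gv j z.1)) * (hpoly z.1).[((z.2)%:C)%C].
Proof.
have h1 := evR_sum [seq i : 'I_M <- index_enum 'I_M | (i <= k)%N]
  (fun i : 'I_M => gbounded_term L q psic (c i) i).
have h2 := near0_forall (fun j => evR_addY (gbg j)).
have h3 := near0_forall (fun i => evR_term L q psic (c i) i).
apply: filterS3 h3 h2 h1 => z hT hg; rewrite !big_filter => ->.
rewrite horner_sum mulr_sumr; apply: eq_bigr => i ik.
rewrite hT hornerZ horner_prod /cv -evR_ofx_fst mulrCA; congr (_ * _).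
rewrite (bigID (fun j : 'I_M => (k < j)%N))/=; congr (_ * _).
  apply: eq_big => j; first by case: (ltnP k j) => kj; rewrite ?andbF ?andbT ?(leq_ltn_trans ik kj).
  by move=> _; rewrite hg.
apply: eq_big => j; first by rewrite -leqNgt.
by move=> _; rewrite hg hornerXsubC opprK.
Qed.

Let gv_real x : gv k x = ((complex.Re (gv k x))%:C)%C.
Proof.
have : complex.Im (gv k x) = 0.
  by apply: evR_real => m n; rewrite /ofx /fps_const /branch_series; case: (n == 0)%N.
by case: (gv k x) => a b /= ->.
Qed.

Lemma top_coef_necessary :
  Lp_loc p (quot_fun (\sum_(i < M | (i <= k)%N) ofx (polyf (c i)) * FF i) PP) ->
  forall m : nat, (m%:Z < bnd k)%R -> (c k)`_m = 0.
Proof.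
set S := \sum_(i < M | _) _ => hLp m0 hm0; apply/eqP; apply: contraT => cm0.
have exn : exists n, (c k)`_n != 0 by exists m0.
case: (ex_minnP exn) => n cn nmin.
have nm0 : (n <= m0)%N by apply: nmin.
set Sk := (\sum_(j < M | (j < k)%N) O j k)%N in hm0.
have p0 : 0 < p by apply: lt_le_trans p1.
(* Below the bound means [n + 1 <= floor v + Sk <= v + Sk]; multiplied by [p], this is the condition
   under which the strip integral diverges. *)
have nup : p * (n%:R - Sk%:R - (2 * L k)%:R) + (2 * L k)%:R <= -1.
  set v := (2 * L k + 1)%:R * (1 - p^-1) in hm0.
  have h1 : (n%:Z + 1 <= Num.floor v + Sk%:Z)%R.
    by rewrite lezD1 (le_lt_trans _ hm0)// lez_nat.
  have h2 : n%:R + 1 <= (Num.floor v)%:~R + Sk%:R :> R.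
    by have := h1; rewrite -(ler_int R) !intrD.
  have h3 : n%:R + 1 <= v + Sk%:R by apply: le_trans h2 _; rewrite lerD2r floor_le_tmp.
  have := ler_wpM2l (ltW p0) h3.
  have -> : p * (v + Sk%:R) = (2 * L k)%:R * p + p - (2 * L k)%:R - 1 + p * Sk%:R.
    by rewrite /v natrD; field; rewrite gt_eqF.
  by lra.
have cord : fps_ord (polyf (c k)) n.
  split=> // m mn; apply/eqP; apply: contraTT mn => cm; rewrite -leqNgt; exact: nmin.
have [c1 c10 hc1] := evR_ord_lower (gbounded_polyf (c k)) cord.
have dhb j : gbounded (ofx (hs j - gs k)) by rewrite rmorphB/=; exact: gboundedB.
have dgb j : gbounded (ofx (gs k - gs j)) by rewrite rmorphB/=; exact: gboundedB.
have [||K3 K30 hK3] := @near_unif_upper R _ xpredT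
  (fun j z => cabs (evR (ofx (hs j - gs k)) z)) (fun j z => `|z.1| ^+ oo j k).
- by move=> j z; rewrite exprn_ge0.
- by move=> j _; exact: evR_ord_upper (dhb j) (ord_hg proper j k).1.
have [||c4 c40 hc4] := @near_unif_lower R _ (fun j : 'I_M => j != k)
  (fun j z => cabs (evR (ofx (gs k - gs j)) z)) (fun j z => `|z.1| ^+ O j k).
- by move=> j z; exact: cabs_ge0.
- by move=> j jk; exact: evR_ord_lower (dgb j) (ord_gg proper jk).
have gk0 m : (m < 1)%N -> gs k m = 0 by case: m => // _; exact: gs0.
have [Kg Kg0 hKg] := evR_ord_upper (gbg k) gk0.
have hP := evR_PP L q.
have hDl := Dv_lower L q.
have hh := near0_forall (fun j => evR_addY (gbh j)).
have hsubj j : \forall z \near ((0 : R), (0 : R)),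
  evR (ofx (hs j - gs k)) z = evR (ofx (hs j)) z - evR (ofx (gs k)) z /\
  evR (ofx (gs k - gs j)) z = evR (ofx (gs k)) z - evR (ofx (gs j)) z.
  have e1 := evRB (gbh j) (gbg k); have e2 := evRB (gbg k) (gbg j).
  by apply: filterS2 e1 e2 => z; rewrite !rmorphB.
have hsub := near0_forall hsubj.
have /near_boxE[rho rho0 hrho] := near0I (near0I (near0I evR_partial_sum hP) (near0I hDl hh))
  (near0I (near0I hsub hc1) (near0I (near0I hK3 hc4) hKg)).
have [r1 r10 hr1] := Lp_boxE hLp.
pose r := Num.min (Num.min 1 rho) r1.
have r0 : 0 < r by rewrite !lt_min ltr01 rho0 r10.
have r_1 : r <= 1 by rewrite !ge_min lexx.
have r_rho : r <= rho by rewrite !ge_min lexx !orbT.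
have r_r1 : r <= r1 by rewrite ge_min lexx orbT.
have [mq fin] := hr1 r r_r1.
(* On a strip of width [ep x^(2 L_k)] the distance to branch [k] is at most half of the gap
   [c4 x^(O_jk)] between the branches, so each branch [j > k] remains at distance at least [c4 / 2]
   times [x^(O_jk)]. *)
pose ep := Num.min 1 (c4 / 2).
have ep0 : 0 < ep by rewrite lt_min ltr01 divr_gt0.
have ep1 : ep <= 1 by rewrite ge_min lexx.
have epc : ep <= c4 / 2 by rewrite ge_min lexx orbT.
have [cP cP0 hcP] := poly_lower_itv R M.
(* Branch [k] satisfies [|a| <= Kg x] and the strip is no wider than [x], so [x <= d] keeps the
   strip inside [[-r, r]]. *)
pose d := r / (Kg + 2).
have Kg2 : 0 < Kg + 2 by rewrite ltr_wpDl.
have d0 : 0 < d by rewrite divr_gt0.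
have dK : (Kg + 2) * d = r by rewrite /d mulrC divfK// gt_eqF.
have dr : d <= r by rewrite -[leRHS]dK ler_peMl ?(ltW d0)//; lra.
have K31 : 0 < K3 + 1 by rewrite ltr_wpDl.
(* The three groups bound, in order, the branches above [k], the value of [hpoly], and from above
   the factors of P. *)
pose ka := (\prod_(j < M | (k < j)%N) (c4 / 2)) * (cP * c1) / \prod_(j < M) (K3 + 1).
have c42 : 0 < c4 / 2 by rewrite divr_gt0.
have ka0 : 0 < ka by rewrite divr_gt0 ?prodr_gt0 ?mulr_gt0// ?prodr_gt0.
have p3 : (0 : R) < 3 ^+ M by rewrite exprn_gt0.
pose g (z : R * R) : \bar R := (cabs (quot_fun S PP z) `^ p)%:E.
have g0 z : (0 <= g z)%E by rewrite lee_fin powR_ge0.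
have mg : measurable_fun (box r) g by exact: measurable_cabs_powR.
suff low (x : R) : 0 < x -> x <= d ->
  ((ka `^ p * (ep / 3 ^+ M) / x)%:E <= \int[mu]_(y in `[(- r)%R, r]) g (x, y))%E.
  have ce : 0 < ka `^ p * (ep / 3 ^+ M) by rewrite mulr_gt0 ?powR_gt0// divr_gt0.
  have := integral_box_diverges mg g0 ce d0 dr low.
  by move=> e; move: fin; rewrite /Lp_box -/g e.
move=> x0 xd.
have x1 : x <= 1 by apply: le_trans xd (le_trans dr r_1).
have xge0 := ltW x0.
have xX l : 0 < x ^+ l by rewrite exprn_gt0.
pose T := ep * x ^+ (2 * L k).
have T0 : 0 < T by rewrite mulr_gt0.
have xL1 : x ^+ (2 * L k) <= x.
  by rewrite -[leRHS]expr1 ler_wiXn2l// muln_gt0 L0.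
have Tx : T <= x by apply: le_trans xL1; rewrite /T ler_piMl// ltW.
pose a := - complex.Re (gv k x).
have aE : ((a%:C)%C : C) = - gv k x by rewrite /a rmorphN/= -gv_real.
have [b [ab bT hb]] := hcP (hpoly x) a T (size_hpoly x) T0.
rewrite aE hpoly_branch in hb.
have xr : `|x| <= r by rewrite ger0_norm// (le_trans xd).
have inbox y : `|y| <= r -> box rho (x, y) by move=> yr; split; apply: le_trans r_rho.
have aK : `|a| <= Kg * x.
  have zr : `|0 : R| <= r by rewrite normr0 ltW.
  have [_ [_ [_ h]]] := hrho _ (inbox 0 zr); move: h => /=.
  rewrite expr1 (ger0_norm xge0) -/(gv k x) => h; apply: le_trans h.
  by rewrite -cabs_real aE cabsN.
have T3 : T / 3 ^+ M <= T by rewrite ler_pdivrMr// ler_peMr ?(ltW T0)// exprn_ege1// ler1n.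
have T30 : 0 < T / 3 ^+ M by rewrite divr_gt0.
have arange : - (Kg * x) <= a /\ a <= Kg * x by move: aK; rewrite ler_norml => /andP[].
have Kxr : Kg * x + x <= r.
  apply: le_trans (_ : (Kg + 2) * d <= _); last by rewrite dK.
  apply: le_trans (_ : (Kg + 2) * x <= _); last by rewrite ler_wpM2l ?(ltW Kg2).
  by rewrite mulrDl lerD2l; lra.
have yrange y : b <= y -> y <= b + T / 3 ^+ M -> `|y| <= r.
  by move=> y1 y2; rewrite ler_norml; apply/andP; split; lra.
pose val := (ka * x ^+ n / x ^+ (Sk + 2 * L k)) `^ p.
have main y : b <= y -> y <= b + T / 3 ^+ M -> (val%:E <= g (x, y))%E.
  move=> y1 y2.
  have [[[eS eP] [hD eh]] [[esub hc1'] [[hK3' hc4'] _]]] := hrho _ (inbox y (yrange y y1 y2)).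
  rewrite /= in eS eP hD eh esub hc1' hK3' hc4'.
  rewrite (ger0_norm xge0) in hD hc1' hK3' hc4'.
  pose tau := y - a.
  have tau0 : 0 <= tau by rewrite /tau; lra.
  have tauT : tau <= T by rewrite /tau; lra.
  have tauE : ((tau%:C)%C : C) = (y%:C)%C + gv k x by rewrite /tau rmorphB/= aE opprK.
  (* With [tau = y - a], factor [j] is [tau] plus the difference of the series; [tau <= x^(2 L_k)]
     is absorbed because no full contact with [k] exceeds [2 L_k]. *)
  have Dup j : Dv j (x, y) <= (K3 + 1) * x ^+ oo j k.
    rewrite /Pfactor_abs eh /= -/(evR _ _).
    have -> : (y%:C)%C + evR (ofx (hs j)) (x, 0) =
      (tau%:C)%C + evR (ofx (hs j - gs k)) (x, y).
      rewrite (esub j).1 tauE (evR_ofx_fst (hs j) (x, y)) (evR_ofx_fst (gs k) (x, y)) /=.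
      rewrite -[gv k x]/(evR (ofx (gs k)) (x, 0)).
      by rewrite -[RHS]addrA [X in _ = _ + X]addrC subrK.
    apply: le_trans (cabsD _ _) _; rewrite mulrDl mul1r addrC; apply: lerD.
      exact: hK3'.
    rewrite cabs_real ger0_norm// (le_trans tauT)// (le_trans (_ : _ <= x ^+ (2 * L k)))//.
      by rewrite /T ler_piMl// ltW.
    rewrite ler_wiXn2l// /contact_full; case: eqVneq => // _.
    by have [] := O_leqL L q j k.
  have Glow (j : 'I_M) : (k < j)%N -> c4 / 2 * x ^+ oo j k <= cabs ((y%:C)%C + gv j x).
    move=> kj; have jk : j != k by rewrite neq_ltn kj orbT.
    have h := hc4' j jk; rewrite (esub j).2 in h.
    rewrite (evR_ofx_fst (gs k) (x, y)) (evR_ofx_fst (gs j) (x, y)) /= -/(gv k x) -/(gv j x) in h.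
    have : cabs (gv k x - gv j x) <= cabs (tau%:C)%C + cabs ((y%:C)%C + gv j x).
      have -> : gv k x - gv j x = (tau%:C)%C - ((y%:C)%C + gv j x).
        by rewrite tauE opprD addrACA subrr add0r.
      exact: cabsB.
    have : tau <= c4 / 2 * x ^+ O j k.
      apply: le_trans tauT _; rewrite /T; apply: ler_pM => //; rewrite ?(ltW ep0) ?(ltW (xX _))//.
      by rewrite ler_wiXn2l//; have [] := O_leqL L q j k.
    rewrite cabs_real (ger0_norm tau0) /contact_full (negbTE jk).
    by move: h; set w := x ^+ _; lra.
  rewrite /g lee_fin /val; apply: ge0_ler_powR; rewrite ?nnegrE ?cabs_ge0 ?(ltW p0)//.
    by apply: divr_ge0; [apply: mulr_ge0; [exact: ltW|exact: ltW (xX _)]|exact: ltW (xX _)].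
  rewrite /quot_fun /= -!/(evR _ (x, y)) eS eP !cabsM cabsV !cabs_prod.
  have DvP : \prod_(j < M) cabs (evR (hfac j) (x, y)) <= \prod_(j < M) ((K3 + 1) * x ^+ oo j k).
    by apply: ler_prod => j _; rewrite cabs_ge0 Dup.
  have Dp : 0 < \prod_(j < M) cabs (evR (hfac j) (x, y)).
    by apply: prodr_gt0 => j _; apply: lt_le_trans (hD j).1.
  have Gp : \prod_(j < M | (k < j)%N) (c4 / 2 * x ^+ oo j k) <=
      \prod_(j < M | (k < j)%N) cabs ((y%:C)%C + gv j x).
    by apply: ler_prod => j kj; rewrite mulr_ge0 ?(ltW c42) ?(ltW (xX _))//= Glow.
  have Hp : cP * (c1 * x ^+ n) <= cabs (hpoly x).[(y%:C)%C].
    apply: le_trans (hb y y1 y2); apply: (ler_wpM2l (ltW cP0)).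
    rewrite (evR_ofx_fst (polyf (c k)) (x, y)) /= in hc1'.
    exact: hc1'.
  apply: le_trans (_ : (\prod_(j < M | (k < j)%N) (c4 / 2 * x ^+ oo j k)) * (cP * (c1 * x ^+ n)) /
    \prod_(j < M) ((K3 + 1) * x ^+ oo j k) <= _); last first.
    apply: ler_pM.
    - apply: mulr_ge0; last by rewrite !mulr_ge0 ?(ltW cP0) ?(ltW c10) ?(ltW (xX _)).
      by apply: prodr_ge0 => j _; rewrite mulr_ge0 ?(ltW c42) ?(ltW (xX _)).
    - by rewrite invr_ge0 prodr_ge0// => j _; rewrite mulr_ge0 ?(ltW K31) ?(ltW (xX _)).
    - apply: ler_pM => //.
        by apply: prodr_ge0 => j _; rewrite mulr_ge0 ?(ltW c42) ?(ltW (xX _)).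
      by rewrite !mulr_ge0 ?(ltW cP0) ?(ltW c10) ?(ltW (xX _)).
    - rewrite lef_pV2 ?posrE//.
      by apply: prodr_gt0 => j _; rewrite mulr_gt0.
  rewrite [X in _ <= _ / X]big_split/= [X in _ <= X * _ / _]big_split/= /ka.
  have -> : \prod_(j < M) x ^+ oo j k = (\prod_(j < M | (k < j)%N) x ^+ oo j k) * x ^+ (Sk + 2 * L k).
    rewrite (bigID (fun j : 'I_M => (k < j)%N))/=; congr (_ * _).
    have okk : oo k k = (2 * L k)%N by rewrite /contact_full eqxx.
    rewrite (bigD1 k)/= ?ltnn// okk exprD [RHS]mulrC; congr (_ * _).
    transitivity (\prod_(j < M | (j < k)%N) x ^+ O j k).
      apply: eq_big => j; first by rewrite -leqNgt ltn_neqAle andbC.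
      by move=> /andP[_ jk]; rewrite /contact_full (negbTE jk).
    by rewrite /Sk; elim/big_rec2 : _ => // j u v _ ->; rewrite exprD.
  set Q1 := \prod_(j < M | (k < j)%N) x ^+ oo j k.
  set Q2 := \prod_(j < M | _) (c4 / 2); set Q3 := \prod_(j < M) (K3 + 1).
  have Q10 : Q1 != 0 by rewrite gt_eqF// prodr_gt0.
  have Q30 : Q3 != 0 by rewrite gt_eqF// prodr_gt0.
  have xS : x ^+ (Sk + 2 * L k) != 0 by rewrite gt_eqF.
  rewrite le_eqVlt; apply/orP; left; apply/eqP.
  clearbody Q1 Q2 Q3; move: (x ^+ (Sk + 2 * L k)) xS (x ^+ n) => X X0 Xn.
  by field; rewrite X0 Q30 Q10.
have mgx : measurable_fun (`[- r, r]%classic : set R) (fun y => g (x, y)).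
  exact: section_measurable mg xr.
apply: le_trans (integral_ge_itv mgx (fun y => g0 (x, y)) (ltW T30) _ _ _ main).
- rewrite lee_fin.
  have h := powR_quot_lower p1 x0 x1 ka0 nup.
  rewrite -/val in h *.
  rewrite [leLHS](_ : _ = (ka `^ p / x) * (ep / 3 ^+ M)); last by ring.
  rewrite /T [leRHS](_ : _ = (val * x ^+ (2 * L k)) * (ep / 3 ^+ M)); last by ring.
  by rewrite ler_wpM2r// divr_ge0 ?ltW.
- by lra.
- by lra.
- by rewrite powR_ge0.
Qed.

End Necessity.

(** * Coefficient arrays as elements of the ring of series *)

Section Translation.
Variable R : realType.
Local Notation C := R[i].
Local Notation PS := (fps (fps C)).

Definition kst (x : C) : PS := fps_const (fps_const x).

Lemma ps_mulE (a b : PS) : ps_mul a b = a * b.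
Proof. by apply/funext => m; apply/funext => n; rewrite fps2_mulE. Qed.
Lemma ps_addE (a b : PS) : ps_add a b = a + b. Proof. by []. Qed.
Lemma ps_scaleE x (a : PS) : ps_scale x a = kst x * a.
Proof. by apply/funext => m; apply/funext => n; rewrite !fps_constME. Qed.
Lemma ps_subE (a b : PS) : ps_sub a b = a - b.
Proof.
apply/funext => m; apply/funext => n.
by rewrite /ps_sub /ps_add /ps_scale mulN1r.
Qed.
Lemma ps_oneE : ps_one R = 1 :> PS.
Proof.
apply/funext => m; apply/funext => n; rewrite /ps_one fps_oneE.
by case: (m == 0)%N.
Qed.
Lemma ps_prodE (s : seq PS) : ps_prod s = \prod_(a <- s) a.
Proof.
elim: s => [|a s IH]; first by rewrite big_nil /= ps_oneE.
by rewrite big_cons -IH -ps_mulE.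
Qed.
Lemma ps_sumE (s : seq PS) : ps_sum s = \sum_(a <- s) a.
Proof. by elim: s => [|a s IH]; rewrite ?big_nil// big_cons -IH. Qed.
Lemma ps_YE : ps_Y R = psY R.
Proof.
apply/funext => m; apply/funext => n; rewrite /ps_Y /psY /fps_const /fpsX.
by case: (m == 0)%N.
Qed.

Variables (M : nat) (L : 'I_M -> nat) (q : 'I_M -> {poly R}) (psi : 'I_M -> nat -> R).

Lemma PfacE j : Pfac (L j) (q j) = Pfactor L q j :> PS.
Proof. by rewrite /Pfac ps_YE. Qed.
Lemma bfacE j : bfac L q j psi = branch_factor L q psi j :> PS.
Proof. by rewrite /bfac ps_YE. Qed.

Lemma P_PP : P L q = Pprod L q.
Proof.
rewrite /P ps_prodE big_map big_enum/=.
by apply: eq_bigr => j _; exact: PfacE.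
Qed.

Lemma PP_perm (s : {perm 'I_M}) : Pprod (L \o s) (q \o s) = Pprod L q.
Proof. by rewrite [RHS](reindex_inj (@perm_inj _ s)). Qed.
Lemma GG_perm (s : {perm 'I_M}) : branch_prod (L \o s) (q \o s) (psi \o s) = branch_prod L q psi.
Proof. by rewrite [RHS](reindex_inj (@perm_inj _ s)). Qed.

Lemma prod_bfacE : ps_prod [seq bfac L q j psi | j <- enum 'I_M] = branch_prod L q psi.
Proof.
rewrite ps_prodE big_map big_enum/=.
by apply: eq_bigr => j _; exact: bfacE.
Qed.

Lemma FkE (u : PS) s k : Fk L q u psi s k = u * tail_prod (L \o s) (q \o s) (psi \o s) k.
Proof.
have e : ps_prod [seq bfac L q (s j) psi | j <- [seq j0 : 'I_M <- enum 'I_M | (k < j0)%N]] =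
  tail_prod (L \o s) (q \o s) (psi \o s) k.
  rewrite ps_prodE big_map big_filter big_enum_cond/=.
  apply: eq_big => [j|j _]; first by rewrite ?andbT.
  exact: bfacE.
by rewrite /Fk ps_mulE e.
Qed.

(** The coefficients are [1/2 + t/(2i)] and [1/2 - t/(2i)]; the second vanishes only for [t = i],
    excluded as [t] is real. Their sum 1 makes A + tB monic in [y]. *)
Lemma ApBE t : exists al be : C, [/\ be != 0, al + be = 1 &
  ApB L q t = kst al * Pprod L q + kst be * ps_conj (Pprod L q)].
Proof.
pose w : C := (t%:C)%C * (2 * 'i%C)^-1.
exists (2^-1 + w), (2^-1 - w); split.
- rewrite subr_eq0 /w; apply/eqP => e.
  have i0 : 2 * 'i%C != 0 :> C.
    by rewrite mulf_neq0 ?pnatr_eq0// eq_complex/= oner_eq0 andbF.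
  have := congr1 (fun x => x * (2 * 'i%C)) e.
  rewrite mulfVK// mulrA mulVf ?pnatr_eq0// mul1r => /(congr1 (@complex.Im R)) /=.
  by move/eqP; rewrite oner_eq0.
- by rewrite addrACA subrr addr0; field.
rewrite /ApB /Aser /Bser /Pbar P_PP !ps_scaleE !ps_addE ps_subE /w.
have kD x y : kst (x + y) = kst x + kst y by rewrite /kst !rmorphD.
have kN x : kst (- x) = - kst x by rewrite /kst !rmorphN.
have kM x y : kst (x * y) = kst x * kst y by rewrite /kst !rmorphM.
rewrite !kD kN kM; set A := kst _; set B := kst _; set D := kst _.
have e (a b d x y : PS) : a * (x + y) + b * (d * (x - y)) = (a + b * d) * x + (a - b * d) * y.
  by ring.
exact: e.
Qed.

Definition ymonic (a : PS) n := (forall m k, (n < k)%N -> a m k = 0) /\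
  forall m, a m n = (m == 0%N)%:R.

Lemma ymonic_factor (f : fps C) (a : PS) n : ymonic a n -> ymonic ((psY R + ofx f) * a) n.+1.
Proof.
move=> [a0 a1].
have e m k : ((psY R + ofx f) * a) m k.+1 = a m k + \sum_(i < m.+1) f i * a (m - i)%N k.+1.
  by rewrite mulrDl !fps_addE psYMES ofxME.
have s m k : (n <= k)%N -> \sum_(i < m.+1) f i * a (m - i)%N k.+1 = 0.
  by move=> nk; rewrite big1// => i _; rewrite a0 ?mulr0.
split=> [m [|k]// nk|m]; first by rewrite e s ?a0 ?addr0// ltnW.
by rewrite e s// addr0.
Qed.

Lemma ymonic_prod (F : 'I_M -> fps C) : ymonic (\prod_(j < M) (psY R + ofx (F j))) M.
Proof.
have e : size (index_enum 'I_M) = M by rewrite /index_enum -enumT size_enum_ord.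
rewrite -[X in ymonic _ X]e.
elim: (index_enum _) => [|j r IH]; last by rewrite big_cons; exact: ymonic_factor.
rewrite big_nil; split=> [m [|k]// _|m]; rewrite fps_oneE.
  by case: (m == 0)%N.
by case: (m == 0)%N.
Qed.

Lemma ymonic_conj (a : PS) n : ymonic a n -> ymonic (ps_conj a) n.
Proof.
move=> [a0 a1]; split=> [m k nk|m]; rewrite /ps_conj; first by rewrite a0// rmorph0.
by rewrite a1; case: (m == 0)%N; rewrite ?rmorph1 ?rmorph0.
Qed.

Lemma GG_x0 k : (forall j, branch_series L q psi j 0%N = 0) -> branch_prod L q psi 0%N k = (k == M)%:R.
Proof.
move=> g0.
have e : size (index_enum 'I_M) = M by rewrite /index_enum -enumT size_enum_ord.
rewrite -[X in (_ == X)]e /branch_prod; elim: (index_enum _) k => [|j r IH] k.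
  by rewrite big_nil fps_oneE/= fps_oneE; case: (k == 0)%N.
rewrite big_cons mulrDl !fps_addE ofxME big_ord1 g0 mul0r addr0.
by case: k => [|k]; rewrite ?psYME0// psYMES IH.
Qed.

(** Uniqueness in Weierstrass preparation: at [x = 0] the factor [W] is [y^M], so the lowest nonzero
    row of [v] would put into [v * W] a power of [y] at least [M], which [d] does not contain. *)
Lemma weierstrass_unit_eq0 (v W d : PS) : v * W = d ->
  (forall m k, (M <= k)%N -> d m k = 0) -> (forall k, W 0%N k = (k == M)%:R) -> v = 0.
Proof.
move=> vW d0 W0; apply/funext => m; elim/ltn_ind: m => m IH; apply/funext => n.
have := d0 m (n + M)%N (leq_addl _ _); rewrite -vW fps2_mulE big_ord_recr/= subnn.
rewrite big1 ?add0r => [|i _]; last first.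
  by rewrite big1// => j _; rewrite IH// mul0r.
have nM : (n < (n + M).+1)%N by rewrite ltnS leq_addr.
rewrite (bigD1 (Ordinal nM))//= big1 => [|j jn].
  by rewrite addr0 W0 addKn eqxx mulr1.
rewrite W0 (_ : (_ == M) = false) ?mulr0//.
apply/negbTE; apply: contra jn => /eqP e; apply/eqP/val_inj => /=.
by have := ltn_ord j; lia.
Qed.

End Translation.

(** * Stability of integrability under sums and modulo the ideal *)

Section LpQuotients.
Variables (R : realType) (p : R).
Hypothesis p1 : 1 <= p.
Local Notation C := R[i].
Local Notation PS := (fps (fps C)).
Variable den : PS.
Hypothesis denb : gbounded den.

Lemma quotD (a b : PS) : gbounded a -> gbounded b ->
  \forall z \near ((0 : R), (0 : R)), quot_fun a den z + quot_fun b den z = quot_fun (a + b) den z.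
Proof.
move=> ha hb; apply: filterS (evRD ha hb) => z.
by rewrite /quot_fun /evR => ->; rewrite mulrDl.
Qed.

Lemma LpqD (a b : PS) : gbounded a -> gbounded b ->
  Lp_loc p (quot_fun a den) -> Lp_loc p (quot_fun b den) -> Lp_loc p (quot_fun (a + b) den).
Proof. by move=> ha hb la lb; apply: Lp_near_eq (quotD ha hb) (LpD p1 la lb). Qed.

Lemma LpqB (a b : PS) : gbounded a -> gbounded b ->
  Lp_loc p (quot_fun a den) -> Lp_loc p (quot_fun b den) -> Lp_loc p (quot_fun (a - b) den).
Proof.
move=> ha hb la lb; apply: (LpqD ha (gboundedN hb) la).
apply: Lp_near_eq (LpN lb); apply: filterS (evRN hb) => z.
by rewrite /quot_fun /evR => ->; rewrite mulNr.
Qed.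

Lemma Lpq0 : Lp_loc p (quot_fun (0 : PS) den).
Proof.
have [r r0 hr] := quot_measurable (gbounded0 R) denb.
apply: (@Lp_bounded R p p1 _ r 0 r0).
  by move=> s sr; apply: hr; exact: subset_box.
apply: filterS (evR0 R) => z; rewrite /quot_fun /evR => ->.
by rewrite mul0r cabs0.
Qed.

Lemma Lpq_sum I (r : seq I) (Q : pred I) (F : I -> PS) : (forall i, gbounded (F i)) ->
  (forall i, Q i -> Lp_loc p (quot_fun (F i) den)) ->
  Lp_loc p (quot_fun (\sum_(i <- r | Q i) F i) den).
Proof.
move=> Fb h.
suff : gbounded (\sum_(i <- r | Q i) F i) /\ Lp_loc p (quot_fun (\sum_(i <- r | Q i) F i) den) by case.
elim/big_ind: _ => [|a b [ab la] [bb lb]|i Qi].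
- by split; [exact: gbounded0|exact: Lpq0].
- by split; [exact: gboundedD|exact: LpqD].
- by split; [exact: Fb|exact: h].
Qed.

(** At real points the conjugate of [den] has the modulus of [den], so the quotient is bounded by
    [|X| + |Y|]; at zeros of [den] it is 0 by the convention on division. *)
Lemma Lpq_ideal (X Y : PS) : gbounded X -> gbounded Y ->
  Lp_loc p (quot_fun (X * den + Y * ps_conj den) den).
Proof.
move=> Xb Yb; have denc := gbounded_conj denb.
have XP := gboundedM Xb denb; have YP := gboundedM Yb denc.
have [r r0 hr] := quot_measurable (gboundedD XP YP) denb.
have [K1 K10 hK1] := evR_bounded Xb; have [K2 K20 hK2] := evR_bounded Yb.
apply: (@Lp_bounded R p p1 _ r (K1 + K2) r0).
  by move=> s sr; apply: hr; exact: subset_box.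
have := near0I (near0I (evRD XP YP) (near0I (evRM Xb denb) (evRM Yb denc))) (evR_conj denb).
apply: filterS3 hK1 hK2 => z h1 h2 [[e1 [e2 e3]] e4].
rewrite /quot_fun -!/(evR _ z) e1 e2 e3 e4.
have [->|P0] := eqVneq (evR den z) 0.
  by rewrite invr0 mulr0 cabs0 addr_ge0.
have Pc : 0 < cabs (evR den z) by rewrite cabs_gt0.
rewrite cabsM cabsV ler_pdivrMr// (le_trans (cabsD _ _))// !cabsM cabs_conj mulrDl.
by apply: lerD; rewrite ler_wpM2r// ltW.
Qed.

End LpQuotients.

Theorem theorem8p1 (R : realType) (M : nat) (L : 'I_M -> nat) (q : 'I_M -> {poly R})
    (p t : R) (u : ps R) (psi : 'I_M -> nat -> R) :
  (forall j, (0 < L j)%N) ->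
  (forall j, (size (q j) <= 2 * L j)%N) ->
  (forall j, (q j).[0] = 0) ->
  1 <= p ->
  proper_factorization L q t u psi ->
  exists s : {perm 'I_M},
    forall Q : ps R, ps_convergent Q ->
      (exists c : 'I_M -> {poly R[i]},
         is_rep L q u psi s Q c /\
         (Lp_loc p (quot_fun Q (P L q)) <->
          forall k : 'I_M, forall m : nat,
            (m%:Z < Num.floor ((2 * L (s k) + 1)%:R * (1 - p^-1))
                     + (\sum_(j < M | (nat_of_ord j < nat_of_ord k)%N) Os L q s j k)%:Z)%R ->
            (c k)`_m = 0)) /\
      (forall c c' : 'I_M -> {poly R[i]},
         is_rep L q u psi s Q c -> is_rep L q u psi s Q c' -> forall k, c k = c' k).
Proof.
move=> L0 _ q0 p1 [_ _ psic fac prop].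
have qc0 j : (q j)`_0 = 0 by rewrite -horner_coef0 q0.
have [al [be [be0 albe GE]]] := ApBE L q t.
(* A + tB and the product of the branches are both monic of degree [M] in [y], so [(u - 1)] times
   that product has degree below [M]. *)
have u1 : u = 1 :> fps (fps R[i]).
  move: fac; rewrite ps_mulE prod_bfacE GE => fac.
  apply/eqP; rewrite -subr_eq0; apply/eqP.
  have [P0 P1] := ymonic_prod (Pseries L q).
  have [C0 C1] := ymonic_conj (ymonic_prod (Pseries L q)).
  have [G0 G1] := ymonic_prod (branch_series L q psi).
  apply: (@weierstrass_unit_eq0 R M ((u : fps (fps R[i])) - 1) (branch_prod L q psi)
    (kst al * Pprod L q + kst be * ps_conj (Pprod L q) - branch_prod L q psi)).
  - by rewrite fac mulrBl mul1r.
  - move=> m k; rewrite !(fps_subE, fps_addE) !fps_constME leq_eqVlt => /orP[/eqP <-|kM].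
      rewrite [Pprod _ _ _ _]P1 [ps_conj _ _ _]C1 [branch_prod _ _ _ _ _]G1 -mulrDl albe mul1r.
      by rewrite subrr.
    by rewrite [Pprod _ _ _ _]P0// [ps_conj _ _ _]C0// [branch_prod _ _ _ _ _]G0// !mulr0 addr0 subr0.
  - by move=> k; apply: GG_x0 => j; exact: gs0.
pose th : R := 1 - p^-1.
(* The demand of index [i] within [S], without the floor and with [2 L_i] in place of [2 L_i + 1]:
   the omitted [1 - 1/p] is the same for all indices, and comparing before rounding is what
   [exponent_choice] requires. *)
pose w (S : {set 'I_M}) (i : 'I_M) : R :=
  (\sum_(x in S | x != i) contact L q x i)%:R + (2 * L i)%:R * th.
have [s hgreedy] := greedy_perm w.
exists s.
pose L' := L \o s; pose q' := q \o s; pose psi' := psi \o s.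
have L0' j : (0 < L' j)%N by exact: L0.
have q0' j : (q' j)`_0 = 0 by exact: qc0.
have psic' j : rseries_convergent (psi' j) by exact: psic.
have prop' i j : i != j -> ord_is (fun m => (q' j - q' i)`_m + xshift (2 * L' j) (psi' j) m
    - xshift (2 * L' i) (psi' i) m) (contact L' q' i j).
  by move=> ij; apply: prop; rewrite (inj_eq perm_inj).
have order (i k : 'I_M) : (i <= k)%N ->
  (\sum_(j < M | (j <= k)%N && (j != i)) contact L' q' j i)%:R + (2 * L' i)%:R * th <=
  (\sum_(j < M | (j <= k)%N && (j != k)) contact L' q' j k)%:R + (2 * L' k)%:R * th.
  have wE (i0 : 'I_M) : w [set s j | j : 'I_M & (j <= k)%N]%SET (s i0) =
    (\sum_(j < M | (j <= k)%N && (j != i0)) contact L' q' j i0)%:R + (2 * L' i0)%:R * th.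
    rewrite /w (reindex_inj (@perm_inj _ s))/=; congr (_%:R + _).
    apply: eq_bigl => j; rewrite (inj_eq perm_inj) mem_imset ?inE//; exact: perm_inj.
  by move=> ik; rewrite -!wE; exact: hgreedy.
have PE : P L q = Pprod L' q' by rewrite P_PP PP_perm.
pose Pb := ps_conj (Pprod L' q').
have PbE : Pbar L q = Pb by rewrite /Pbar PE.
have GE' : branch_prod L' q' psi' = kst al * Pprod L' q' + kst be * Pb.
  by rewrite GG_perm -[branch_prod L q psi]mul1r -u1 -prod_bfacE -ps_mulE -fac GE -P_PP PE.
have NE k : (2 * L (s k) + \sum_(j < M | j != k) Os L q s j k = \sum_(j < M) contact_full L' q' j k)%N.
  rewrite [RHS](bigD1 k)//= {1}/contact_full eqxx; congr (_ + _)%N.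
  by apply: eq_bigr => j jk; rewrite /contact_full (negbTE jk).
have sumE (c : 'I_M -> {poly R[i]}) :
  ps_sum [seq ps_mul (ps_polyx (c k)) (Fk L q u psi s k) | k <- enum 'I_M] =
  \sum_(k < M) ofx (polyf (c k)) * tail_prod L' q' psi' k.
  rewrite ps_sumE big_map big_enum/=; apply: eq_bigr => k _.
  by rewrite ps_mulE FkE u1 mul1r.
have PPb := gbounded_PP L' q'.
have Fb (c : 'I_M -> {poly R[i]}) k := gbounded_term L' q' psic' (c k) k.
have kb (x : R[i]) : gbounded (kst x) by exact: gbounded_const.
move=> Q /convergent_gbounded Qb; split; last first.
  move=> c c' [cN [a1 [b1 [_ [_ E1]]]]] [cN' [a2 [b2 [_ [_ E2]]]]] k.
  rewrite !ps_mulE ps_addE ps_subE sumE PE PbE in E1.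
  rewrite !ps_mulE ps_addE ps_subE sumE PE PbE in E2.
  apply/eqP; rewrite -subr_eq0; apply/eqP.
  (* Since [be] is nonzero, Pbar is recovered from P and A + tB, so the relation can be stated in
     the ideal handled by [core_rep_uniq]. *)
  have bV : kst be * kst be^-1 = 1 by rewrite /kst -!rmorphM/= divff// !rmorph1.
  have PbG : Pb = kst be^-1 * (branch_prod L' q' psi' - kst al * Pprod L' q').
    by rewrite GE' [_ + _ - _]addrAC subrr add0r mulrA [kst _ * kst _]mulrC bV mul1r.
  apply: (@core_rep_uniq R M L' q' psi' L0' q0' psic' prop' (fun k => c k - c' k)
    ((a2 : fps (fps R[i])) - a1 - ((b2 : fps (fps R[i])) - b1) * kst be^-1 * kst al)
    (((b2 : fps (fps R[i])) - b1) * kst be^-1)).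
    move=> j; rewrite -NE (leq_trans (size_polyD _ _))// size_polyN geq_max.
    by rewrite cN cN'.
  have -> : \sum_(k0 < M) ofx (polyf (c k0 - c' k0)) * tail_prod L' q' psi' k0 =
    (\sum_(k0 < M) ofx (polyf (c k0)) * tail_prod L' q' psi' k0) -
    (\sum_(k0 < M) ofx (polyf (c' k0)) * tail_prod L' q' psi' k0).
    rewrite -sumrB; apply: eq_bigr => j _; rewrite -mulrBl -rmorphB/=.
    by congr (ofx _ * _); apply/funext => m; rewrite fps_subE /polyf coefB.
  have -> : \sum_(k0 < M) ofx (polyf (c k0)) * tail_prod L' q' psi' k0 =
    (Q : fps (fps R[i])) - ((a1 : fps (fps R[i])) * Pprod L' q' + (b1 : fps (fps R[i])) * Pb) by rewrite -E1 opprB addrC subrK.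
  have -> : \sum_(k0 < M) ofx (polyf (c' k0)) * tail_prod L' q' psi' k0 =
    (Q : fps (fps R[i])) - ((a2 : fps (fps R[i])) * Pprod L' q' + (b2 : fps (fps R[i])) * Pb) by rewrite -E2 opprB addrC subrK.
  by rewrite PbG; ring.
have [c [a [b [cN ab bb QE]]]] := core_rep_exists L0' q0' psic' prop' Qb.
pose X := a + b * kst al; pose Y := b * kst be.
have Xb : gbounded X by apply: gboundedD => //; exact: gboundedM.
have Yb : gbounded Y by exact: gboundedM.
set S := \sum_(k < M) _ in QE.
have Sb : gbounded S by apply: gbounded_sum => k _; exact: Fb.
have QE' : Q = S + (X * Pprod L' q' + Y * Pb) :> fps (fps R[i]).
  by rewrite QE GE' /X /Y; ring.
exists c; split.
  split; first by move=> k; rewrite NE.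
  exists X, Y; split; first exact: gbounded_convergent.
  split; first exact: gbounded_convergent.
  rewrite !ps_mulE ps_addE ps_subE sumE PE PbE QE' -/S.
  by rewrite addrAC subrr add0r.
have Ib : gbounded (X * Pprod L' q' + Y * Pb).
  by apply: gboundedD; apply: gboundedM => //; exact: gbounded_conj.
have LI := Lpq_ideal p1 PPb Xb Yb.
(* [Q] and its representative differ by an element of the ideal, whose quotient is integrable by
   [Lpq_ideal]. *)
have -> : Lp_loc p (quot_fun Q (P L q)) <-> Lp_loc p (quot_fun S (Pprod L' q')).
  rewrite PE; split=> h; last by rewrite QE'; exact: (LpqD p1 Sb Ib h LI).
  have -> : S = (Q : fps (fps R[i])) - (X * Pprod L' q' + Y * Pb) by rewrite QE' addrK.
  exact: (LpqB p1 Qb Ib h LI).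
split=> [hS|hc].
  (* Descent on the number of remaining terms: once the top coefficient is known to vanish to its
     order, sufficiency makes its term integrable, and it is subtracted. *)
  suff nec n : (n <= M)%N ->
    Lp_loc p (quot_fun (\sum_(k < M | (k < n)%N) ofx (polyf (c k)) * tail_prod L' q' psi' k) (Pprod L' q')) ->
    forall k : 'I_M, (k < n)%N -> forall m : nat,
      (m%:Z < Num.floor ((2 * L' k + 1)%:R * (1 - p^-1))
        + (\sum_(j < M | (nat_of_ord j < nat_of_ord k)%N) contact L' q' j k)%:Z)%R -> (c k)`_m = 0.
    move=> k; apply: (nec M (leqnn M)); last exact: ltn_ord.
    rewrite (eq_bigl xpredT) => [|j]; last by rewrite ltn_ord.
    exact: hS.
  elim: n => // n IH nM hn.
  pose k0 := Ordinal nM.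
  have top := top_coef_necessary L0' q0' psic' prop' p1 (k := k0) hn.
  move=> k; rewrite ltnS leq_eqVlt => /orP[/eqP kn|kn]; last first.
    apply: IH kn; first exact: ltnW.
    have LT := term_integrable psic' prop' p1 order top.
    have Tb := Fb c k0.
    have Snb : gbounded (\sum_(k < M | (k < n.+1)%N) ofx (polyf (c k)) * tail_prod L' q' psi' k).
      by apply: gbounded_sum => j _; exact: Fb.
    have := LpqB p1 Snb Tb hn LT; congr (Lp_loc _ (quot_fun _ _)).
    rewrite (bigD1 k0)//= addrAC subrr add0r; apply: eq_bigl => j.
    by rewrite ltnS -(inj_eq val_inj)/= [RHS]ltn_neqAle andbC.
  by have -> : k = k0 by exact: val_inj.
apply: (Lpq_sum p1 PPb) => [k|k _]; first exact: Fb.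
by apply: (term_integrable psic' prop' p1 order) => m; exact: hc.
Qed.
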